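(* Let $x,y\in\Sigma^n$, where each symbol of $\Sigma$ can be stored with $O(\log n)$ bits, and suppose we have one-pass streaming access to $x$ and random access to $y$. For any constant $\delta\in(0,\frac12)$, there is a deterministic algorithm that, making one pass through $x$, outputs an $O(2^{1/\delta})$-approximation of $\mathsf{ED}(x,y)$ in $\tilde{O}_\delta(n^4)$ time using $O(\frac{n^\delta}{\delta}\log n)$ bits of space.
   Context: $\mathsf{ED}(x,y)$ is the minimum number of single-character insertions, deletions and substitutions needed to transform $x$ into $y$. An $\alpha$-approximation of $\mathsf{ED}(x,y)$ is a number $d$ with $\mathsf{ED}(x,y)\le d\le\alpha\,\mathsf{ED}(x,y)$. In this streaming model $x$ can only be read once from left to right, while any position of $y$ can be queried at any time; space is the working memory in bits. $\tilde{O}_\delta$ hides polylogarithmic factors in $n$ and constants depending on $\delta$. *)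

(* Defs.v *)
From Stdlib Require Import Reals List Arith.
Import ListNotations.

Inductive edit1 : list nat -> list nat -> Prop :=
| e_ins (u v : list nat) (a : nat) : edit1 (u ++ v) (u ++ a :: v)
| e_del (u v : list nat) (a : nat) : edit1 (u ++ a :: v) (u ++ v)
| e_sub (u v : list nat) (a b : nat) : edit1 (u ++ a :: v) (u ++ b :: v).

Inductive edits : nat -> list nat -> list nat -> Prop :=
| edits0 (s : list nat) : edits 0 s s
| editsS (k : nat) (s t u : list nat) : edit1 s t -> edits k t u -> edits (S k) s u.

Definition is_ED (x y : list nat) (e : nat) : Prop :=
  edits e x y /\ forall k, edits k x y -> e <= k.

(* A deterministic logarithmic-cost RAM with unbounded nat registers.
   Register i holds (nth i mem 0).  The only access to x is IReadX, which
   reads the next symbol of x (one left-to-right pass); y is accessed by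
   random-access queries IQueryY. *)
Inductive instr : Type :=
| IConst (r k : nat)
| IAdd (r a b : nat)
| ISub (r a b : nat)            (* R[r] := R[a] - R[b] (truncated) *)
| IMul (r a b : nat)
| IDiv (r a b : nat)            (* R[r] := R[a] / R[b] (0 if R[b]=0) *)
| ILt (r a b : nat)
| IEq (r a b : nat)
| ILoad (r a : nat)
| IStore (a r : nat)
| IJz (a target : nat)
| IJmp (target : nat)
| IReadX (r : nat)              (* R[r] := next symbol of x (0 if exhausted) *)
| IQueryY (r a : nat)           (* R[r] := y[R[a]] (0-indexed; 0 if out of range) *)
| IHalt (r : nat).

Record config : Type := Config { pc : nat; mem : list nat; pos : nat }.

Definition get (m : list nat) (i : nat) : nat := nth i m 0.

Fixpoint set (m : list nat) (i v : nat) : list nat :=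
  match m, i with
  | [], 0 => [v]
  | [], S i' => 0 :: set [] i' v
  | _ :: m', 0 => v :: m'
  | a :: m', S i' => a :: set m' i' v
  end.

Definition bitlen (v : nat) : nat := S (Nat.log2 v).

Definition space (c : config) : nat := fold_right (fun v acc => bitlen v + acc) 0 (mem c).

Definition b2n (b : bool) : nat := if b then 1 else 0.

Definition step (p : list instr) (x y : list nat) (c : config) : option (config * nat) :=
  let m := mem c in
  let nx := S (pc c) in
  let arith r a b f :=
      let va := get m a in let vb := get m b in let v := f va vb in
      Some (Config nx (set m r v) (pos c), 1 + bitlen va + bitlen vb + bitlen v) in
  match nth_error p (pc c) with
  | None => None
  | Some i =>
    match i with
    | IConst r k => Some (Config nx (set m r k) (pos c), 1 + bitlen k)
    | IAdd r a b => arith r a b Nat.add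
    | ISub r a b => arith r a b Nat.sub
    | IMul r a b => arith r a b Nat.mul
    | IDiv r a b => arith r a b Nat.div
    | ILt r a b => arith r a b (fun u v => b2n (Nat.ltb u v))
    | IEq r a b => arith r a b (fun u v => b2n (Nat.eqb u v))
    | ILoad r a =>
        let ad := get m a in let v := get m ad in
        Some (Config nx (set m r v) (pos c), 1 + bitlen ad + bitlen v)
    | IStore a r =>
        let ad := get m a in let v := get m r in
        Some (Config nx (set m ad v) (pos c), 1 + bitlen ad + bitlen v)
    | IJz a t =>
        let v := get m a in
        Some (Config (if Nat.eqb v 0 then t else nx) m (pos c), 1 + bitlen v)
    | IJmp t => Some (Config t m (pos c), 1)
    | IReadX r =>
        let v := nth (pos c) x 0 in
        Some (Config nx (set m r v) (S (pos c)), 1 + bitlen v)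
    | IQueryY r a =>
        let ad := get m a in let v := nth ad y 0 in
        Some (Config nx (set m r v) (pos c), 1 + bitlen ad + bitlen v)
    | IHalt _ => None
    end
  end.

Inductive exec (p : list instr) (x y : list nat) : config -> nat -> nat -> nat -> Prop :=
| exec_halt (c : config) (r s : nat) :
    nth_error p (pc c) = Some (IHalt r) -> space c <= s ->
    exec p x y c 1 s (get (mem c) r)
| exec_step (c c' : config) (k t s d : nat) :
    step p x y c = Some (c', k) -> space c <= s ->
    exec p x y c' t s d -> exec p x y c (k + t) s d.

Definition init (n : nat) : config := Config 0 [n] 0.

(* Main.v *)
(** With b about n^(1/T) and T about 1/delta, a block of b^(t+1) symbols of x is read as b
    blocks of b^t symbols.  A block of x is remembered only through a window of y nearest to
    it up to a factor alpha_t, together with a bound on their distance, so one number per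
    block and T*b numbers in all are kept.  The b windows of the children stand for their
    parent, and the window of y nearest to their concatenation is searched by dynamic
    programming over the cut points.  For each guess D = 2^k of the distance only about K*b
    cut points, spaced D/(K*b) apart around the diagonal, are tried at each step.  The
    distance of two windows of y is computed by the same recursion, which needs no storage
    since y can be queried again, and loses only a factor (1 + 6/K)^T.  By the triangle
    inequality alpha_(t+1) = alpha_t + (1 + 1/T)(alpha_t + 1), whence alpha_T = O(2^T).

    The space bound has to hold with a constant independent of delta, so inputs shorter than a
    threshold depending on delta are handled by a decision tree built into the program. *)

(* The exponent 4 is one factor n for the left end of the window that is searched, times n^3 for the
   comparisons: each level of the recursion on windows of y tries about b blocks and about b cut
   points at either end of each, and b^(3T) is about n^3. The empty window always competes, so a
   stored distance never exceeds the length of its block and a stored window is at most twice as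
   long as the block; hence windows of y are divided into 2b pieces per level, not b. With K =
   6(T+1)^2 the loss in comparing windows is at most 1 + 1/T, and 1/T strictly below delta leaves a
   positive power of n that swallows every factor depending on delta once n is large. The machine
   charges every bit of every register, so the algorithm is written in a small expression language
   whose arithmetic saturates at a polynomial V in n. V doubles as infinite cost, and loop bounds
   are fixed parameters, so that running times follow from the syntax and the parameters alone. *)
Require Import Defs.
From Stdlib Require Import Reals List Arith ZArith Lra Lia ClassicalEpsilon FunctionalExtensionality.
Import ListNotations.

(** * Alignments and edit distance *)

(* [al k x y]: some alignment of x and y costs at most k. *)
Inductive al : nat -> list nat -> list nat -> Prop :=
| al_nil k : al k [] []
| al_ins k a x y : al k x y -> al (S k) x (a :: y)
| al_del k a x y : al k x y -> al (S k) (a :: x) y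
| al_eq k a x y : al k x y -> al k (a :: x) (a :: y)
| al_sub k a b x y : al k x y -> al (S k) (a :: x) (b :: y).

Lemma al_le k k' x y : al k x y -> k <= k' -> al k' x y.
Proof.
  intros H; revert k'; induction H; intros k' Hk; try (constructor; fail);
    try (destruct k' as [|k']; [lia|]); try (constructor; apply IHal; lia).
Qed.

Lemma al_refl k x : al k x x.
Proof. induction x; constructor; auto. Qed.

Lemma al_app k k' x y x' y' : al k x y -> al k' x' y' -> al (k + k') (x ++ x') (y ++ y').
Proof.
  intros H H'; induction H; simpl; try (constructor; auto; fail).
  apply (al_le k'); auto; lia.
Qed.

Lemma al_sym k x y : al k x y -> al k y x.
Proof. induction 1; [apply al_nil|apply al_del|apply al_ins|apply al_eq|apply al_sub]; auto. Qed.

Lemma al_length k x y : al k x y -> length y <= length x + k /\ length x <= length y + k.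
Proof. induction 1; simpl; lia. Qed.

Lemma al_nil_l y : al (length y) [] y.
Proof. induction y; simpl; constructor; auto. Qed.

Lemma al_max x y : al (Nat.max (length x) (length y)) x y.
Proof.
  revert y; induction x as [|a x IH]; intros y; simpl.
  - apply al_nil_l.
  - destruct y as [|b y]; simpl.
    + apply al_del. apply (al_sym _ _ _ (al_nil_l x)).
    + apply al_sub; apply IH.
Qed.

(** Alignments are built from the front, so cutting x after x1 cuts the derivation in two.
    [grid_complete] and [dsum_spec] take from here the cut points that an arbitrary alignment
    induces in y. *)
Lemma al_split k x1 x2 y : al k (x1 ++ x2) y ->
  exists k1 k2 y1 y2, k = k1 + k2 /\ y = y1 ++ y2 /\ al k1 x1 y1 /\ al k2 x2 y2.
Proof.
  intros H; remember (x1 ++ x2) as x eqn:E; revert x1 x2 E.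
  induction H; intros x1 x2 E.
  - symmetry in E; apply app_eq_nil in E as [-> ->].
    exists 0, k, [], []; repeat split; auto; constructor.
  - destruct (IHal _ _ E) as (k1 & k2 & y1 & y2 & -> & -> & H1 & H2).
    exists (S k1), k2, (a :: y1), y2; repeat split; auto; constructor; auto.
  - destruct x1 as [|a' x1]; simpl in E; [subst x2|injection E as <- E].
    + exists 0, (S k), [], y; repeat split; auto; constructor; auto.
    + destruct (IHal _ _ E) as (k1 & k2 & y1 & y2 & -> & -> & H1 & H2).
      exists (S k1), k2, y1, y2; repeat split; auto; constructor; auto.
  - destruct x1 as [|a' x1]; simpl in E; [subst x2|injection E as <- E].
    + exists 0, k, [], (a :: y); repeat split; auto; constructor; auto.
    + destruct (IHal _ _ E) as (k1 & k2 & y1 & y2 & -> & -> & H1 & H2).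
      exists k1, k2, (a :: y1), y2; repeat split; auto; constructor; auto.
  - destruct x1 as [|a' x1]; simpl in E; [subst x2|injection E as <- E].
    + exists 0, (S k), [], (b :: y); repeat split; auto; try (apply al_sub; auto; fail); constructor.
    + destruct (IHal _ _ E) as (k1 & k2 & y1 & y2 & -> & -> & H1 & H2).
      exists (S k1), k2, (b :: y1), y2; repeat split; auto; apply al_sub; auto.
Qed.

(** The alternatives at the bottom of the recursion: the symbol is not matched and every symbol of y
    costs 1, or it is matched and one symbol of y is free. *)
Lemma al_single k a y : al k [a] y ->
  1 <= k /\ length y <= k \/ In a y /\ length y <= S k.
Proof.
  intros H; remember [a] as x eqn:E; revert E; induction H; intros E; try discriminate; simpl.
  - destruct (IHal E) as [|[]]; [left; lia|right; split; auto; lia].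
  - injection E as -> ->. apply al_length in H as []; simpl in *; left; lia.
  - injection E as -> ->. apply al_length in H as []; simpl in *; right; split; auto; lia.
  - injection E as -> ->. apply al_length in H as []; simpl in *; left; lia.
Qed.

Lemma al_zero x y : al 0 x y -> x = y.
Proof.
  intros H; remember 0 as k eqn:E; revert E; induction H; intros E; try discriminate; f_equal; auto.
Qed.

(** An edit is local: split the remaining alignment around its position, and only the middle part
    has to be replaced, at a price of at most 1. *)
Lemma al_edit1 k s t u : edit1 s t -> al k t u -> al (S k) s u.
Proof.
  intros E H; destruct E as [p v a|p v a|p v a b];
    apply al_split in H as (k1 & k2 & u1 & u2 & -> & -> & H1 & H2).
  - change (a :: v) with ([a] ++ v) in H2.
    apply al_split in H2 as (j1 & j2 & w1 & w2 & -> & -> & H2 & H3).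
    replace (S (k1 + (j1 + j2))) with (k1 + (S j1 + j2)) by lia.
    apply al_app; auto. apply (al_app _ _ []); auto.
    apply al_le with (length w1); [apply al_nil_l|].
    apply al_length in H2; simpl in *; lia.
  - replace (S (k1 + k2)) with (k1 + S k2) by lia.
    apply al_app; auto. constructor; auto.
  - change (b :: v) with ([b] ++ v) in H2; change (a :: v) with ([a] ++ v).
    apply al_split in H2 as (j1 & j2 & w1 & w2 & -> & -> & H2 & H3).
    replace (S (k1 + (j1 + j2))) with (k1 + (S j1 + j2)) by lia.
    apply al_app; auto. apply al_app; auto.
    apply al_length in H2; simpl in H2.
    apply al_le with (Nat.max (length [a]) (length w1)); [apply al_max|change (length [a]) with 1; lia].
Qed.

Lemma al_of_edits k x y : edits k x y -> al k x y.
Proof. induction 1; [apply al_refl|eapply al_edit1; eauto]. Qed.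

Lemma edits_trans k k' x y z : edits k x y -> edits k' y z -> edits (k + k') x z.
Proof. induction 1; simpl; auto. intros; econstructor; eauto. Qed.

Lemma edits_cons a k x y : edits k x y -> edits k (a :: x) (a :: y).
Proof.
  induction 1 as [|k s t u E H IH]; econstructor; [|exact IH].
  destruct E as [u0 v b|u0 v b|u0 v b b'];
    [apply (e_ins (a :: u0))|apply (e_del (a :: u0))|apply (e_sub (a :: u0))].
Qed.

Lemma edits_of_al k x y : al k x y -> exists k', k' <= k /\ edits k' x y.
Proof.
  induction 1 as [k|k a x y H [k' [Hk E]]|k a x y H [k' [Hk E]]
                 |k a x y H [k' [Hk E]]|k a b x y H [k' [Hk E]]].
  - exists 0; split; [lia|constructor].
  - exists (S k'); split; [lia|]. econstructor; [apply (e_ins [] x a)|].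
    simpl. apply edits_cons; auto.
  - exists (S k'); split; [lia|]. econstructor; [apply (e_del [] x a)|]; auto.
  - exists k'; split; auto. apply edits_cons; auto.
  - exists (S k'); split; [lia|]. econstructor; [apply (e_sub [] x a b)|].
    simpl. apply edits_cons; auto.
Qed.

(** Composing alignments directly would need a case analysis on pairs of columns; for edit sequences
    it is mere concatenation, so the triangle inequality is borrowed from there. *)
Lemma al_trans k k' x y z : al k x y -> al k' y z -> al (k + k') x z.
Proof.
  intros H H'. apply edits_of_al in H as (j & Hj & H); apply edits_of_al in H' as (j' & Hj' & H').
  apply al_le with (j + j'); [|lia]. apply al_of_edits. eapply edits_trans; eauto.
Qed.

Lemma is_ED_exists x y : exists e, is_ED x y e.
Proof.
  destruct (edits_of_al _ _ _ (al_max x y)) as (m & _ & H).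
  revert H; induction m as [m IH] using (well_founded_induction lt_wf); intros H.
  destruct (classic (exists k, k < m /\ edits k x y)) as [(k & Hk & Ek)|N].
  - eapply IH; eauto.
  - exists m; split; auto. intros k Ek. destruct (le_lt_dec m k); auto. destruct N; eauto.
Qed.

Lemma is_ED_al x y e : is_ED x y e -> al e x y /\ forall k, al k x y -> e <= k.
Proof.
  intros [H M]; split; [apply al_of_edits; auto|].
  intros k Hk. apply edits_of_al in Hk as (k' & L & Hk). apply M in Hk; lia.
Qed.

(** * Windows of a string *)

Definition sub (w : list nat) (i j : nat) : list nat := firstn (j - i) (skipn i w).

Lemma sub_length w i j : j <= length w -> length (sub w i j) = j - i.
Proof. intros; unfold sub. rewrite length_firstn, length_skipn. lia. Qed.

Lemma sub_app w i j k : i <= j -> j <= k -> sub w i j ++ sub w j k = sub w i k.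
Proof.
  intros; unfold sub. replace (k - i) with ((j - i) + (k - j)) by lia.
  replace (skipn j w) with (skipn (j - i) (skipn i w))
    by (rewrite skipn_skipn; f_equal; lia).
  generalize (skipn i w) as z, (j - i) as a, (k - j) as b; intros z a.
  revert z; induction a; intros z b; simpl; auto.
  destruct z; simpl; [destruct b; auto|]. f_equal; auto.
Qed.

Lemma sub_empty w i j : j <= i -> sub w i j = [].
Proof. intros; unfold sub. replace (j - i) with 0 by lia. reflexivity. Qed.

Lemma sub_full w : sub w 0 (length w) = w.
Proof. unfold sub. rewrite Nat.sub_0_r, skipn_0. apply firstn_all. Qed.

Lemma sub_single w i : i < length w -> sub w i (S i) = [nth i w 0].
Proof.
  intros H; unfold sub. replace (S i - i) with 1 by lia.
  revert i H; induction w; intros [|i] H; simpl in *; try lia; auto. apply IHw; lia.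
Qed.

Lemma sub_In w i j a : In a (sub w i j) -> j <= length w -> exists k, i <= k < j /\ nth k w 0 = a.
Proof.
  intros H L. apply In_nth with (d := 0) in H as (k & Hk & E).
  rewrite sub_length in Hk by auto. exists (i + k); split; [lia|].
  rewrite <- E. unfold sub. rewrite nth_firstn, nth_skipn.
  destruct (Nat.ltb_spec k (j - i)); auto; lia.
Qed.

(** The price of rounding both ends of a window down. If the windows overlap, trim one side and
    extend the other; if q' < p, comparing lengths is enough. *)
Lemma al_window w p q p' q' : p' <= p -> q' <= q -> p <= q -> p' <= q' -> q <= length w ->
  al ((p - p') + (q - q')) (sub w p q) (sub w p' q').
Proof.
  intros. destruct (le_lt_dec p q').
  - rewrite <- (sub_app w p' p q'), <- (sub_app w p q' q) by lia.
    rewrite <- (app_nil_r (sub w p' p ++ sub w p q')), <- app_assoc.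
    change (sub w p q' ++ sub w q' q) with ([] ++ (sub w p q' ++ sub w q' q)).
    apply al_app.
    + eapply al_le; [apply al_nil_l|]. rewrite sub_length; lia.
    + change (q - q') with (0 + (q - q')). apply al_app; [apply al_refl|].
      apply al_sym. eapply al_le; [apply al_nil_l|]. rewrite sub_length; lia.
  - eapply al_le; [apply al_max|]. rewrite !sub_length by lia. lia.
Qed.

(** * Weakest preconditions for the RAM *)

Lemma get_set m r v i : get (set m r v) i = if Nat.eqb i r then v else get m i.
Proof.
  unfold get; revert m i; induction r as [|r IH]; intros [|a m] [|i]; simpl; auto.
  - destruct i; reflexivity.
  - rewrite IH. destruct (Nat.eqb i r); auto. destruct i; reflexivity.
Qed.

Lemma set_length m r v : length (set m r v) <= Nat.max (length m) (S r).
Proof.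
  revert m; induction r as [|r IH]; intros [|a m]; simpl; try lia.
  - specialize (IH []); simpl in IH; lia.
  - specialize (IH m); lia.
Qed.

Lemma bitlen_mono a b : a <= b -> bitlen a <= bitlen b.
Proof. intros; unfold bitlen. apply le_n_S, Nat.log2_le_mono; auto. Qed.

(** Jump targets are absolute, so a fragment is a function of the address where it is placed. *)
Definition code := nat -> list instr.
Definition block (l : list instr) : code := fun _ => l.
Definition cseq (c1 c2 : code) : code := fun st => c1 st ++ c2 (st + length (c1 st)).
Definition loopc (s1 rc rb : nat) (body : code) : code := fun st =>
  let bd := body (st + 2) in
  [ILt s1 rc rb; IJz s1 (st + length bd + 5)] ++ bd ++ [IConst s1 1; IAdd rc rc s1; IJmp st].
Definition ite (r : nat) (c1 c2 : code) : code := fun st =>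
  let b1 := c1 (st + 1) in
  let b2 := c2 (st + length b1 + 2) in
  [IJz r (st + length b1 + 2)] ++ b1 ++ [IJmp (st + length b1 + 2 + length b2)] ++ b2.

Definition eff (y : list nat) (x : list nat) (i : instr) (g : nat -> nat) (pos : nat) : option (nat * nat * nat) :=
  match i with
  | IConst r k => Some (r, k, pos)
  | IAdd r a b => Some (r, g a + g b, pos)
  | ISub r a b => Some (r, g a - g b, pos)
  | IMul r a b => Some (r, g a * g b, pos)
  | IDiv r a b => Some (r, g a / g b, pos)
  | ILt r a b => Some (r, b2n (Nat.ltb (g a) (g b)), pos)
  | IEq r a b => Some (r, b2n (Nat.eqb (g a) (g b)), pos)
  | ILoad r a => Some (r, g (g a), pos)
  | IStore a r => Some (g a, g r, pos)
  | IReadX r => Some (r, nth pos x 0, S pos)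
  | IQueryY r a => Some (r, nth (g a) y 0, pos)
  | _ => None
  end.

Section Machine.
Variables (p : list instr) (x y : list nat) (S0 Z : nat).

(** No instruction is charged for more than three values, and none of them exceeds Z. *)
Definition tau := 1 + 3 * bitlen Z.
Definition sp := S0 * bitlen Z.

Definition bounded (m : list nat) := length m <= S0 /\ forall i, get m i <= Z.

Lemma space_bounded pc m pos : bounded m -> space (Config pc m pos) <= sp.
Proof.
  intros [L B]; unfold space, sp; cbn [mem].
  apply Nat.le_trans with (length m * bitlen Z); [|apply Nat.mul_le_mono_r; auto].
  clear L. induction m as [|a m IH]; [simpl; lia|].
  cbn [fold_right length Nat.mul]. apply Nat.add_le_mono.
  - apply bitlen_mono. apply (B 0).
  - apply IH. intros i. apply (B (S i)).
Qed.

Lemma bounded_set m r v : bounded m -> r < S0 -> v <= Z -> bounded (set m r v).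
Proof.
  intros [L B] Hr Hv; split.
  - pose proof (set_length m r v); lia.
  - intros i. rewrite get_set. destruct (Nat.eqb i r); auto.
Qed.

(** Stated backwards, on completed executions, because [exec] grows from the halting configuration.
    Composition is then composition of implications, and [exec] itself carries the space bound. *)
Definition reach (c c' : config) (N : nat) :=
  forall t d, exec p x y c' t sp d -> exists t', t' <= N * tau + t /\ exec p x y c t' sp d.

Lemma reach_refl c : reach c c 0.
Proof. intros t d H; exists t; split; auto. Qed.

Lemma reach_trans c1 c2 c3 N1 N2 : reach c1 c2 N1 -> reach c2 c3 N2 -> reach c1 c3 (N1 + N2).
Proof.
  intros H1 H2 t d H. destruct (H2 _ _ H) as (t2 & L2 & E2).
  destruct (H1 _ _ E2) as (t1 & L1 & E1). exists t1; split; auto.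
  rewrite Nat.mul_add_distr_r. lia.
Qed.

Lemma reach_le c c' N N' : reach c c' N -> N <= N' -> reach c c' N'.
Proof.
  intros H L t d E. destruct (H _ _ E) as (t' & L' & E'). exists t'; split; auto.
  pose proof (Nat.mul_le_mono_r _ _ tau L). lia.
Qed.

Lemma reach_step c c' k : step p x y c = Some (c', k) -> bounded (mem c) -> k <= tau -> reach c c' 1.
Proof.
  intros H B K t d E. exists (k + t); split; [lia|].
  eapply exec_step; eauto. destruct c; apply space_bounded; auto.
Qed.

Definition code_at (st : nat) (l : list instr) :=
  forall i ins, nth_error l i = Some ins -> nth_error p (st + i) = Some ins.

Lemma code_at_app st l1 l2 : code_at st (l1 ++ l2) -> code_at st l1 /\ code_at (st + length l1) l2.
Proof.
  intros H; split; intros i ins E.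
  - apply H. rewrite nth_error_app1; auto. apply nth_error_Some; congruence.
  - rewrite <- Nat.add_assoc. apply H. rewrite nth_error_app2 by lia.
    rewrite <- E. f_equal; lia.
Qed.

Lemma code_at_cons st i l : code_at st (i :: l) -> nth_error p st = Some i /\ code_at (st + 1) l.
Proof.
  intros H; split.
  - rewrite <- (Nat.add_0_r st). apply H; reflexivity.
  - apply (code_at_app st [i] l H).
Qed.

(** Registers are seen through a function g rather than a list, and the address is universally
    quantified, so that triples compose wherever the code lies. N counts instructions; logarithmic
    costs enter only through [tau]. *)
Definition wp (c : code) (N : nat) (Q : (nat -> nat) -> nat -> Prop) (g : nat -> nat) (pos : nat) :=
  forall st m, code_at st (c st) -> bounded m -> (forall i, get m i = g i) ->
  exists m' pos', reach (Config st m pos) (Config (st + length (c st)) m' pos') N /\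
    bounded m' /\ Q (get m') pos'.

Lemma wp_mono c N N' (Q Q' : (nat -> nat) -> nat -> Prop) g pos :
  wp c N Q g pos -> N <= N' -> (forall g' p', Q g' p' -> Q' g' p') -> wp c N' Q' g pos.
Proof.
  intros H L HQ st m C B G. destruct (H st m C B G) as (m' & pos' & R & B' & Q1).
  exists m', pos'; repeat split; auto; try apply B'. eapply reach_le; eauto.
Qed.

Lemma wp_seq c1 c2 N1 N2 Q g pos :
  wp c1 N1 (fun g' p' => wp c2 N2 Q g' p') g pos -> wp (cseq c1 c2) (N1 + N2) Q g pos.
Proof.
  intros H st m C B G. unfold cseq in *. apply code_at_app in C as [C1 C2].
  destruct (H st m C1 B G) as (m1 & p1 & R1 & B1 & H2).
  destruct (H2 _ m1 C2 B1 (fun i => eq_refl)) as (m2 & p2 & R2 & B2 & HQ).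
  exists m2, p2; repeat split; auto; try apply B2.
  rewrite length_app, Nat.add_assoc. eapply reach_trans; eauto.
Qed.

Lemma bitlen_Z v : v <= Z -> bitlen v <= bitlen Z.
Proof. apply bitlen_mono. Qed.

Lemma eff_step i pc0 m pos r v pos' g :
  nth_error p pc0 = Some i -> bounded m -> (forall j, get m j = g j) ->
  eff y x i g pos = Some (r, v, pos') -> v <= Z ->
  reach (Config pc0 m pos) (Config (pc0 + 1) (set m r v) pos') 1.
Proof.
  intros E B G F V. pose proof (proj2 B) as BZ.
  assert (BL : forall j, bitlen (get m j) <= bitlen Z) by (intros; apply bitlen_Z, BZ).
  pose proof (bitlen_Z _ V) as BV.
  assert (1 <= bitlen Z) by (unfold bitlen; lia).
  rewrite Nat.add_1_r.
  destruct i; simpl in F; try discriminate; injection F as <- <- <-; rewrite <- ?G in *;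
    (eapply reach_step; [unfold step; cbn [pc mem Defs.pos]; rewrite E; cbv zeta; reflexivity|exact B|]);
    unfold tau; repeat match goal with |- context [bitlen (get m ?j)] =>
      pose proof (BL j); generalize dependent (bitlen (get m j)); intros end;
    lia.
Qed.

(** The state after an instruction is any g' satisfying the update equations: proofs then rewrite
    with equations and never meet nested conditionals. *)
Fixpoint wpb (l : list instr) (Q : (nat -> nat) -> nat -> Prop) (g : nat -> nat) (pos : nat) : Prop :=
  match l with
  | [] => Q g pos
  | i :: l' =>
    match eff y x i g pos with
    | None => False
    | Some (r, v, pos') => r < S0 /\ v <= Z /\
        forall g', g' r = v -> (forall j, j <> r -> g' j = g j) -> wpb l' Q g' pos'
    end
  end.

Lemma wp_block l Q g pos : wpb l Q g pos -> wp (block l) (length l) Q g pos.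
Proof.
  unfold block; revert g pos; induction l as [|i l IH]; intros g pos H st m C B G; simpl in H.
  - assert (E : (forall i, get m i = g i)) by auto. clear G.
    exists m, pos. rewrite Nat.add_0_r. split; [apply reach_refl|]. split; auto.
    replace (get m) with g; auto. symmetry. apply functional_extensionality; auto.
  - apply code_at_cons in C as [C1 C2].
    destruct (eff y x i g pos) as [[[r v] pos']|] eqn:F; [|contradiction].
    destruct H as (Hr & Hv & H).
    destruct (IH (get (set m r v)) pos') with (st := st + 1) (m := set m r v)
      as (m' & p' & R & B' & HQ); auto.
    + apply H.
      * rewrite get_set, Nat.eqb_refl; auto.
      * intros j Hj. rewrite get_set, G. destruct (Nat.eqb_spec j r); congruence.
    + apply bounded_set; auto.
    + exists m', p'. split; [|split; auto].
      simpl length. rewrite Nat.add_succ_r, <- Nat.add_1_r.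
      change (S (length l)) with (1 + length l).
      replace (st + length l + 1) with (st + 1 + length l) by lia.
      eapply reach_trans; [|exact R]. eapply eff_step; eauto.
Qed.

Lemma jmp_step pc0 m pos t : nth_error p pc0 = Some (IJmp t) -> bounded m ->
  reach (Config pc0 m pos) (Config t m pos) 1.
Proof.
  intros E B. eapply reach_step; [unfold step; cbn [pc mem Defs.pos]; rewrite E; cbv zeta; reflexivity|exact B|].
  unfold tau; lia.
Qed.

Lemma jz_step pc0 m pos a t : nth_error p pc0 = Some (IJz a t) -> bounded m ->
  reach (Config pc0 m pos) (Config (if Nat.eqb (get m a) 0 then t else pc0 + 1) m pos) 1.
Proof.
  intros E B. rewrite Nat.add_1_r.
  eapply reach_step; [unfold step; cbn [pc mem Defs.pos]; rewrite E; cbv zeta; reflexivity|exact B|].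
  unfold tau. pose proof (bitlen_Z _ (proj2 B a)); lia.
Qed.

Lemma wp_ite r c1 c2 N1 N2 Q g pos :
  (g r <> 0 -> wp c1 N1 Q g pos) -> (g r = 0 -> wp c2 N2 Q g pos) ->
  wp (ite r c1 c2) (Nat.max N1 N2 + 2) Q g pos.
Proof.
  intros H1 H2 st m C B G. unfold ite in *.
  set (b1 := c1 (st + 1)) in *. set (b2 := c2 (st + length b1 + 2)) in *.
  simpl app in C. apply code_at_cons in C as [C0 C]. apply code_at_app in C as [C1 C].
  apply code_at_cons in C as [C3 C2].
  pose proof (jz_step _ m pos _ _ C0 B) as R0.
  replace (st + length ([IJz r (st + length b1 + 2)] ++ b1 ++ [IJmp (st + length b1 + 2 + length b2)] ++ b2))
    with (st + length b1 + 2 + length b2)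
    by (simpl; rewrite length_app; simpl; lia).
  destruct (Nat.eqb_spec (get m r) 0) as [E|E].
  - assert (C2' : code_at (st + length b1 + 2) b2)
      by (replace (st + length b1 + 2) with (st + 1 + length b1 + 1) by lia; exact C2).
    destruct (H2 ltac:(rewrite <- G; auto) _ m C2' B G) as (m' & p' & R & B' & HQ).
    exists m', p'; split; [|split; auto].
    eapply reach_le; [eapply reach_trans; [exact R0|exact R]|lia].
  - destruct (H1 ltac:(rewrite <- G; auto) _ m C1 B G) as (m' & p' & R & B' & HQ).
    exists m', p'; split; [|split; auto].
    eapply reach_le; [eapply reach_trans; [exact R0|eapply reach_trans; [exact R|]]|].
    + eapply jmp_step; eauto.
    + lia.
Qed.

(** The test and the increment overwrite [s1]; hence the body and the exit must work from every
    state that agrees with the invariant's state off [s1], and the invariant for S k is asked for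
    after the increment. The overhead is five instructions per round and two for the last test. *)
Lemma wp_loop s1 rc rb body n N (I : nat -> (nat -> nat) -> nat -> Prop) Q g pos :
  s1 < S0 -> rc < S0 -> s1 <> rc -> n <= Z -> 1 <= Z ->
  I 0 g pos ->
  (forall k g1 p1, I k g1 p1 -> g1 rc = k /\ g1 rb = n) ->
  (forall k g1 p1 g2, k < n -> I k g1 p1 -> (forall j, j <> s1 -> g2 j = g1 j) ->
     wp body N (fun g3 p3 => g3 rc = k /\
       forall g4, g4 rc = S k -> (forall j, j <> rc -> j <> s1 -> g4 j = g3 j) -> I (S k) g4 p3) g2 p1) ->
  (forall g1 p1 g2, I n g1 p1 -> (forall j, j <> s1 -> g2 j = g1 j) -> Q g2 p1) ->
  wp (loopc s1 rc rb body) (n * (N + 5) + 2) Q g pos.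
Proof.
  intros Hs Hr Hsr Hn HZ I0 Ic Ib IQ st m C B G.
  set (bd := body (st + 2)).
  assert (C' := C). unfold loopc in C'. fold bd in C'. simpl app in C'.
  apply code_at_cons in C' as [C0 C']. apply code_at_cons in C' as [C1 C'].
  apply code_at_app in C' as [C2 C']. apply code_at_cons in C' as [C3 C'].
  apply code_at_cons in C' as [C4 C']. apply code_at_cons in C' as [C5 _].
  replace (st + 1 + 1) with (st + 2) in * by lia.
  assert (Len : length (loopc s1 rc rb body st) = length bd + 5)
    by (unfold loopc; fold bd; rewrite !length_app; simpl; lia).
  rewrite Len. clear Len C.
  assert (Main : forall j k m p1, j + k = n -> bounded m -> I k (get m) p1 ->
     exists m' p', reach (Config st m p1) (Config (st + (length bd + 5)) m' p') (j * (N + 5) + 2) /\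
       bounded m' /\ Q (get m') p').
  { clear m B G g pos I0. induction j as [|j IH]; intros k m pos E B HI;
      destruct (Ic _ _ _ HI) as [Gc Gb];
      assert (R0 : reach (Config st m pos)
         (Config (st + 1) (set m s1 (b2n (Nat.ltb k n))) pos) 1)
        by (eapply eff_step; [exact C0|auto|reflexivity|simpl; rewrite Gc, Gb; reflexivity
                             |destruct (Nat.ltb _ _); simpl; lia]);
      assert (B1 : bounded (set m s1 (b2n (Nat.ltb k n))))
        by (apply bounded_set; auto; destruct (Nat.ltb _ _); simpl; lia);
      pose proof (jz_step _ _ pos _ _ C1 B1) as R1;
      rewrite get_set, Nat.eqb_refl in R1.
    - assert (K : k = n) by lia; clear Gc; subst k.
      rewrite Nat.ltb_irrefl in R0, R1, B1. simpl in R0, R1, B1.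
      eexists _, _; split; [|split; [exact B1|]].
      + eapply reach_le; [eapply reach_trans; [exact R0|]|].
        * replace (st + (length bd + 5)) with (st + length bd + 5) by lia. exact R1.
        * lia.
      + eapply IQ; eauto. intros i Hi. rewrite get_set. destruct (Nat.eqb_spec i s1); congruence.
    - assert (L : k < n) by lia. apply Nat.ltb_lt in L; rewrite L in R0, R1, B1. simpl in R0, R1, B1.
      apply Nat.ltb_lt in L.
      destruct (Ib k (get m) pos (get (set m s1 1)) L HI) with (st := st + 2) (m := set m s1 1)
        as (m2 & p2 & R2 & B2 & Gk & Inext); auto.
      { intros i Hi. rewrite get_set. destruct (Nat.eqb_spec i s1); congruence. }
      fold bd in R2.
      assert (R3 : reach (Config (st + 2 + length bd) m2 p2)
                (Config (st + 2 + length bd + 1) (set m2 s1 1) p2) 1)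
        by (eapply eff_step; [exact C3|auto|reflexivity|reflexivity|lia]).
      assert (B3 : bounded (set m2 s1 1)) by (apply bounded_set; auto).
      assert (V3 : get (set m2 s1 1) rc + get (set m2 s1 1) s1 = S k).
      { rewrite !get_set, Nat.eqb_refl.
        destruct (Nat.eqb_spec rc s1); [congruence|]. rewrite Gk; lia. }
      assert (R4 : reach (Config (st + 2 + length bd + 1) (set m2 s1 1) p2)
          (Config (st + 2 + length bd + 1 + 1) (set (set m2 s1 1) rc (S k)) p2) 1).
      { eapply eff_step; [exact C4|auto|reflexivity| |lia]. simpl. rewrite V3. reflexivity. }
      assert (B4 : bounded (set (set m2 s1 1) rc (S k))) by (apply bounded_set; auto; lia).
      pose proof (jmp_step _ _ p2 _ C5 B4) as R5.
      destruct (IH (S k) (set (set m2 s1 1) rc (S k)) p2) as (m' & p' & R6 & B6 & HQ); auto; [lia| |].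
      { apply Inext.
        - rewrite get_set, Nat.eqb_refl; auto.
        - intros i H1 H2. rewrite !get_set.
          destruct (Nat.eqb_spec i rc); [congruence|]. destruct (Nat.eqb_spec i s1); congruence. }
      exists m', p'; split; [|split; auto].
      eapply reach_le.
      + eapply reach_trans; [exact R0|]. eapply reach_trans.
        { replace (st + 2) with (st + 1 + 1) in R2 by lia. exact R1. }
        eapply reach_trans; [replace (st + 1 + 1) with (st + 2) by lia; exact R2|].
        eapply reach_trans; [exact R3|]. eapply reach_trans; [exact R4|].
        eapply reach_trans; [exact R5|exact R6].
      + simpl. lia. }
  destruct (Main n 0 m pos) as (m' & p' & R & HH); auto.
  - replace (get m) with g; auto. symmetry; apply functional_extensionality; auto.
  - exists m', p'; split; auto.
Qed.

End Machine.

(** * An expression language with saturating arithmetic, and its compiler *)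

Fixpoint loop {A : Type} (n : nat) (f : nat -> A -> A) (a : A) : A :=
  match n with 0 => a | S n => f n (loop n f a) end.

Inductive op := Oadd | Osub | Omul | Odiv | Olt | Oeq | Omin.

(* [Var] and [Arr] are de Bruijn indices of scalars and arrays.  [Fold N e0 eb] binds the
   loop counter (index 1) and the current value (index 0) in [eb].  [AFold N e0 es er] iterates
   N times a whole array of fixed size: [e0] binds the cell (0); [es] binds the cell (0), the
   iteration (1) and the previous array; [er] sees the final array.  Loop bounds [N] are
   parameter registers, so that the cost of an expression is static. *)
Inductive expr :=
| Cst (k : nat)
| Par (i : nat)
| Var (i : nat)
| Op (o : op) (e1 e2 : expr)
| If (c e1 e2 : expr)
| Arr (i : nat) (e : expr)
| QY (e : expr)
| Let (e1 e2 : expr)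
| Fold (N : nat) (e0 eb : expr)
| AFold (N : nat) (e0 es er : expr).

Definition NP := 9.
Definition s1 := 9.
Definition s2 := 10.
Definition SB := 11.
Definition rg (d : nat) := SB + d.

(** Register 1 holds V: sums and products are cut back to V by subtracting their excess, and
    truncated subtraction gives the minimum as a - (a - b). *)
Definition opi (o : op) (r a b : nat) : list instr :=
  match o with
  | Oadd => [IAdd r a b; ISub s1 r 1; ISub r r s1]
  | Osub => [ISub r a b]
  | Omul => [IMul r a b; ISub s1 r 1; ISub r r s1]
  | Odiv => [IDiv r a b]
  | Olt => [ILt r a b]
  | Oeq => [IEq r a b]
  | Omin => [ISub s1 a b; ISub r a s1]
  end.

Definition mov (r a : nat) : list instr := [IConst s1 0; IAdd r a s1].

(** Stack registers used from the current depth on. The 3 of [AFold] is for the iteration counter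
    together with the loop that copies the new array over the old one. *)
Fixpoint dneed (e : expr) : nat :=
  match e with
  | Cst _ | Par _ | Var _ => 1
  | Op _ e1 e2 | Let e1 e2 => Nat.max (dneed e1) (1 + dneed e2)
  | If c e1 e2 => Nat.max (dneed c) (Nat.max (dneed e1) (dneed e2))
  | Arr _ e | QY e => dneed e
  | Fold _ e0 eb => Nat.max (dneed e0) (2 + dneed eb)
  | AFold _ e0 es er => Nat.max 3 (Nat.max (1 + dneed e0) (Nat.max (2 + dneed es) (dneed er)))
  end.

Lemma dneed_pos e : 1 <= dneed e.
Proof. induction e; cbn [dneed]; lia. Qed.

(** An array iteration owns two arrays, since the old one is read while the new one is filled. *)
Fixpoint aneed (e : expr) : nat :=
  match e with
  | Cst _ | Par _ | Var _ => 0
  | Op _ e1 e2 | Let e1 e2 | Fold _ e1 e2 => Nat.max (aneed e1) (aneed e2)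
  | If c e1 e2 => Nat.max (aneed c) (Nat.max (aneed e1) (aneed e2))
  | Arr _ e | QY e => aneed e
  | AFold _ e0 es er => 2 + Nat.max (aneed e0) (Nat.max (aneed es) (aneed er))
  end.

Fixpoint maxc (e : expr) : nat :=
  match e with
  | Cst k => k
  | Par _ | Var _ => 0
  | Op _ e1 e2 | Let e1 e2 | Fold _ e1 e2 => Nat.max (maxc e1) (maxc e2)
  | If e0 e1 e2 | AFold _ e0 e1 e2 => Nat.max (maxc e0) (Nat.max (maxc e1) (maxc e2))
  | Arr _ e | QY e => maxc e
  end.

Fixpoint scope (nv na : nat) (e : expr) : Prop :=
  match e with
  | Cst _ => True
  | Par i => i < NP
  | Var i => i < nv
  | Op _ e1 e2 => scope nv na e1 /\ scope nv na e2
  | If c e1 e2 => scope nv na c /\ scope nv na e1 /\ scope nv na e2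
  | Arr i e => i < na /\ scope nv na e
  | QY e => scope nv na e
  | Let e1 e2 => scope nv na e1 /\ scope (S nv) na e2
  | Fold N e0 eb => N < NP /\ scope nv na e0 /\ scope (S (S nv)) na eb
  | AFold N e0 es er =>
      N < NP /\ scope (S nv) na e0 /\ scope (S (S nv)) (S na) es /\ scope nv (S na) er
  end.

(* Registers below [NP] hold the parameters: register 1 the saturation bound V, registers 2
   and 3 the array size W and W - 1.  They are followed by two scratch registers, a stack of D
   registers, and NA interleaved arrays of W cells. *)
Record layout (V W : nat) (rho : nat -> nat) (y : list nat) (D NA S0 Z : nat) : Prop := {
  lay_V2 : 2 <= V;
  lay_VZ : V * V <= Z;
  lay_S : SB + D + W * NA <= S0;
  lay_SV : S0 <= V;
  lay_D : 1 <= D;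
  lay_NA : 1 <= NA;
  lay_W : 1 <= W;
  lay_rho : forall i, i < NP -> rho i <= V;
  lay_1 : rho 1 = V;
  lay_2 : rho 2 = W;
  lay_3 : rho 3 = W - 1;
  lay_y : forall i, nth i y 0 <= V }.

Lemma clamp_min a c : a - (a - c) = Nat.min a c.
Proof. lia. Qed.

Section Language.
Variables (V W : nat) (rho : nat -> nat) (y : list nat) (D NA : nat).

Definition opf (o : op) (a b : nat) : nat :=
  match o with
  | Oadd => Nat.min V (a + b)
  | Osub => a - b
  | Omul => Nat.min V (a * b)
  | Odiv => a / b
  | Olt => b2n (Nat.ltb a b)
  | Oeq => b2n (Nat.eqb a b)
  | Omin => Nat.min a b
  end.

(** Both the index and the value of an array access are clamped, so that addresses and results stay
    in range whatever the array and the index are. *)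
Fixpoint ev (e : expr) (env : list nat) (arrs : list (nat -> nat)) : nat :=
  match e with
  | Cst k => k
  | Par i => rho i
  | Var i => nth i env 0
  | Op o e1 e2 => opf o (ev e1 env arrs) (ev e2 env arrs)
  | If c e1 e2 => if Nat.eqb (ev c env arrs) 0 then ev e2 env arrs else ev e1 env arrs
  | Arr i e => Nat.min V (nth i arrs (fun _ => 0) (Nat.min (ev e env arrs) (W - 1)))
  | QY e => Nat.min V (nth (ev e env arrs) y 0)
  | Let e1 e2 => ev e2 (ev e1 env arrs :: env) arrs
  | Fold N e0 eb => loop (rho N) (fun k acc => ev eb (acc :: k :: env) arrs) (ev e0 env arrs)
  | AFold N e0 es er =>
      ev er env (loop (rho N) (fun k f => fun j => ev es (j :: k :: env) (f :: arrs))
                   (fun j => ev e0 (j :: env) arrs) :: arrs)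
  end.

Definition fill_cost (n : nat) := 1 + (W * (n + 5 + 5) + 2).

Fixpoint cost (e : expr) : nat :=
  match e with
  | Cst _ => 1
  | Par _ | Var _ => 2
  | Op _ e1 e2 => cost e1 + (cost e2 + 3)
  | If c e1 e2 => cost c + (Nat.max (cost e1) (cost e2) + 2)
  | Arr _ e => cost e + 9
  | QY e => cost e + 3
  | Let e1 e2 => cost e1 + (cost e2 + 2)
  | Fold N e0 eb => cost e0 + (3 + ((rho N * (cost eb + 2 + 5) + 2) + 2))
  | AFold N e0 es er =>
      fill_cost (cost e0) +
      (1 + ((rho N * (fill_cost (cost es) + fill_cost 11 + 5) + 2) + cost er))
  end.

Definition AB := SB + D.
(** Arrays are interleaved because W depends on n and is known only at run time, whereas the number
    NA of arrays is a constant of the program. *)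
Definition cell (q idx : nat) := AB + idx * NA + q.

(** The value is stored from register [S r], where a body compiled one level above the counter r
    leaves it. *)
Definition fillc (slot r : nat) (body : code) : code :=
  cseq (block [IConst r 0])
    (loopc s1 r 2 (cseq body
       (block [IConst s1 NA; IMul s1 s1 r; IConst s2 (AB + slot); IAdd s1 s1 s2; IStore s1 (S r)]))).

Definition arrc (slot r : nat) : code :=
  block [ISub s1 r 3; ISub r r s1; IConst s1 NA; IMul r r s1; IConst s1 (AB + slot);
         IAdd r r s1; ILoad r r; ISub s1 r 1; ISub r r s1].

(** [rs] and [qs] locate the scalars and arrays in scope, d is the first free stack register and q
    the first free array; the value ends in [rg d]. *)
Fixpoint comp (e : expr) (rs qs : list nat) (d q : nat) : code :=
  match e with
  | Cst k => block [IConst (rg d) k]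
  | Par i => block (mov (rg d) i)
  | Var i => block (mov (rg d) (nth i rs 0))
  | Op o e1 e2 =>
      cseq (comp e1 rs qs d q) (cseq (comp e2 rs qs (S d) q) (block (opi o (rg d) (rg d) (rg (S d)))))
  | If c e1 e2 => cseq (comp c rs qs d q) (ite (rg d) (comp e1 rs qs d q) (comp e2 rs qs d q))
  | Arr i e => cseq (comp e rs qs d q) (arrc (nth i qs 0) (rg d))
  | QY e => cseq (comp e rs qs d q) (block [IQueryY (rg d) (rg d); ISub s1 (rg d) 1; ISub (rg d) (rg d) s1])
  | Let e1 e2 =>
      cseq (comp e1 rs qs d q)
        (cseq (comp e2 (rg d :: rs) qs (S d) q) (block (mov (rg d) (rg (S d)))))
  | Fold N e0 eb =>
      cseq (comp e0 rs qs d q)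
        (cseq (block (mov (rg (S d)) (rg d) ++ [IConst (rg d) 0]))
          (cseq (loopc s1 (rg d) N
                  (cseq (comp eb (rg (S d) :: rg d :: rs) qs (S (S d)) q)
                        (block (mov (rg (S d)) (rg (S (S d)))))))
                (block (mov (rg d) (rg (S d))))))
  | AFold N e0 es er =>
      cseq (fillc q (rg d) (comp e0 (rg d :: rs) qs (S d) (S (S q))))
        (cseq (block [IConst (rg d) 0])
          (cseq (loopc s1 (rg d) N
            (cseq (fillc (S q) (rg (S d))
                     (comp es (rg (S d) :: rg d :: rs) (q :: qs) (S (S d)) (S (S q))))
                  (fillc q (rg (S d))
                     (cseq (block (mov (rg (S (S d))) (rg (S d)))) (arrc (S q) (rg (S (S d))))))))
            (comp er rs (q :: qs) d (S (S q)))))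
  end.

Variables (p : list instr) (x : list nat) (S0 Z : nat).
Hypothesis lay : layout V W rho y D NA S0 Z.
Let HV2 : 2 <= V := lay_V2 _ _ _ _ _ _ _ _ lay.
Let HVZ : V * V <= Z := lay_VZ _ _ _ _ _ _ _ _ lay.
Let HS : AB + W * NA <= S0 := lay_S _ _ _ _ _ _ _ _ lay.
Let HS0V : S0 <= V := lay_SV _ _ _ _ _ _ _ _ lay.
Let HD : 1 <= D := lay_D _ _ _ _ _ _ _ _ lay.
Let HNA : 1 <= NA := lay_NA _ _ _ _ _ _ _ _ lay.
Let HW : 1 <= W := lay_W _ _ _ _ _ _ _ _ lay.
Let Hrho : forall i, i < NP -> rho i <= V := lay_rho _ _ _ _ _ _ _ _ lay.
Let Hr1 : rho 1 = V := lay_1 _ _ _ _ _ _ _ _ lay.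
Let Hr2 : rho 2 = W := lay_2 _ _ _ _ _ _ _ _ lay.
Let Hr3 : rho 3 = W - 1 := lay_3 _ _ _ _ _ _ _ _ lay.
Let Hy : forall i, nth i y 0 <= V := lay_y _ _ _ _ _ _ _ _ lay.

(** * Correctness of the compiler *)

Definition keep (d q i : nat) : Prop :=
  i < NP \/ SB <= i < SB + d \/ exists q' idx, q' < q /\ idx < W /\ i = cell q' idx.

Definition eqon (d q : nat) (g g' : nat -> nat) := forall i, keep d q i -> g' i = g i.

Record rep (g : nat -> nat) (rs qs env : list nat) (arrs : list (nat -> nat)) (d q : nat) : Prop := {
  rep_lrs : length rs = length env;
  rep_var : forall i, i < length env ->
    SB <= nth i rs 0 < SB + d /\ g (nth i rs 0) = nth i env 0 /\ nth i env 0 <= V;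
  rep_lqs : length qs = length arrs;
  rep_arr : forall i, i < length arrs -> nth i qs 0 < q /\
    forall idx, idx < W -> g (cell (nth i qs 0) idx) = nth i arrs (fun _ => 0) idx;
  rep_par : forall i, i < NP -> g i = rho i }.

Lemma keep_le d q d' q' i : keep d q i -> d <= d' -> q <= q' -> keep d' q' i.
Proof.
  intros [H|[H|(a & b & H1 & H2 & H3)]] L1 L2; [left; auto|right; left; lia|].
  right; right; exists a, b; repeat split; auto; lia.
Qed.

Lemma keep_scratch d q : ~ keep d q s1 /\ ~ keep d q s2.
Proof.
  split; intros [H|[H|(a & b & H1 & H2 & H3)]];
    unfold cell, AB, SB, NP, s1, s2 in *; lia.
Qed.

Lemma keep_rg d q d' : d <= d' -> d' < D -> ~ keep d q (rg d').
Proof.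
  intros L1 L2 [H|[H|(a & b & H1 & H2 & H3)]]; unfold cell, AB, rg, SB, NP in *; lia.
Qed.

(** The slot is the remainder of the offset modulo NA. *)
Lemma cell_inj a b a' b' : a < NA -> a' < NA -> cell a b = cell a' b' -> a = a' /\ b = b'.
Proof.
  unfold cell; intros L1 L2 E. assert (E' : b = b') by nia. subst b'; lia.
Qed.

Lemma keep_cell d q a b : d <= D -> q <= a -> a < NA -> b < W -> ~ keep d q (cell a b).
Proof.
  intros Ld L1 L2 L3 [H|[H|(a' & b' & H1 & H2 & H3)]].
  - unfold cell, AB, SB, NP in *; lia.
  - unfold cell, AB in *; lia.
  - apply cell_inj in H3; lia.
Qed.

Lemma keep_has_par d q i : i < NP -> keep d q i.
Proof. left; auto. Qed.

Lemma keep_has_rg d q d' : d' < d -> keep d q (rg d').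
Proof. right; left; unfold rg; lia. Qed.

Lemma keep_has_cell d q a b : a < q -> b < W -> keep d q (cell a b).
Proof. right; right; exists a, b; auto. Qed.

Lemma eqon_trans d q g1 g2 g3 : eqon d q g1 g2 -> eqon d q g2 g3 -> eqon d q g1 g3.
Proof. intros H1 H2 i K. rewrite H2, H1; auto. Qed.

Lemma eqon_le d q d' q' g g' : eqon d' q' g g' -> d <= d' -> q <= q' -> eqon d q g g'.
Proof. intros H L1 L2 i K. apply H. eapply keep_le; eauto. Qed.

Lemma rep_eqon g g' rs qs env arrs d q : rep g rs qs env arrs d q -> eqon d q g g' ->
  rep g' rs qs env arrs d q.
Proof.
  intros [H1 H2 H3 H4 H5] E; split; auto.
  - intros i L. destruct (H2 i L) as (A & B & C). repeat split; auto; try lia.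
    rewrite E; auto. right; left; lia.
  - intros i L. destruct (H4 i L) as (A & B). split; auto. intros idx Li.
    rewrite E; auto. apply keep_has_cell; auto.
  - intros i L. rewrite E; auto. left; auto.
Qed.

Lemma rep_le g rs qs env arrs d q d' q' : rep g rs qs env arrs d q -> d <= d' -> q <= q' ->
  rep g rs qs env arrs d' q'.
Proof.
  intros [H1 H2 H3 H4 H5] L1 L2; split; auto.
  - intros i L. destruct (H2 i L) as (A & B & C). repeat split; auto; lia.
  - intros i L. destruct (H4 i L) as (A & B). split; auto; lia.
Qed.

Lemma rep_weaken g g' rs qs env arrs d q d' q' : rep g rs qs env arrs d q -> eqon d q g g' ->
  d <= d' -> q <= q' -> rep g' rs qs env arrs d' q'.
Proof. intros R E L1 L2. eapply rep_le; eauto. eapply rep_eqon; eauto. Qed.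

Lemma rep_push g rs qs env arrs d q d' v : rep g rs qs env arrs d q -> d' < d -> g (rg d') = v ->
  v <= V -> rep g (rg d' :: rs) qs (v :: env) arrs d q.
Proof.
  intros [H1 H2 H3 H4 H5] L E LV; split; auto; cbn [nth length].
  - congruence.
  - intros [|i] Li; [|apply H2; lia]. split; [unfold rg; lia|split; [exact E|exact LV]].
Qed.

Lemma rep_apush g rs qs env arrs d q q' f : rep g rs qs env arrs d q -> q' < q ->
  (forall idx, idx < W -> g (cell q' idx) = f idx) ->
  rep g rs (q' :: qs) env (f :: arrs) d q.
Proof.
  intros [H1 H2 H3 H4 H5] L E; split; auto; cbn [nth length].
  - congruence.
  - intros [|i] Li; [|apply H4; lia]. auto.
Qed.

Notation wp := (wp p x y S0 Z).
Notation wpb := (wpb x y S0 Z).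

Definition gives (d q : nat) (g : nat -> nat) (pos v : nat) (g' : nat -> nat) (pos' : nat) :=
  pos' = pos /\ eqon d q g g' /\ g' (rg d) = v /\ v <= V.

Lemma rg_lt d : d < D -> rg d < S0.
Proof. unfold rg, AB in *; lia. Qed.

Lemma s12_lt : s1 < S0 /\ s2 < S0.
Proof. unfold AB, s1, s2, SB in *; lia. Qed.

Lemma cell_lt a b : a < NA -> b < W -> cell a b < S0.
Proof. intros. unfold cell. nia. Qed.

Lemma le_Z v : v <= V -> v <= Z.
Proof. nia. Qed.

Lemma VV_le_Z : V + V <= Z.
Proof. nia. Qed.

Lemma W_le_V : W <= V.
Proof. rewrite <- Hr2. apply Hrho. unfold NP; lia. Qed.

Lemma eqon_upd d q g g' r : (forall j, j <> r -> g' j = g j) -> ~ keep d q r -> eqon d q g g'.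
Proof. intros H N i K. apply H. intros ->; auto. Qed.

Lemma wp_bounded c N Q g pos : ((forall i, g i <= Z) -> wp c N Q g pos) -> wp c N Q g pos.
Proof.
  intros H st m C B G. apply H; auto. intros i. rewrite <- G. apply B.
Qed.

Lemma mov_ok r a g pos : r < S0 -> r <> s1 -> a <> s1 ->
  wp (block (mov r a)) 2 (fun g' p' => p' = pos /\ g' r = g a /\
    forall j, j <> r -> j <> s1 -> g' j = g j) g pos.
Proof.
  intros Hr Hs Ha. apply wp_bounded; intros B. apply (wp_block p x y S0 Z (mov r a)).
  cbn [wpb mov eff]. pose proof s12_lt as [L _]. split; [auto|]. split; [lia|].
  intros g1 E1 O1. rewrite E1, (O1 a), Nat.add_0_r by auto. split; [auto|]. split; [auto|].
  intros g2 E2 O2. repeat split; auto. intros j J1 J2. rewrite O2, O1; auto.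
Qed.

Lemma op_ok o d g pos : S d < D -> g 1 = V -> g (rg d) <= V -> g (rg (S d)) <= V ->
  wp (block (opi o (rg d) (rg d) (rg (S d)))) 3 (fun g' p' => p' = pos /\
    g' (rg d) = opf o (g (rg d)) (g (rg (S d))) /\ g' (rg d) <= V /\
    forall j, j <> rg d -> j <> s1 -> g' j = g j) g pos.
Proof.
  intros Hd G1 A B. pose proof s12_lt as [L _]. pose proof (rg_lt d ltac:(lia)) as Lr.
  pose proof (le_Z V ltac:(lia)) as LV.
  assert (N1 : rg d <> s1) by (unfold rg, SB, s1; lia).
  assert (N2 : rg (S d) <> s1) by (unfold rg, SB, s1; lia).
  assert (N3 : rg d <> 1) by (unfold rg, SB; lia).
  assert (N4 : rg (S d) <> rg d) by (unfold rg, SB; lia).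
  assert (M1 : g (rg d) + g (rg (S d)) <= Z) by (pose proof VV_le_Z; lia).
  assert (M2 : g (rg d) * g (rg (S d)) <= Z)
    by (eapply Nat.le_trans; [apply Nat.mul_le_mono; eauto|auto]).
  eapply wp_mono with (N := length (opi o (rg d) (rg d) (rg (S d))));
    [apply wp_block|destruct o; simpl; lia|intros g' p' H; exact H].
  destruct o; cbn [opi wpb eff].
  1,3: (split; [auto|]; split; [auto|]; intros g1 E1 O1;
    split; [auto|]; split; [rewrite E1; lia|]; intros g2 E2 O2;
    split; [auto|]; split; [rewrite O2, E1 by auto; lia|]; intros g3 E3 O3;
    rewrite (O1 1), G1 in E2 by (unfold s1; lia);
    rewrite E2, O2, E1 in E3 by auto; cbn [opf];
    (split; [auto|]; split; [rewrite E3; lia|]; split; [rewrite E3; lia|];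
     intros j J1 J2; rewrite O3, O2, O1; auto)).
  - split; [auto|]; split; [lia|]; intros g1 E1 O1. rewrite E1; cbn [opf]. repeat split; auto; lia.
  - pose proof (Nat.Div0.div_le_upper_bound (g (rg d)) (g (rg (S d))) (g (rg d))) as DL.
    assert (g (rg d) / g (rg (S d)) <= g (rg d)).
    { destruct (g (rg (S d))) as [|w]; [simpl; lia|]. apply DL; nia. }
    split; [auto|]; split; [lia|]; intros g1 E1 O1. rewrite E1; cbn [opf]. repeat split; auto; lia.
  - assert (b2n (g (rg d) <? g (rg (S d))) <= 1) by (destruct (_ <? _); simpl; lia).
    split; [auto|]; split; [lia|]; intros g1 E1 O1. rewrite E1; cbn [opf]. repeat split; auto; lia.
  - assert (b2n (g (rg d) =? g (rg (S d))) <= 1) by (destruct (_ =? _); simpl; lia).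
    split; [auto|]; split; [lia|]; intros g1 E1 O1. rewrite E1; cbn [opf]. repeat split; auto; lia.
  - split; [auto|]; split; [lia|]; intros g1 E1 O1.
    split; [auto|]; split; [rewrite O1 by auto; lia|]; intros g2 E2 O2.
    rewrite E1, O1 in E2 by auto. cbn [opf].
    split; [auto|]; split; [lia|]; split; [lia|].
    intros j J1 J2; rewrite O2, O1; auto.
Qed.

Lemma arrc_ok slot d g pos : d < D -> slot < NA -> g 1 = V -> g 3 = W - 1 ->
  wp (arrc slot (rg d)) 9 (fun g' p' => p' = pos /\
    g' (rg d) = Nat.min V (g (cell slot (Nat.min (g (rg d)) (W - 1)))) /\
    forall j, j <> rg d -> j <> s1 -> g' j = g j) g pos.
Proof.
  intros Hd Hs G1 G3. apply wp_bounded; intros B.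
  pose proof s12_lt as [L _]. pose proof (rg_lt d ltac:(lia)) as Lr.
  pose proof (le_Z V ltac:(lia)) as LV.
  assert (N1 : rg d <> s1) by (unfold rg, SB, s1; lia).
  assert (N3 : rg d <> 3) by (unfold rg, SB; lia).
  assert (N4 : rg d <> 1) by (unfold rg, SB; lia).
  set (idx := Nat.min (g (rg d)) (W - 1)).
  assert (Li : idx < W) by lia. pose proof W_le_V as WV.
  pose proof (cell_lt slot idx Hs Li) as Lc.
  assert (Nc : rg d <> cell slot idx /\ s1 <> cell slot idx)
    by (unfold rg, s1, cell, AB, SB; nia).
  assert (M4 : cell slot idx <= Z) by lia.
  assert (M2 : idx * NA <= Z) by (unfold cell in M4; lia).
  assert (M3 : AB + slot <= Z) by (unfold cell in M4; lia).
  assert (M1 : NA <= Z) by (pose proof (Nat.mul_le_mono_r 1 W NA HW); lia).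
  unfold arrc. refine (wp_block p x y S0 Z [_;_;_;_;_;_;_;_;_] _ g pos _). cbn [wpb eff].
  split; [auto|]; split; [pose proof (B (rg d)); lia|]; intros g1 E1 O1.
  assert (E1' : g1 (rg d) - g1 s1 = idx) by (rewrite E1, O1, G3 by auto; apply clamp_min).
  split; [auto|]; split; [rewrite E1'; lia|]; intros g2 E2 O2. rewrite E1' in E2.
  split; [auto|]; split; [lia|]; intros g3 E3 O3.
  assert (E3' : g3 (rg d) * g3 s1 = idx * NA) by (rewrite E3, O3, E2 by auto; lia).
  split; [auto|]; split; [rewrite E3'; lia|]; intros g4 E4 O4. rewrite E3' in E4.
  split; [auto|]; split; [lia|]; intros g5 E5 O5.
  assert (E5' : g5 (rg d) + g5 s1 = cell slot idx) by (rewrite E5, O5, E4 by auto; unfold cell; lia).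
  split; [auto|]; split; [rewrite E5'; lia|]; intros g6 E6 O6. rewrite E5' in E6.
  assert (E6' : g6 (g6 (rg d)) = g (cell slot idx)).
  { rewrite E6, O6, O5, O4, O3, O2, O1; auto; intros E; symmetry in E; revert E; apply Nc. }
  split; [auto|]; split; [rewrite E6'; auto|]; intros g7 E7 O7. rewrite E6' in E7.
  assert (E71 : g7 1 = V).
  { rewrite O7, O6, O5, O4, O3, O2, O1; auto; unfold s1; lia. }
  split; [auto|]; split; [rewrite E7; eapply Nat.le_trans; [apply Nat.le_sub_l|apply B]|]; intros g8 E8 O8. rewrite E71, E7 in E8.
  assert (E8' : g8 (rg d) - g8 s1 = Nat.min V (g (cell slot idx))) by (rewrite E8, O8, E7, Nat.min_comm by auto; apply clamp_min).
  split; [auto|]; split; [rewrite E8'; eapply Nat.le_trans; [apply Nat.le_min_l|exact LV]|]; intros g9 E9 O9. rewrite E8' in E9.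
  repeat split; auto.
  intros j J1 J2. rewrite O9, O8, O7, O6, O5, O4, O3, O2, O1; auto.
Qed.

(** The array being filled lies below q, because cells already written must survive the body; this
    relation exempts it from [eqon]. *)
Definition eqoff (d q slot : nat) (g g' : nat -> nat) :=
  forall i, keep d q i -> (forall idx, idx < W -> i <> cell slot idx) -> g' i = g i.

Lemma eqoff_eqon d q q' slot g g' : eqoff d q' slot g g' -> q <= slot -> q <= q' -> slot < NA ->
  d <= D -> eqon d q g g'.
Proof.
  intros H L1 L2 L3 L4 i K. apply H; [eapply keep_le; eauto|].
  intros idx Li ->. revert K. apply keep_cell; auto.
Qed.

Lemma fill_ok slot d q body N f g pos :
  S d < D -> slot < q -> q <= NA ->
  g 2 = W ->
  (forall j g1, j < W -> g1 (rg d) = j -> eqoff d q slot g g1 ->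
    wp body N (gives (S d) q g1 pos (f j)) g1 pos) ->
  wp (fillc slot (rg d) body) (fill_cost N) (fun g' p' => p' = pos /\ eqoff d q slot g g' /\
     forall j, j < W -> g' (cell slot j) = f j /\ f j <= V) g pos.
Proof.
  intros Hd Hs Hq G2 Hb. pose proof s12_lt as [L1 L2].
  pose proof (rg_lt d ltac:(lia)) as Lr. pose proof (rg_lt (S d) ltac:(lia)) as Lr'.
  assert (LV : V <= Z) by nia.
  pose proof W_le_V as WV.
  assert (N1 : rg d <> s1 /\ rg d <> s2 /\ rg (S d) <> s1 /\ rg (S d) <> s2 /\ rg d <> 2)
    by (unfold rg, SB, s1, s2; lia).
  destruct N1 as (N1 & N2 & N3 & N4 & N5).
  assert (N0 : forall i, i < NP -> i <> s1 /\ i <> s2 /\ i <> rg d) by (unfold NP, rg, SB, s1, s2; lia).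
  assert (Nc : forall i, (i < NP \/ i = s1 \/ i = s2 \/ exists d', d' < D /\ i = rg d') ->
       forall a b, i <> cell a b).
  { intros i Hi a b ->. unfold NP, s1, s2, rg, cell, AB, SB in *.
    destruct Hi as [|[|[|(d' & ? & ?)]]]; lia. }
  unfold fillc, fill_cost. apply wp_seq. refine (wp_block p x y S0 Z [_] _ g pos _). cbn [wpb eff].
  split; [auto|]; split; [lia|]; intros g0 E0 O0.
  apply wp_loop with (n := W) (I := fun j g1 p1 => p1 = pos /\ g1 (rg d) = j /\
    eqoff d q slot g g1 /\ forall j', j' < j -> j' < W -> g1 (cell slot j') = f j' /\ f j' <= V);
    auto; try lia.
  - repeat split; auto; try lia. intros i K _. apply O0. intros ->.
    revert K; apply keep_rg; lia.
  - intros k g1 p1 (-> & E1 & K1 & F1). split; auto. rewrite <- G2. apply K1.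
    + left; unfold NP; lia.
    + intros idx _. apply Nc. left; unfold NP; lia.
  - intros k g1 p1 g2 Lk (-> & E1 & K1 & F1) O2.
    apply wp_seq. eapply wp_mono; [apply (Hb k g2); auto| |].
    + rewrite O2; auto.
    + intros i Ki Kn. rewrite O2, K1; auto. intros ->. revert Ki; apply keep_scratch.
    + reflexivity.
    + intros g3 p3 (-> & K3 & V3 & B3).
      assert (A3 : g3 (rg d) = k).
      { rewrite K3, O2, E1; auto. apply keep_has_rg; lia. }
      pose proof (cell_lt slot k ltac:(lia) Lk) as Lc.
      assert (M4 : cell slot k <= Z) by lia.
      assert (M2 : NA * k <= Z) by (unfold cell in M4; lia).
      assert (M3 : AB + slot <= Z) by (unfold cell in M4; lia).
      assert (M1 : NA <= Z) by (pose proof (Nat.mul_le_mono_r 1 W NA HW); lia).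
      assert (M5 : f k <= Z) by lia.
      refine (wp_block p x y S0 Z [_;_;_;_;_] _ _ _ _). cbn [wpb eff].
      split; [auto|]; split; [lia|]; intros g4 E4 O4.
      assert (E4' : g4 s1 * g4 (rg d) = NA * k) by (rewrite E4, O4, A3 by auto; lia).
      split; [auto|]; split; [lia|]; intros g5 E5 O5. rewrite E4' in E5.
      split; [auto|]; split; [lia|]; intros g6 E6 O6.
      assert (E6' : g6 s1 + g6 s2 = cell slot k)
        by (rewrite E6, O6, E5 by (unfold s1, s2; lia); unfold cell; lia).
      split; [auto|]; split; [lia|]; intros g7 E7 O7. rewrite E6' in E7.
      assert (E7' : g7 (S (rg d)) = f k).
      { change (S (rg d)) with (S (SB + d)). replace (S (SB + d)) with (rg (S d)) by (unfold rg; lia).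
        rewrite O7, O6, O5, O4; auto. }
      split; [rewrite E7; auto|]; split; [lia|]; intros g8 E8 O8. rewrite E7', E7 in *.
      assert (X8 : forall i, i <> s1 -> i <> s2 -> i <> cell slot k -> g8 i = g3 i).
      { intros i I1 I2 I3. rewrite O8, O7, O6, O5, O4; auto. }
      split.
      { rewrite X8; auto. apply Nc. right; right; right; exists d; split; auto; lia. }
      intros g9 E9 O9. split; [auto|]. split; [auto|]. split.
      * intros i Ki Kn. destruct (keep_scratch d q) as [S1 S2].
        rewrite O9, X8; auto; try (intros ->; eauto; fail).
        -- rewrite K3, O2, K1; auto; try (intros ->; auto; fail).
           eapply keep_le; eauto.
        -- intros ->. revert Ki. apply keep_rg; lia.
      * intros j' Hj Hj'. 
        assert (G9 : g9 (cell slot j') = g8 (cell slot j')).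
        { apply O9; apply not_eq_sym; apply Nc; eauto 6. right; right; right; exists d; split; auto; lia. }
        rewrite G9. destruct (Nat.eq_dec j' k) as [->|Ne]; [rewrite E8; auto|].
        rewrite X8.
        -- rewrite K3, O2; [apply F1; lia|apply not_eq_sym; apply Nc; auto|].
           apply keep_has_cell; auto.
        -- apply not_eq_sym; apply Nc; auto.
        -- apply not_eq_sym; apply Nc; auto.
        -- intros E. apply cell_inj in E; lia.
  - intros g1 p1 g2 (-> & E1 & K1 & F1) O2. split; [auto|]. split.
    + intros i Ki Kn. rewrite O2, K1; auto. intros ->. revert Ki; apply keep_scratch.
    + intros j Hj. rewrite O2; auto. apply not_eq_sym; apply Nc; auto.
Qed.

Lemma gives_rep d q g pos v g' pos' rs qs env arrs :
  gives d q g pos v g' pos' -> rep g rs qs env arrs d q -> rep g' rs qs env arrs d q.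
Proof. intros (_ & K & _ & _) H. eapply rep_eqon; eauto. Qed.

Lemma gives_push d q g pos v g' pos' rs qs env arrs d' q' :
  gives d' q' g pos v g' pos' -> rep g rs qs env arrs d q -> d <= d' -> q <= q' ->
  rep g' (rg d' :: rs) qs (v :: env) arrs (S d') q'.
Proof.
  intros (_ & K & E & L) H L1 L2. apply rep_push; auto.
  eapply rep_le; [eapply rep_eqon|..]; eauto; try lia. eapply eqon_le; eauto.
Qed.

Lemma eqon_scr d q d' g g' : d <= d' -> d' < D ->
  (forall j, j <> rg d' -> j <> s1 -> g' j = g j) -> eqon d q g g'.
Proof.
  intros L1 L2 H i K. apply H; intros ->; revert K; [apply keep_rg; auto|apply keep_scratch].
Qed.

(** [gives] also records that the value is at most V; this is what keeps sums and products below Z,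
    hence within the register bound, before they are cut back. *)
Lemma comp_ok e : forall rs qs d q env arrs g pos,
  d + dneed e <= D -> q + aneed e <= NA -> maxc e <= V -> scope (length env) (length arrs) e ->
  rep g rs qs env arrs d q ->
  wp (comp e rs qs d q) (cost e) (gives d q g pos (ev e env arrs)) g pos.
Proof.
  assert (Nrg : forall d, rg d <> s1) by (unfold rg, SB, s1; lia).
  assert (LV : V <= Z) by nia.
  induction e as [k|i|i|o e1 IH1 e2 IH2|c IHc e1 IH1 e2 IH2|i e IH|e IH|e1 IH1 e2 IH2
                 |N e0 IH0 eb IHb|N e0 IH0 es IHs er IHr];
    intros rs qs d q env arrs g pos Hd Hq Hc Hsc R; cbn [comp cost ev dneed aneed maxc scope] in *.
  - refine (wp_block p x y S0 Z [_] _ g pos _). cbn [wpb eff].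
    split; [apply rg_lt; lia|]; split; [lia|]; intros g1 E1 O1.
    split; [auto|]; split; [|auto]. eapply eqon_upd; eauto. apply keep_rg; lia.
  - eapply wp_mono; [apply mov_ok|reflexivity|].
    + apply rg_lt; lia.
    + apply Nrg.
    + unfold NP, s1 in *; lia.
    + intros g' p' (-> & E & O). split; [auto|]; split; [|].
      * eapply eqon_scr; eauto; lia.
      * rewrite E, (rep_par _ _ _ _ _ _ _ R) by auto. auto.
  - pose proof (rep_var _ _ _ _ _ _ _ R _ Hsc) as (H1 & H2 & H3).
    eapply wp_mono; [apply mov_ok|reflexivity|].
    + apply rg_lt; lia.
    + apply Nrg.
    + unfold SB, s1 in *; lia.
    + intros g' p' (-> & E & O). split; [auto|]; split; [|].
      * eapply eqon_scr; eauto; lia.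
      * rewrite E, H2. auto.
  - pose proof (dneed_pos e2).
    apply wp_seq. eapply wp_mono; [apply IH1; eauto; try lia; apply Hsc|reflexivity|].
    intros g1 p1 G1. pose proof (gives_rep _ _ _ _ _ _ _ _ _ _ _ G1 R) as R1.
    apply wp_seq. eapply wp_mono; [apply (IH2 rs qs (S d) q env arrs); eauto; try lia|reflexivity|].
    + apply Hsc.
    + eapply rep_le; eauto.
    + intros g2 p2 (-> & K2 & E2 & L2). destruct G1 as (-> & K1 & E1 & L1).
      assert (A2 : g2 (rg d) = ev e1 env arrs) by (rewrite K2; auto; apply keep_has_rg; lia).
      eapply wp_mono; [apply (op_ok o d); try lia|reflexivity|].
      * rewrite K2 by (apply keep_has_par; unfold NP; lia).
        rewrite (rep_par _ _ _ _ _ _ _ R1); auto; unfold NP; lia.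
      * intros g3 p3 (-> & E3 & L3 & O3). split; [auto|]. split.
        -- eapply eqon_trans; [exact K1|]. eapply eqon_trans; [eapply eqon_le; [exact K2|lia|lia]|].
           eapply eqon_scr; eauto; lia.
        -- rewrite E3, A2, E2 in *. auto.
  - apply wp_seq. eapply wp_mono; [apply IHc; eauto; try lia; apply Hsc|reflexivity|].
    intros g1 p1 G1. pose proof (gives_rep _ _ _ _ _ _ _ _ _ _ _ G1 R) as R1.
    destruct G1 as (-> & K1 & E1 & L1).
    apply wp_ite; intros Hz; rewrite E1 in Hz.
    + eapply wp_mono; [apply IH1; eauto; try lia; apply Hsc|reflexivity|].
      intros g2 p2 (-> & K2 & E2 & L2). apply Nat.eqb_neq in Hz; rewrite Hz.
      split; [auto|]. split; [|auto]. eapply eqon_trans; eauto.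
    + eapply wp_mono; [apply IH2; eauto; try lia; apply Hsc|reflexivity|].
      intros g2 p2 (-> & K2 & E2 & L2). apply Nat.eqb_eq in Hz; rewrite Hz.
      split; [auto|]. split; [|auto]. eapply eqon_trans; eauto.
  - destruct Hsc as [Hi Hsc].
    assert (d < D) by (pose proof (dneed_pos e); lia).
    apply wp_seq. eapply wp_mono; [apply IH; eauto; try lia|reflexivity|].
    intros g1 p1 G1. pose proof (gives_rep _ _ _ _ _ _ _ _ _ _ _ G1 R) as R1.
    destruct G1 as (-> & K1 & E1 & L1).
    destruct (rep_arr _ _ _ _ _ _ _ R1 _ Hi) as [Hs Ha].
    eapply wp_mono; [apply arrc_ok; auto|reflexivity|].
    + lia.
    + rewrite (rep_par _ _ _ _ _ _ _ R1); auto; unfold NP; lia.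
    + rewrite (rep_par _ _ _ _ _ _ _ R1); auto; unfold NP; lia.
    + intros g2 p2 (-> & E2 & O2). split; [auto|]. split.
      * eapply eqon_trans; [exact K1|]. eapply eqon_scr; eauto; lia.
      * rewrite E2, E1, Ha by lia. split; [auto|lia].
  - assert (d < D) by (pose proof (dneed_pos e); lia).
    apply wp_seq. eapply wp_mono; [apply IH; eauto; try lia|reflexivity|].
    intros g1 p1 G1. pose proof (gives_rep _ _ _ _ _ _ _ _ _ _ _ G1 R) as R1.
    destruct G1 as (-> & K1 & E1 & L1).
    refine (wp_block p x y S0 Z [_;_;_] _ _ _ _). cbn [wpb eff].
    pose proof (Hy (g1 (rg d))) as Hyv. pose proof (rg_lt d ltac:(lia)) as Lr.
    pose proof s12_lt as [Ls _].
    split; [auto|]; split; [lia|]; intros g2 E2 O2.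
    assert (G1V : g2 1 = V).
    { rewrite O2 by (unfold rg, SB; lia). rewrite (rep_par _ _ _ _ _ _ _ R1); auto; unfold NP; lia. }
    split; [auto|]; split; [lia|]; intros g3 E3 O3.
    assert (E3' : g3 (rg d) - g3 s1 = Nat.min V (nth (ev e env arrs) y 0))
      by (rewrite E3, O3, E2, G1V, E1 by auto; rewrite E1 in Hyv; lia).
    split; [auto|]; split; [lia|]; intros g4 E4 O4. rewrite E3' in E4.
    split; [auto|]; split; [|split; [auto|lia]].
    eapply eqon_trans; [exact K1|]. eapply eqon_scr; [reflexivity|lia|].
    intros j J1 J2. rewrite O4, O3, O2; auto.
  - apply wp_seq. eapply wp_mono; [apply IH1; eauto; try lia; apply Hsc|reflexivity|].
    intros g1 p1 G1. pose proof (gives_push _ _ _ _ _ _ _ _ _ _ _ _ _ G1 R ltac:(lia) ltac:(lia)) as R1.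
    apply wp_seq. eapply wp_mono; [apply IH2; eauto; try lia; apply Hsc|reflexivity|].
    intros g2 p2 (-> & K2 & E2 & L2). destruct G1 as (-> & K1 & E1 & L1).
    assert (1 <= dneed e2) by apply dneed_pos.
    eapply wp_mono; [apply mov_ok; auto; apply rg_lt; lia|reflexivity|].
    intros g3 p3 (-> & E3 & O3). split; [auto|]. split; [|rewrite E3, E2; auto].
    eapply eqon_trans; [exact K1|]. eapply eqon_trans; [eapply eqon_le; [exact K2|lia|lia]|].
    eapply eqon_scr; eauto; lia.
  - destruct Hsc as (HN & Hsc0 & Hscb).
    assert (Db : 1 <= dneed eb) by apply dneed_pos.
    assert (LN : rho N <= V) by auto.
    assert (NN : forall d', N <> rg d') by (unfold rg, SB, NP in *; lia).
    apply wp_seq. eapply wp_mono; [apply IH0; eauto; try lia|reflexivity|].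
    intros g1 p1 G1. pose proof (gives_rep _ _ _ _ _ _ _ _ _ _ _ G1 R) as R1.
    destruct G1 as (-> & K1 & E1 & L1).
    pose proof (rg_lt d ltac:(lia)) as Lr. pose proof (rg_lt (S d) ltac:(lia)) as Lr1.
    pose proof s12_lt as [Ls _].
    assert (Nd : rg d <> rg (S d)) by (unfold rg; lia).
    apply wp_seq. refine (wp_block p x y S0 Z [_;_;_] _ _ _ _). cbn [wpb eff].
    split; [auto|]; split; [lia|]; intros g2 E2 O2.
    assert (E2' : g2 (rg d) + g2 s1 = ev e0 env arrs) by (rewrite E2, O2, E1 by auto; lia).
    split; [auto|]; split; [lia|]; intros g3 E3 O3. rewrite E2' in E3.
    split; [auto|]; split; [lia|]; intros g4 E4 O4.
    assert (K4 : eqon d q g g4).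
    { eapply eqon_trans; [exact K1|]. intros i Ki.
      rewrite O4, O3, O2; auto; intros ->; revert Ki; solve [apply keep_rg; lia|apply keep_scratch]. }
    assert (V4 : g4 (rg (S d)) = ev e0 env arrs) by (rewrite O4; auto).
    clear g2 g3 E2 O2 E2' E3 O3 O4.
    set (F := loop (rho N)). 
    set (B := fun k acc => ev eb (acc :: k :: env) arrs).
    apply wp_seq. apply wp_loop with (n := rho N) (I := fun k g5 p5 =>
      p5 = pos /\ g5 (rg d) = k /\ k <= V /\ eqon d q g g5 /\
      g5 (rg (S d)) = loop k B (ev e0 env arrs) /\ loop k B (ev e0 env arrs) <= V); auto; try lia.
    + repeat split; auto; lia.
    + intros k g5 p5 (-> & A5 & Lk & K5 & V5 & L5). split; auto.
      rewrite K5, (rep_par _ _ _ _ _ _ _ R); auto. left; auto.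
    + intros k g5 p5 g6 Lk (-> & A5 & Lk' & K5 & V5 & L5) O6.
      assert (R6 : rep g6 rs qs env arrs d q).
      { eapply rep_eqon; [exact R|]. eapply eqon_trans; [exact K5|].
        eapply eqon_upd; [exact O6|apply keep_scratch]. }
      assert (R6' : rep g6 (rg (S d) :: rg d :: rs) qs (loop k B (ev e0 env arrs) :: k :: env) arrs (S (S d)) q).
      { apply rep_push; auto; [|rewrite O6; auto]. apply rep_push; auto; [|rewrite O6; auto].
        eapply rep_le; eauto. }
      apply wp_seq. eapply wp_mono; [refine (IHb _ _ _ _ _ _ _ _ _ _ _ _ R6'); [lia|lia|lia|exact Hscb]|reflexivity|].
      intros g7 p7 (-> & K7 & V7 & L7).
      eapply wp_mono; [apply mov_ok; auto|reflexivity|].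
      intros g8 p8 (-> & V8 & O8). split.
      * rewrite O8, K7, O6; auto. apply keep_has_rg; lia.
      * intros g9 A9 O9. split; [auto|]. split; [auto|]. split; [lia|]. split.
        -- eapply eqon_trans; [exact K5|]. 
           eapply eqon_trans; [eapply eqon_upd; [exact O6|apply keep_scratch]|].
           eapply eqon_trans; [eapply eqon_le; [exact K7|lia|lia]|].
           intros i Ki.
           rewrite O9, O8; auto; intros ->; revert Ki;
             solve [apply keep_rg; lia|apply keep_scratch].
        -- cbn [loop]. rewrite O9, V8, V7 by auto. split; [reflexivity|exact L7].
    + intros g5 p5 g6 (-> & A5 & Lk' & K5 & V5 & L5) O6.
      eapply wp_mono; [apply mov_ok; auto|reflexivity|].
      intros g7 p7 (-> & V7 & O7). split; [auto|]. split.
      * eapply eqon_trans; [exact K5|].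
        intros i Ki.
        rewrite O7, O6; auto; intros ->; revert Ki; solve [apply keep_rg; lia|apply keep_scratch].
      * rewrite V7, O6, V5 by auto. split; [reflexivity|exact L5].
  - destruct Hsc as (HN & Hsc0 & Hscs & Hscr).
    assert (LN : rho N <= V) by auto.
    assert (NN : forall d', N <> rg d') by (unfold rg, SB, NP in *; lia).
    pose proof (rg_lt d ltac:(lia)) as Lr. pose proof s12_lt as [Ls _].
    apply wp_seq. eapply wp_mono.
    { apply fill_ok with (q := S (S q)) (f := fun j => ev e0 (j :: env) arrs); try lia.
      - rewrite (rep_par _ _ _ _ _ _ _ R); auto; unfold NP; lia.
      - intros j g1 Lj E1 K1.
        assert (K1' : eqon d q g g1) by (eapply eqoff_eqon; eauto; lia).
        apply IH0; auto; try lia. apply rep_push; auto; [|pose proof W_le_V; lia].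
        eapply rep_le; [eapply rep_eqon; eauto|lia|lia]. }
    { reflexivity. }
    intros g1 p1 (-> & K1 & F1).
    assert (K1' : eqon d q g g1) by (eapply eqoff_eqon; eauto; lia).
    apply wp_seq. refine (wp_block p x y S0 Z [_] _ _ _ _). cbn [wpb eff].
    split; [auto|]; split; [lia|]; intros g2 E2 O2.
    assert (C2 : forall a b d', cell a b <> rg d' \/ D <= d') .
    { intros a b d'. unfold cell, AB, rg. lia. }
    assert (C3 : forall a b, cell a b <> s1) by (intros a b; unfold cell, AB, SB, s1; lia).
    set (B := fun k f => fun j => ev es (j :: k :: env) (f :: arrs)).
    set (f0 := fun j => ev e0 (j :: env) arrs).
    apply wp_seq. apply wp_loop with (n := rho N) (I := fun k g5 p5 =>
      p5 = pos /\ g5 (rg d) = k /\ k <= V /\ eqon d q g g5 /\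
      forall j, j < W -> g5 (cell q j) = loop k B f0 j /\ loop k B f0 j <= V); auto; try lia.
    + split; [auto|]. split; [auto|]. split; [lia|]. split.
      * eapply eqon_trans; [exact K1'|]. eapply eqon_upd; eauto. apply keep_rg; lia.
      * intros j Lj. rewrite O2; auto. destruct (C2 q j d); auto; lia.
    + intros k g5 p5 (-> & A5 & Lk & K5 & V5). split; auto.
      rewrite K5, (rep_par _ _ _ _ _ _ _ R); auto. left; auto.
    + intros k g5 p5 g6 Lk (-> & A5 & Lk' & K5 & V5) O6.
      assert (K6 : eqon d q g g6).
      { eapply eqon_trans; [exact K5|]. eapply eqon_upd; [exact O6|apply keep_scratch]. }
      assert (R6 : rep g6 rs qs env arrs d q) by (eapply rep_eqon; eauto).
      assert (R6' : rep g6 (rg d :: rs) (q :: qs) (k :: env) (loop k B f0 :: arrs) (S d) (S q)).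
      { apply rep_apush; auto.
        - apply rep_push; auto; [|rewrite O6; auto]. eapply rep_le; eauto.
        - intros j Lj. rewrite O6; auto. apply V5; auto. }
      apply wp_seq. eapply wp_mono.
      { apply fill_ok with (q := S (S q)) (f := B k (loop k B f0)); try lia.
        - rewrite (rep_par _ _ _ _ _ _ _ R6); auto; unfold NP; lia.
        - intros j g7 Lj E7 K7.
          apply IHs; auto; try lia. 
          apply rep_push; auto; [|pose proof W_le_V; lia].
          eapply rep_le; [eapply rep_eqon; [exact R6'|]|lia|lia].
          eapply eqoff_eqon; eauto; lia. }
      { reflexivity. }
      intros g7 p7 (-> & K7 & F7).
      assert (K7' : eqon (S d) (S q) g6 g7) by (eapply eqoff_eqon; eauto; lia).
      eapply wp_mono.
      (* The second filling copies slot [S q] back to slot q; its 11 instructions are a move and an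
         array access. *)
      { apply fill_ok with (q := S (S q)) (f := B k (loop k B f0)) (N := 11); try lia.
        - rewrite K7', (rep_par _ _ _ _ _ _ _ R6); auto; unfold NP; [lia|left; unfold NP; lia].
        - intros j g8 Lj E8 K8.
          apply (wp_seq p x y S0 Z _ _ 2 9). 
          eapply wp_mono; [apply mov_ok; [apply rg_lt; lia|apply Nrg|apply Nrg]|reflexivity|].
          intros g9 p9 (-> & E9 & O9).
          assert (P9 : forall i, i < NP -> g9 i = rho i).
          { intros i Hi. rewrite O9, K8, K7', (rep_par _ _ _ _ _ _ _ R6); auto.
            - left; auto.
            - left; auto.
            - intros idx _. unfold cell, AB, SB, NP in *; lia.
            - unfold rg, SB, NP in *; lia.
            - unfold NP, s1 in *; lia. }
          eapply wp_mono; [apply arrc_ok; [lia|lia| |]|reflexivity|].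
          + rewrite P9; auto; unfold NP; lia.
          + rewrite P9; auto; unfold NP; lia.
          + intros g10 p10 (-> & E10 & O10).
            rewrite E9, E8 in E10. replace (Nat.min j (W - 1)) with j in E10 by lia.
            assert (G9 : g9 (cell (S q) j) = B k (loop k B f0) j).
            { rewrite O9; auto; [|destruct (C2 (S q) j (S (S d))); auto; lia].
              rewrite K8; [apply F7; auto|apply keep_has_cell; lia|].
              intros idx Li E. apply cell_inj in E; lia. }
            pose proof (proj2 (F7 j Lj)).
            split; [auto|]. split; [|split; [rewrite E10, G9; lia|auto]].
            intros i Ki. rewrite O10, O9; auto; intros ->; revert Ki; solve [apply keep_rg; lia|apply keep_scratch]. }
      { reflexivity. }
      intros g8 p8 (-> & K8 & F8).
      assert (A8 : g8 (rg d) = k).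
      { rewrite K8, K7', O6; auto; try (apply keep_has_rg; lia).
        intros idx _ E. destruct (C2 q idx d); auto; lia. }
      split; [auto|]. intros g9 E9 O9. split; [auto|]. split; [auto|]. split; [lia|]. split.
      * intros i Ki. destruct (keep_scratch d q) as [Ks _].
        rewrite O9; [|intros ->; revert Ki; apply keep_rg; lia|intros ->; auto].
        rewrite K8, K7', K6; auto.
        -- eapply keep_le; eauto.
        -- eapply keep_le; eauto.
        -- intros idx Li ->. revert Ki. apply keep_cell; lia.
      * intros j Lj. rewrite O9; [apply F8; auto|destruct (C2 q j d); auto; lia|apply C3].
    + intros g5 p5 g6 (-> & A5 & Lk' & K5 & V5) O6.
      assert (K6 : eqon d q g g6).
      { eapply eqon_trans; [exact K5|]. eapply eqon_upd; [exact O6|apply keep_scratch]. }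
      assert (R6 : rep g6 rs (q :: qs) env (loop (rho N) B f0 :: arrs) d (S (S q))).
      { apply rep_apush; auto.
        - eapply rep_le; [eapply rep_eqon; eauto|lia|lia].
        - intros j Lj. rewrite O6; auto. apply V5; auto. }
      eapply wp_mono; [refine (IHr _ _ _ _ _ _ _ _ _ _ _ _ R6); [lia|lia|lia|exact Hscr]|reflexivity|].
      intros g7 p7 (-> & K7 & V7 & L7). split; [auto|]. split; [|auto].
      eapply eqon_trans; [exact K6|]. eapply eqon_le; eauto.
Qed.

End Language.

(** * Dynamic programming over a grid of cut points *)

Lemma loop_ext {A} n (f g : nat -> A -> A) a :
  (forall k z, k < n -> f k z = g k z) -> loop n f a = loop n g a.
Proof.
  induction n as [|n IH]; intros H; simpl; auto. rewrite IH, H; auto.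
Qed.

(** Every search in the algorithm is such a loop. The second conjunct serves when a good candidate
    must not be missed, the third when the result must come from a genuine candidate. *)
Lemma loop_min n (f : nat -> nat -> nat) a (c : nat -> bool) (v : nat -> nat) :
  (forall k z, k < n -> f k z = if c k then Nat.min z (v k) else z) ->
  loop n f a <= a /\
  (forall k, k < n -> c k = true -> loop n f a <= v k) /\
  (loop n f a = a \/ exists k, k < n /\ c k = true /\ loop n f a = v k).
Proof.
  induction n as [|n IH]; intros H; simpl.
  - repeat split; auto; lia.
  - destruct IH as (H1 & H2 & H3); [auto|]. rewrite H by lia.
    destruct (c n) eqn:C; repeat split; try lia.
    + intros k Lk Ck. destruct (Nat.eq_dec k n) as [->|]; [lia|].
      specialize (H2 k ltac:(lia) Ck); lia.
    + destruct (Nat.min_dec (loop n f a) (v n)) as [E|E]; rewrite E.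
      * destruct H3 as [|(k & Lk & Ck & E')]; auto. right; exists k; repeat split; auto.
      * right; exists n; repeat split; auto.
    + intros k Lk Ck. apply H2; auto. destruct (Nat.eq_dec k n) as [->|]; [congruence|lia].
    + destruct H3 as [|(k & Lk & Ck & E')]; auto. right; exists k; repeat split; auto.
Qed.

Lemma b2n_eqb0 b : (b2n b =? 0) = negb b.
Proof. destruct b; reflexivity. Qed.

Fixpoint xcat (w : list nat) (uI vI : nat -> nat) (i : nat) : list nat :=
  match i with 0 => [] | S i => xcat w uI vI i ++ sub w (uI i) (vI i) end.

Section Grid.
Variables (V W : nat) (y : list nat).

(** The j-th cut point tried, relative to l, once s symbols are consumed: multiples of g, from s -
    dl rounded down. *)
Definition gpos (g dl s j : nat) := Nat.min V (g * Nat.min V ((s - dl) / g + j)).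

Definition cellv (dp : nat -> nat) (j : nat) := Nat.min V (dp (Nat.min j (W - 1))).

(** Cell j' receives the cost of matching the first i + 1 blocks with y from l up to the cut point
    j'. V stands for infinity, and cut points beyond R are refused. *)
Definition grid_step (f : nat -> nat -> nat -> nat -> nat) (sI uI vI : nat -> nat)
    (l R dl g i : nat) (dp : nat -> nat) (j' : nat) : nat :=
  if b2n (R <? gpos g dl (Nat.min V (sI i + (vI i - uI i))) j') =? 0 then
    loop W (fun j acc =>
      if b2n (gpos g dl (Nat.min V (sI i + (vI i - uI i))) j' <? gpos g dl (sI i) j) =? 0
      then Nat.min acc (Nat.min V (cellv dp j +
             f (uI i) (vI i) (Nat.min V (l + gpos g dl (sI i) j))
               (Nat.min V (l + gpos g dl (Nat.min V (sI i + (vI i - uI i))) j'))))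
      else acc) V
  else V.

(** Before the first block, cell j stands for the cut g * j, whose symbols are all inserted. *)
Definition grid f sI uI vI l R dl g b : nat -> nat :=
  loop b (grid_step f sI uI vI l R dl g) (fun j => Nat.min V (g * j)).

Variables (f : nat -> nat -> nat -> nat -> nat) (sI uI vI : nat -> nat) (l R dl g b : nat).
Hypothesis (HnV : length y < V) (HlR : l + R <= length y)
  (Hs0 : sI 0 = 0) (HsS : forall i, i < b -> sI (S i) = sI i + (vI i - uI i))
  (HsV : forall i, i <= b -> sI i <= V)
  (Huv : forall i, i < b -> uI i <= vI i <= length y).

Lemma xcat_length i : i <= b -> length (xcat y uI vI i) = sI i.
Proof.
  induction i as [|i IH]; intros L; simpl; auto.
  rewrite length_app, IH, sub_length, HsS by (try lia; apply Huv; lia). auto.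
Qed.

(** A value below V has never been truncated, so it is a sum of costs of consecutive pieces, and
    alignments of consecutive pieces concatenate. *)
Lemma grid_sound :
  (forall i p q, i < b -> p <= q -> q <= length y -> f (uI i) (vI i) p q < V ->
     al (f (uI i) (vI i) p q) (sub y (uI i) (vI i)) (sub y p q)) ->
  forall i j, i <= b -> grid f sI uI vI l R dl g i j < V -> gpos g dl (sI i) j <= R ->
  al (grid f sI uI vI l R dl g i j) (xcat y uI vI i) (sub y l (l + gpos g dl (sI i) j)).
Proof.
  intros Hf. unfold grid. induction i as [|i IH]; intros j Li Lv Lp; cbn [loop xcat] in *.
  - rewrite Hs0 in *. unfold gpos in *. replace ((0 - dl) / g) with 0 in *
      by (destruct g; simpl; auto; symmetry; apply Nat.Div0.div_0_l).
    simpl Nat.add in *. apply al_le with (length (sub y l (l + Nat.min V (g * Nat.min V j)))).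
    + apply al_nil_l.
    + rewrite sub_length by lia. nia.
  - set (dp := loop i _ _) in *. rewrite (HsS i) in Lp |- * by lia.
    specialize (HsV (S i) Li). rewrite (HsS i) in HsV by lia.
    unfold grid_step in *. replace (Nat.min V (sI i + (vI i - uI i)))
      with (sI i + (vI i - uI i)) in * by lia.
    set (q := gpos g dl (sI i + (vI i - uI i)) j) in *.
    rewrite b2n_eqb0 in *. destruct (Nat.ltb_spec R q); simpl negb in *; cbn [negb] in *; [lia|].
    match type of Lv with loop W ?F _ < _ =>
      destruct (loop_min W F V (fun j => negb (q <? gpos g dl (sI i) j))
        (fun j => Nat.min V (cellv dp j + f (uI i) (vI i) (Nat.min V (l + gpos g dl (sI i) j))
               (Nat.min V (l + q))))) as (_ & _ & [E|(j1 & L1 & C1 & E)])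
    end.
    + intros k z _. rewrite b2n_eqb0. reflexivity.
    + lia.
    + rewrite E in *. apply Bool.negb_true_iff, Nat.ltb_ge in C1.
      set (p := gpos g dl (sI i) j1) in *.
      assert (B : cellv dp j1 < V /\ f (uI i) (vI i) (Nat.min V (l + p)) (Nat.min V (l + q)) < V) by lia.
      destruct B as [B1 B2]. unfold cellv in B1.
      replace (Nat.min j1 (W - 1)) with j1 in * by lia.
      assert (E2 : cellv dp j1 = dp j1) by (unfold cellv; replace (Nat.min j1 (W - 1)) with j1 by lia; lia).
      rewrite E2. replace (Nat.min V (l + p)) with (l + p) in * by lia.
      replace (Nat.min V (l + q)) with (l + q) in * by lia.
      replace (Nat.min V (dp j1 + _)) with (dp j1 + f (uI i) (vI i) (l + p) (l + q)) by lia.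
      rewrite <- (sub_app y l (l + p) (l + q)) by lia.
      apply al_app.
      * apply IH; lia.
      * apply Hf; lia.
Qed.

(** Rounding the cuts of a given alignment down to multiples of g moves each end of a piece by at
    most g - 1, so a block pays at most 2(g - 1) extra. By [al_length] the cuts lie within dl of the
    diagonal, and [2 * dl + g < W * g] says that W grid points cover that range. P/Q is the
    approximation factor of f, kept as two naturals. *)
Lemma grid_complete P Q :
  Q <= P -> 1 <= g -> 2 * dl + g < W * g ->
  (forall i p q k, i < b -> p <= q -> q <= length y -> al k (sub y (uI i) (vI i)) (sub y p q) ->
     Q * f (uI i) (vI i) p q <= P * k) ->
  forall i pt k, i <= b -> al k (xcat y uI vI i) (sub y l (l + pt)) -> k <= dl -> pt <= R ->
  exists j, j < W /\ gpos g dl (sI i) j = g * (pt / g) /\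
    Q * grid f sI uI vI l R dl g i j <= P * (k + 2 * i * (g - 1)).
Proof.
  intros HQP Hg HW Hf.
  assert (Pos : forall i pt k, i <= b -> al k (xcat y uI vI i) (sub y l (l + pt)) -> k <= dl ->
     pt <= R -> exists j, j < W /\ (sI i - dl) / g + j = pt / g /\ gpos g dl (sI i) j = g * (pt / g)).
  { intros i pt k Li Ha Hk Lp. apply al_length in Ha. rewrite xcat_length, sub_length in Ha by lia.
    assert (A1 : (sI i - dl) / g <= pt / g) by (apply Nat.Div0.div_le_mono; lia).
    exists (pt / g - (sI i - dl) / g).
    pose proof (Nat.div_mod_eq pt g). pose proof (Nat.div_mod_eq (sI i - dl) g).
    pose proof (Nat.mod_upper_bound pt g ltac:(lia)).
    pose proof (Nat.mod_upper_bound (sI i - dl) g ltac:(lia)).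
    split; [|split].
    - apply (Nat.mul_lt_mono_pos_r g); [lia|]. rewrite Nat.mul_sub_distr_r. nia.
    - lia.
    - unfold gpos. replace ((sI i - dl) / g + _) with (pt / g) by lia.
      assert (pt / g <= pt) by (apply Nat.Div0.div_le_upper_bound; nia).
      rewrite (Nat.min_r V (pt / g)) by lia. apply Nat.min_r. nia. }
  unfold grid. induction i as [|i IH]; intros pt k Li Ha Hk Lp;
    destruct (Pos _ _ _ Li Ha Hk Lp) as (j & Lj & Ej & Gj); exists j; split; auto; split; auto;
    cbn [loop xcat] in *.
  - rewrite Hs0 in Ej. replace ((0 - dl) / g) with 0 in Ej
      by (destruct g; simpl; auto; symmetry; apply Nat.Div0.div_0_l).
    (* With no blocks the value is at most pt, hence at most k; [Q <= P] supplies the factor. *)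
    simpl in Ej. subst j. apply al_length in Ha as [Ha _]. rewrite sub_length in Ha by lia. simpl in Ha.
    pose proof (Nat.Div0.mul_div_le pt g).
    apply Nat.le_trans with (Q * k); [apply Nat.mul_le_mono_l; lia|].
    apply Nat.mul_le_mono; lia.
  - set (dp := loop i _ _) in *.
    apply al_split in Ha as (ka & kb & y1 & y2 & Ek & Ey & Ha1 & Ha2).
    set (p1 := length y1).
    assert (Lpt : length y1 + length y2 = pt).
    { rewrite <- length_app, <- Ey, sub_length; lia. }
    assert (Y1 : y1 = sub y l (l + p1)).
    { unfold sub. replace (l + p1 - l) with p1 by lia. 
      assert (E : firstn p1 (sub y l (l + pt)) = y1).
      { rewrite Ey. unfold p1. rewrite firstn_app, Nat.sub_diag, firstn_all. simpl. apply app_nil_r. }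
      rewrite <- E. unfold sub. rewrite firstn_firstn. f_equal. unfold p1 in *; lia. }
    assert (Y2 : y2 = sub y (l + p1) (l + pt)).
    { apply (app_inv_head y1). rewrite <- Ey. rewrite Y1 at 1.
      rewrite sub_app; auto; unfold p1; lia. }
    destruct (IH p1 ka) as (j1 & Lj1 & Gj1 & Bj1); try lia.
    { rewrite <- Y1; auto. }
    rewrite (HsS i) in Gj by lia.
    pose proof (HsV (S i) Li) as HsVi. rewrite (HsS i) in HsVi by lia.
    unfold grid_step. replace (Nat.min V (sI i + (vI i - uI i)))
      with (sI i + (vI i - uI i)) by lia.
    rewrite Gj. set (q := g * (pt / g)) in *.
    assert (Lq : q <= pt) by (apply Nat.Div0.mul_div_le).
    assert (Lq' : pt - q <= g - 1).
    { pose proof (Nat.div_mod_eq pt g). pose proof (Nat.mod_upper_bound pt g ltac:(lia)). unfold q; lia. }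
    rewrite b2n_eqb0. destruct (Nat.ltb_spec R q); cbn [negb]; [lia|].
    match goal with |- Q * loop W ?F _ <= _ =>
      destruct (loop_min W F V (fun j => negb (q <? gpos g dl (sI i) j))
        (fun j => Nat.min V (cellv dp j + f (uI i) (vI i) (Nat.min V (l + gpos g dl (sI i) j))
               (Nat.min V (l + q))))) as (_ & H2 & _)
    end.
    { intros k0 z _. rewrite b2n_eqb0. reflexivity. }
    specialize (H2 j1 Lj1). cbv beta in H2. rewrite Gj1 in H2. set (p := g * (p1 / g)) in *.
    assert (Lpp : p <= p1) by (apply Nat.Div0.mul_div_le).
    assert (Lpp' : p1 - p <= g - 1).
    { pose proof (Nat.div_mod_eq p1 g). pose proof (Nat.mod_upper_bound p1 g ltac:(lia)). unfold p; lia. }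
    assert (Lpq : p <= q).
    { apply Nat.mul_le_mono_l. apply Nat.Div0.div_le_mono. unfold p1; lia. }
    assert (C1 : negb (q <? p) = true) by (apply Bool.negb_true_iff, Nat.ltb_ge; auto).
    specialize (H2 C1).
    eapply Nat.le_trans; [apply Nat.mul_le_mono_l; exact H2|].
    replace (Nat.min V (l + p)) with (l + p) by lia.
    replace (Nat.min V (l + q)) with (l + q) by lia.
    assert (Ecell : cellv dp j1 <= dp j1)
      by (unfold cellv; replace (Nat.min j1 (W - 1)) with j1 by lia; lia).
    eapply Nat.le_trans; [apply Nat.mul_le_mono_l; apply Nat.le_min_r|].
    assert (Hwin : al (kb + ((l + p1 - (l + p)) + (l + pt - (l + q))))
               (sub y (uI i) (vI i)) (sub y (l + p) (l + q))).
    { eapply al_trans; [exact Ha2|]. rewrite Y2. apply al_window; unfold p1 in *; lia. }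
    apply Hf in Hwin; try lia.
    rewrite Nat.mul_add_distr_l.
    assert (B1 : Q * cellv dp j1 <= P * (ka + 2 * i * (g - 1))).
    { eapply Nat.le_trans; [apply Nat.mul_le_mono_l; exact Ecell|exact Bj1]. }
    assert (B2 : Q * f (uI i) (vI i) (l + p) (l + q) <= P * (kb + 2 * (g - 1))).
    { eapply Nat.le_trans; [exact Hwin|]. apply Nat.mul_le_mono_l. lia. }
    replace (k + 2 * S i * (g - 1)) with ((ka + 2 * i * (g - 1)) + (kb + 2 * (g - 1))) by lia.
    rewrite Nat.mul_add_distr_l. lia.
Qed.

End Grid.

(** * The algorithm as expressions *)

Fixpoint powE (i t : nat) : expr :=
  match t with 0 => Cst 1 | S t => Op Omul (powE i t) (Par i) end.

(** Loop bounds must be parameters, so the loop has a fixed length and doubles only while its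
    counter is below the exponent. The index [S (S k)] steps over the two binders of [Fold]. *)
Definition pow2E (k : nat) : expr :=
  Fold 5 (Cst 1) (If (Op Olt (Var 1) (Var (S (S k)))) (Op Oadd (Var 0) (Var 0)) (Var 0)).

(** The spacing dl / (2Kb), but at least 1: register 7 holds K and register 8 holds 2b. *)
Definition gapE : expr :=
  Let (Op Odiv (Var 0) (Op Omul (Par 7) (Par 8))) (If (Var 0) (Var 0) (Cst 1)).

(* Environment: g, dl, R, l.  [siE], [uiE], [viE] give the prefix length and the two ends of
   block i; [fE] is the window cost in the environment q, p, v, u. *)
Definition gridE (N : nat) (siE uiE viE fE erE : expr) : expr :=
  AFold N (Op Omul (Var 1) (Var 0))
    (Let siE (Let uiE (Let viE
      (Let (Op Omul (Var 5) (Op Oadd (Op Odiv (Op Osub (Op Oadd (Var 2) (Op Osub (Var 0) (Var 1))) (Var 6)) (Var 5)) (Var 3)))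
        (If (Op Olt (Var 8) (Var 0)) (Par 1)
          (Fold 2 (Par 1)
            (Let (Op Omul (Var 8) (Op Oadd (Op Odiv (Op Osub (Var 5) (Var 9)) (Var 8)) (Var 1)))
              (If (Op Olt (Var 3) (Var 0)) (Var 1)
                (Op Omin (Var 1) (Op Oadd (Arr 0 (Var 2))
                  (Let (Var 5) (Let (Var 5) (Let (Op Oadd (Var 14) (Var 2))
                    (Let (Op Oadd (Var 15) (Var 6)) fE))))))))))))))
    erE.

(** The window y[u,v) has at most one symbol here. It is looked for only among the first K symbols
    of y[l,r), since a full scan would cost another factor n; [complete0] shows that a later match
    may be missed. *)
Definition costE0 : expr :=
  If (Op Olt (Var 3) (Var 2))
    (Op Osub (If (Op Osub (Var 0) (Var 1)) (Op Osub (Var 0) (Var 1)) (Cst 1))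
       (Fold 7 (Cst 0)
          (If (Op Olt (Var 1) (Op Osub (Var 2) (Var 3)))
              (If (Op Oeq (QY (Var 5)) (QY (Op Oadd (Var 3) (Var 1)))) (Cst 1) (Var 0))
              (Var 0))))
    (Op Osub (Var 0) (Var 1)).

(* [costE t] approximates the edit distance of y[u,v) and y[l,r) when v - u is at most
   (register 8)^t.  Environment: r, l, v, u. *)
Fixpoint costE (t : nat) : expr :=
  match t with
  | 0 => costE0
  | S t =>
    Fold 5 (Par 1)
      (Let (Var 3) (Let (Op Osub (Var 3) (Var 4)) (Let (pow2E 3) (Let gapE
        (Op Omin (Var 4)
          (gridE 8
            (Op Omin (Op Omul (Var 1) (powE 8 t)) (Op Osub (Var 10) (Var 11)))
            (Op Oadd (Var 12) (Var 0))
            (Op Oadd (Var 13) (Op Omin (Op Omul (Op Oadd (Var 3) (Cst 1)) (powE 8 t)) (Op Osub (Var 12) (Var 13))))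
            (costE t)
            (Fold 2 (Par 1)
              (Let (Op Omul (Var 2) (Op Oadd (Op Odiv (Op Osub (Op Osub (Var 10) (Var 11)) (Var 3)) (Var 2)) (Var 1)))
                (If (Op Olt (Var 5) (Var 0)) (Var 1)
                   (Op Omin (Var 1) (Op Oadd (Arr 0 (Var 2)) (Op Osub (Var 5) (Var 0)))))))))))))
  end.

Definition modE (e m : expr) : expr := Op Osub e (Op Omul (Op Odiv e m) m).
Definition valE (e : expr) : expr := Op Odiv e (Op Omul (Par 6) (Par 6)).
Definition loE (e : expr) : expr := modE (Op Odiv e (Par 6)) (Par 6).
Definition hiE (e : expr) : expr := modE e (Par 6).
(** Distance, left end and right end in base n + 1, the distance leading: one minimum over keys
    selects the smallest distance together with its window, in a single register. *)
Definition keyE (a l r : expr) : expr :=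
  Op Oadd (Op Omul (Op Oadd (Op Omul a (Par 6)) l) (Par 6)) r.
Definition lenE (a k : nat) : expr := Op Osub (hiE (Arr a (Var k))) (loE (Arr a (Var k))).

(** Environment: the symbol and its index in x. Without a match the empty window at distance 1
    remains. Indices from n on occur because b^T may exceed n; their blocks are empty, and key 0 is
    the empty window at distance 0. *)
Definition leafE : expr :=
  If (Op Olt (Var 1) (Par 0))
    (Fold 6 (keyE (Cst 1) (Cst 0) (Cst 0))
       (If (Op Olt (Var 1) (Par 0))
          (If (Op Oeq (QY (Var 1)) (Var 2))
             (Op Omin (Var 0) (keyE (Cst 0) (Var 1) (Op Oadd (Var 1) (Cst 1))))
             (Var 0))
          (Var 0)))
    (Cst 0).

(** Environment: the start of the block, and the array of the children's keys. The first candidate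
    is the empty window, at a distance equal to the length of the block; the minima with [Par 0] cut
    the block off at the end of x. *)
Definition mergeE (t : nat) : expr :=
  Let (Fold 4 (Cst 0) (Op Oadd (Var 0) (valE (Arr 0 (Var 1)))))
    (Op Omin
      (keyE (Op Osub (Op Omin (Op Oadd (Var 1) (powE 4 (S t))) (Par 0)) (Op Omin (Var 1) (Par 0)))
            (Cst 0) (Cst 0))
      (Fold 5 (Par 1)
        (Op Omin (Var 0)
          (Fold 6 (Par 1)
            (Let (Var 1) (Let (Op Osub (Par 0) (Var 0)) (Let (pow2E 5) (Let gapE
              (Op Omin (Var 4)
                (gridE 4
                  (Fold 4 (Cst 0) (If (Op Olt (Var 1) (Var 3)) (Op Oadd (Var 0) (lenE 1 1)) (Var 0)))
                  (loE (Arr 1 (Var 2)))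
                  (hiE (Arr 1 (Var 3)))
                  (costE t)
                  (Let (Fold 4 (Cst 0) (Op Oadd (Var 0) (lenE 1 1)))
                    (Fold 2 (Par 1)
                      (Let (Op Omul (Var 3) (Op Oadd (Op Odiv (Op Osub (Var 2) (Var 4)) (Var 3)) (Var 1)))
                        (If (Op Olt (Var 6) (Var 0)) (Var 1)
                          (Op Omin (Var 1)
                            (keyE (Op Oadd (Var 12) (Arr 0 (Var 2))) (Var 7) (Op Oadd (Var 7) (Var 0)))))))))))))))))).

(** * The expressions evaluated to functions *)

Section Eval.
Variables (rho : nat -> nat) (y : list nat).
Notation V := (rho 1).
Notation W := (rho 2).
Notation evr := (ev (rho 1) (rho 2) rho y).

Lemma ev_gridE N siE uiE viE fE erE g dl R l env arrs f sI uI vI :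
  (forall i j dp, evr siE (j :: i :: g :: dl :: R :: l :: env) (dp :: arrs) = sI i) ->
  (forall i j dp, evr uiE (sI i :: j :: i :: g :: dl :: R :: l :: env) (dp :: arrs) = uI i) ->
  (forall i j dp, evr viE (uI i :: sI i :: j :: i :: g :: dl :: R :: l :: env) (dp :: arrs) = vI i) ->
  (forall u v p q env arrs, evr fE (q :: p :: v :: u :: env) arrs = f u v p q) ->
  evr (gridE N siE uiE viE fE erE) (g :: dl :: R :: l :: env) arrs =
  evr erE (g :: dl :: R :: l :: env) (grid V W f sI uI vI l R dl g (rho N) :: arrs).
Proof.
  intros Hs Hu Hv Hf. unfold gridE. cbn [ev nth opf]. f_equal. f_equal.
  unfold grid. apply loop_ext. intros i dp _. apply functional_extensionality; intros j.
  unfold grid_step. rewrite Hs, Hu, Hv. unfold gpos.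
  match goal with |- context [if ?c =? 0 then _ else V] => destruct (c =? 0) end; auto.
  apply loop_ext. intros j' acc _. cbv beta.
  match goal with |- context [if ?c =? 0 then _ else acc] => destruct (c =? 0) end; [rewrite Hf|]; reflexivity.
Qed.

Definition pw (k : nat) : nat :=
  loop (rho 5) (fun i a => if b2n (i <? k) =? 0 then a else Nat.min V (a + a)) 1.

Fixpoint pows (i t : nat) : nat :=
  match t with 0 => 1 | S t => Nat.min V (pows i t * rho i) end.

Definition gap (dl : nat) : nat :=
  let d := dl / Nat.min V (rho 7 * rho 8) in if d =? 0 then 1 else d.

Lemma ev_Let e1 e2 env arrs : evr (Let e1 e2) env arrs = evr e2 (evr e1 env arrs :: env) arrs.
Proof. reflexivity. Qed.

Lemma ev_Op o e1 e2 env arrs : evr (Op o e1 e2) env arrs = opf V o (evr e1 env arrs) (evr e2 env arrs).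
Proof. reflexivity. Qed.

Lemma ev_Var i env arrs : evr (Var i) env arrs = nth i env 0.
Proof. reflexivity. Qed.

Lemma ev_Fold N e0 eb env arrs : evr (Fold N e0 eb) env arrs =
  loop (rho N) (fun k acc => evr eb (acc :: k :: env) arrs) (evr e0 env arrs).
Proof. reflexivity. Qed.

Lemma ev_pow2E k env arrs : evr (pow2E k) env arrs = pw (nth k env 0).
Proof. reflexivity. Qed.

Lemma ev_gapE dl env arrs : evr gapE (dl :: env) arrs = gap dl.
Proof. reflexivity. Qed.

Lemma ev_powE i t env arrs : evr (powE i t) env arrs = pows i t.
Proof. induction t as [|t IH]; simpl; congruence. Qed.

Definition inner_end (s R dl g : nat) (dp : nat -> nat) : nat :=
  loop W (fun j acc => if b2n (R <? gpos V g dl s j) =? 0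
    then Nat.min acc (Nat.min V (cellv V W dp j + (R - gpos V g dl s j))) else acc) V.

Definition costf0 (u v l r : nat) : nat :=
  if b2n (u <? v) =? 0 then r - l
  else (if r - l =? 0 then 1 else r - l) -
    loop (rho 7) (fun k acc => if b2n (k <? r - l) =? 0 then acc
      else if b2n (Nat.min V (nth u y 0) =? Nat.min V (nth (Nat.min V (l + k)) y 0)) =? 0
           then acc else 1) 0.

Fixpoint costf (t : nat) (u v l r : nat) : nat :=
  match t with
  | 0 => costf0 u v l r
  | S t =>
    loop (rho 5) (fun k acc => Nat.min acc
      (inner_end (v - u) (r - l) (pw k) (gap (pw k))
        (grid V W (costf t) (fun i => Nat.min (Nat.min V (i * pows 8 t)) (v - u))
          (fun i => Nat.min V (u + Nat.min (Nat.min V (i * pows 8 t)) (v - u)))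
          (fun i => Nat.min V (u + Nat.min (Nat.min V (Nat.min V (i + 1) * pows 8 t)) (v - u)))
          l (r - l) (pw k) (gap (pw k)) (rho 8)))) V
  end.

Lemma ev_costE t : forall u v l r env arrs, evr (costE t) (r :: l :: v :: u :: env) arrs = costf t u v l r.
Proof.
  induction t as [|t IH]; intros u v l r env arrs.
  - cbn [costE costf]. unfold costE0, costf0. cbn [ev nth opf].
    destruct (b2n (u <? v) =? 0); reflexivity.
  - cbn [costE costf]. rewrite ev_Fold. apply loop_ext. intros k acc _.
    rewrite ev_Let, ev_Var, ev_Let, ev_Op, !ev_Var. cbn [nth].
    rewrite ev_Let, ev_pow2E. cbn [nth]. rewrite ev_Let, ev_gapE, ev_Op, ev_Var. cbn [nth opf]. f_equal.
    rewrite (ev_gridE _ _ _ _ _ _ _ _ _ _ _ _ (costf t)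
          (fun i => Nat.min (Nat.min V (i * pows 8 t)) (v - u))
          (fun i => Nat.min V (u + Nat.min (Nat.min V (i * pows 8 t)) (v - u)))
          (fun i => Nat.min V (u + Nat.min (Nat.min V (Nat.min V (i + 1) * pows 8 t)) (v - u)))); auto.
    + intros i j dp. cbn [ev nth opf]. rewrite ev_powE. reflexivity.
    + intros i j dp. cbn [ev nth opf]. rewrite ev_powE. reflexivity.
Qed.

Definition kval (k : nat) := k / Nat.min V (rho 6 * rho 6).
Definition kmod (k : nat) := k - Nat.min V (k / rho 6 * rho 6).
Definition klo (k : nat) := kmod (k / rho 6).
Definition key (a l r : nat) :=
  Nat.min V (Nat.min V (Nat.min V (Nat.min V (a * rho 6) + l) * rho 6) + r).

Definition leaff (a s : nat) : nat :=
  if b2n (s <? rho 0) =? 0 then 0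
  else loop (rho 6) (fun k acc => if b2n (k <? rho 0) =? 0 then acc
      else if b2n (Nat.min V (nth k y 0) =? a) =? 0 then acc
           else Nat.min acc (key 0 k (Nat.min V (k + 1)))) (key 1 0 0).

Lemma ev_leafE a s env arrs : evr leafE (a :: s :: env) arrs = leaff a s.
Proof.
  unfold leafE, leaff, keyE, key. cbn [ev nth opf].
  destruct (b2n (s <? rho 0) =? 0); auto.
Qed.

Definition klen (k : nat) := kmod k - klo k.

Definition outer_end (s R dl g D l : nat) (dp : nat -> nat) : nat :=
  loop W (fun j acc => if b2n (R <? gpos V g dl s j) =? 0
    then Nat.min acc (key (Nat.min V (D + cellv V W dp j)) l (Nat.min V (l + gpos V g dl s j)))
    else acc) V.

Definition mergef (t s : nat) (keys : nat -> nat) : nat :=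
  let D := loop (rho 4) (fun k acc => Nat.min V (acc + kval (cellv V W keys k))) 0 in
  Nat.min (key (Nat.min (Nat.min V (s + pows 4 (S t))) (rho 0) - Nat.min s (rho 0)) 0 0)
    (loop (rho 5) (fun k acc => Nat.min acc
      (loop (rho 6) (fun l acc => Nat.min acc
         (outer_end (loop (rho 4) (fun k acc => Nat.min V (acc + klen (cellv V W keys k))) 0)
            (rho 0 - l) (pw k) (gap (pw k)) D l
            (grid V W (costf t)
              (fun i => loop (rho 4) (fun k acc => if b2n (k <? i) =? 0 then acc
                  else Nat.min V (acc + klen (cellv V W keys k))) 0)
              (fun i => klo (cellv V W keys i)) (fun i => kmod (cellv V W keys i))
              l (rho 0 - l) (pw k) (gap (pw k)) (rho 4)))) V)) V).

Lemma ev_mergeE t s env keys arrs : evr (mergeE t) (s :: env) (keys :: arrs) = mergef t s keys.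
Proof.
  unfold mergeE, mergef. rewrite ev_Let.
  change (evr (Fold 4 (Cst 0) (Op Oadd (Var 0) (valE (Arr 0 (Var 1))))) (s :: env) (keys :: arrs))
    with (loop (rho 4) (fun k acc => Nat.min V (acc + kval (cellv V W keys k))) 0).
  set (D := loop (rho 4) (fun k acc => Nat.min V (acc + kval (cellv V W keys k))) 0).
  cbv zeta. rewrite ev_Op. cbn [opf]. f_equal.
  { cbn [keyE ev nth opf]. rewrite ev_powE. reflexivity. }
  rewrite ev_Fold. apply loop_ext; intros k acc _. rewrite ev_Op, ev_Var. cbn [nth opf]. f_equal.
  rewrite ev_Fold. apply loop_ext; intros l acc' _.
  rewrite ev_Let, ev_Var, ev_Let, ev_Op, !ev_Var. cbn [nth].
  rewrite ev_Let, ev_pow2E. cbn [nth]. rewrite ev_Let, ev_gapE, ev_Op, ev_Var. cbn [nth opf]. f_equal.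
  rewrite (ev_gridE _ _ _ _ _ _ _ _ _ _ _ _ (costf t)
     (fun i => loop (rho 4) (fun k acc => if b2n (k <? i) =? 0 then acc
                  else Nat.min V (acc + klen (cellv V W keys k))) 0)
     (fun i => klo (cellv V W keys i)) (fun i => kmod (cellv V W keys i))).
  - reflexivity.
  - reflexivity.
  - reflexivity.
  - reflexivity.
  - apply ev_costE.
Qed.

End Eval.

(** * The cost of comparing two windows of y *)

(** [par_Vn] leaves room for every key with d, l, r <= n and for guesses up to 4n, [par_VK] keeps
    the divisor in [gap] unsaturated, and [par_Vb] does the same for block lengths. The log2 n + 3
    guesses reach beyond 2n. *)
Record params (rho : nat -> nat) (y : list nat) (n b K T : nat) : Prop := {
  par_len : length y = n;
  par_0 : rho 0 = n;
  par_W : rho 2 = 8 * K * b + 4;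
  par_4 : rho 4 = b;
  par_5 : rho 5 = Nat.log2 n + 3;
  par_6 : rho 6 = n + 1;
  par_7 : rho 7 = K;
  par_8 : rho 8 = 2 * b;
  par_n : 1 <= n;
  par_b : 1 <= b;
  par_K : 1 <= K;
  par_Vn : (n + 1) * ((n + 1) * (n + 1)) + 4 * n + 4 < rho 1;
  par_VK : 2 * K * b <= rho 1;
  par_Vb : forall t, t <= T -> (2 * b) ^ t <= rho 1;
  par_y : forall i, nth i y 0 <= rho 1 }.

Section CostSpec.
Variables (rho : nat -> nat) (y : list nat) (n b K T : nat).
Notation V := (rho 1).
Notation W := (rho 2).
Hypothesis par : params rho y n b K T.
Let Hn : length y = n := par_len _ _ _ _ _ _ par.
Let Hr0 : rho 0 = n := par_0 _ _ _ _ _ _ par.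
Let HW : W = 8 * K * b + 4 := par_W _ _ _ _ _ _ par.
Let Hb : rho 4 = b := par_4 _ _ _ _ _ _ par.
Let HL : rho 5 = Nat.log2 n + 3 := par_5 _ _ _ _ _ _ par.
Let Hn1 : rho 6 = n + 1 := par_6 _ _ _ _ _ _ par.
Let HK : rho 7 = K := par_7 _ _ _ _ _ _ par.
Let Hb2 : rho 8 = 2 * b := par_8 _ _ _ _ _ _ par.
Let Hn0 : 1 <= n := par_n _ _ _ _ _ _ par.
Let Hb0 : 1 <= b := par_b _ _ _ _ _ _ par.
Let HK0 : 1 <= K := par_K _ _ _ _ _ _ par.
Let HVn : (n + 1) * ((n + 1) * (n + 1)) + 4 * n + 4 < V := par_Vn _ _ _ _ _ _ par.
Let HVK : 2 * K * b <= V := par_VK _ _ _ _ _ _ par.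
Let HVb : forall t, t <= T -> (2 * b) ^ t <= V := par_Vb _ _ _ _ _ _ par.
Let HVy : forall i, nth i y 0 <= V := par_y _ _ _ _ _ _ par.
Notation costr := (costf rho y).
Notation pwr := (pw rho).
Notation gapr := (gap rho).

Lemma V_large : 4 * n + 4 < V /\ (n + 1) * (n + 1) <= V.
Proof. pose proof (Nat.le_0_l ((n + 1) * ((n + 1) * (n + 1)))). split; [lia|nia]. Qed.

Lemma pw_exact j : j <= Nat.log2 n + 2 -> pwr j = 2 ^ j.
Proof.
  intros Hj. unfold pw. rewrite HL.
  assert (HV : 2 ^ j <= V).
  { apply Nat.le_trans with (2 ^ (Nat.log2 n + 2)); [apply Nat.pow_le_mono_r; lia|].
    rewrite Nat.pow_add_r. destruct (Nat.log2_spec n) as [H _]; [lia|].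
    change (2 ^ 2) with 4. destruct V_large; lia. }
  assert (E : forall m, loop m (fun i a => if b2n (i <? j) =? 0 then a else Nat.min V (a + a)) 1
     = 2 ^ (Nat.min m j)).
  { induction m as [|m IH]; cbn [loop]; auto. rewrite IH, b2n_eqb0.
    destruct (Nat.ltb_spec m j); cbn [negb].
    - replace (Nat.min m j) with m by lia. replace (Nat.min (S m) j) with (S m) by lia.
      rewrite Nat.min_r; [rewrite Nat.pow_succ_r'; lia|].
      apply Nat.le_trans with (2 ^ j); auto. 
      replace (2 ^ m + 2 ^ m) with (2 ^ S m) by (rewrite Nat.pow_succ_r'; lia).
      apply Nat.pow_le_mono_r; lia.
    - f_equal. lia. }
  rewrite E. f_equal. lia.
Qed.

(** Distances up to 2n occur in the merge, where two distances of at most n are added. The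
    alternative 1 is for k = 0, which no power of two approximates. *)
Lemma guess_exists k : k <= 2 * n ->
  exists j, j < rho 5 /\ k <= pwr j /\ (pwr j = 1 \/ pwr j <= 2 * k).
Proof.
  intros Hk. exists (Nat.log2_up k).
  assert (L : Nat.log2_up k <= Nat.log2 n + 2).
  { apply Nat.le_trans with (Nat.log2_up (2 * n)); [apply Nat.log2_up_le_mono; auto|].
    pose proof (Nat.le_log2_up_succ_log2 (2 * n)).
    replace (2 * n) with (2 ^ 1 * n) in * by (simpl; lia).
    rewrite (Nat.mul_comm (2 ^ 1)), Nat.log2_mul_pow2 in H by lia. 
    rewrite (Nat.mul_comm (2 ^ 1)). lia. }
  rewrite pw_exact by auto. split; [lia|].
  destruct (le_lt_dec k 1) as [H|H].
  - rewrite Nat.log2_up_eqn0 by auto. simpl. lia.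
  - destruct (Nat.log2_up_spec k H) as [H1 H2]. split; auto. right.
    destruct (Nat.log2_up k); simpl in *; lia.
Qed.

(** If dl <= 2k and g <= dl/(2Kb), then c <= 4b + 1 <= 6b roundings lose at most 6bg <= 6k/K; if the
    quotient is 0 then g = 1 and nothing is rounded. The width 8Kb + 4 comes from dl < 2Kb(g + 1) <=
    4Kbg. *)
Lemma gap_spec dl : 1 <= gapr dl /\ 2 * dl + gapr dl < W * gapr dl /\
  forall k c, c <= 2 * (2 * b) + 1 -> (dl = 1 \/ dl <= 2 * k) ->
    K * (k + c * (gapr dl - 1)) <= (K + 6) * k.
Proof.
  unfold gap. rewrite HK, Hb2, HW. replace (Nat.min V (K * (2 * b))) with (2 * K * b) by lia.
  pose proof (Nat.div_mod_eq dl (2 * K * b)) as E.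
  assert (P : 1 <= K * b) by nia.
  pose proof (Nat.mod_upper_bound dl (2 * K * b) ltac:(nia)) as E2.
  destruct (Nat.eqb_spec (dl / (2 * K * b)) 0) as [E0|E0].
  - rewrite E0 in E. repeat split; [lia|nia|]. intros k c _ _. rewrite Nat.sub_diag. nia.
  - set (g := dl / (2 * K * b)) in *. set (X := K * b) in *.
    replace (2 * K * b) with (2 * X) in * by (unfold X; lia).
    replace (8 * K * b + 4) with (8 * X + 4) by (unfold X; lia).
    repeat split; [lia|nia|].
    intros k c Hc [H|H]; [nia|].
    assert (c * (g - 1) <= (4 * b + 1) * g) by (apply Nat.mul_le_mono; lia).
    assert (K * (c * (g - 1)) <= K * ((4 * b + 1) * g)) by (apply Nat.mul_le_mono_l; auto).
    assert (K * ((4 * b + 1) * g) <= 6 * (X * g)) by (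
      replace (6 * (X * g)) with (K * ((6 * b) * g)) by (unfold X; ring);
      apply Nat.mul_le_mono_l, Nat.mul_le_mono_r; lia).
    assert (2 * (X * g) <= 2 * k) by nia.
    nia.
Qed.

Lemma pows_exact i t m : rho i = m -> (forall t', t' <= t -> m ^ t' <= V) -> pows rho i t = m ^ t.
Proof.
  intros Hi H. induction t as [|t IH]; auto. cbn [pows].
  rewrite IH, Hi by auto. specialize (H (S t) (le_n _)).
  rewrite Nat.pow_succ_r', Nat.mul_comm in *. lia.
Qed.

Definition sound t := forall u v l r, u <= v -> v <= n -> l <= r -> r <= n -> v - u <= (2 * b) ^ t ->
  costr t u v l r < V -> al (costr t u v l r) (sub y u v) (sub y l r).
(** The factor is (1 + 6/K)^(t + 1), cleared of denominators. *)
Definition complete t := forall u v l r k, u <= v -> v <= n -> l <= r -> r <= n -> v - u <= (2 * b) ^ t ->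
  al k (sub y u v) (sub y l r) -> K ^ (S t) * costr t u v l r <= (K + 6) ^ (S t) * k.

Lemma loop_flag m (c : nat -> bool) :
  let z := loop m (fun k acc => if c k then 1 else acc) 0 in
  z = 0 /\ (forall k, k < m -> c k = false) \/ z = 1 /\ exists k, k < m /\ c k = true.
Proof.
  induction m as [|m IH]; cbn [loop]; [left; split; auto; lia|]. cbv zeta in *.
  destruct (c m) eqn:C.
  - right; split; auto; exists m; auto.
  - destruct IH as [[-> H]|[-> (k & Lk & H)]].
    + left; split; auto. intros k Lk. destruct (Nat.eq_dec k m) as [->|]; auto. apply H; lia.
    + right; split; auto. exists k; auto.
Qed.

Lemma costf0_found u l r : u < n -> l <= r -> r <= n ->
  let z := loop K (fun k acc => if b2n (k <? r - l) =? 0 then acc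
      else if b2n (Nat.min V (nth u y 0) =? Nat.min V (nth (Nat.min V (l + k)) y 0)) =? 0
           then acc else 1) 0 in
  z = 0 /\ (forall j, j < K -> l + j < r -> nth (l + j) y 0 <> nth u y 0) \/
  z = 1 /\ exists j, j < K /\ l + j < r /\ nth (l + j) y 0 = nth u y 0.
Proof.
  intros Hu Hl Hr.
  pose proof (loop_flag K (fun k => (k <? r - l) && (nth u y 0 =? nth (l + k) y 0))%bool) as H.
  cbv zeta in *.
  rewrite (loop_ext K _ (fun k acc => if ((k <? r - l) && (nth u y 0 =? nth (l + k) y 0))%bool then 1 else acc)).
  - destruct H as [[-> H]|[-> (k & Lk & H)]]; [left|right]; split; auto.
    + intros j Lj Lj' E. specialize (H j Lj). apply Bool.andb_false_iff in H as [H|H].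
      * apply Nat.ltb_ge in H; lia.
      * apply Nat.eqb_neq in H; congruence.
    + apply andb_prop in H as [H1 H2]. apply Nat.ltb_lt in H1; apply Nat.eqb_eq in H2.
      exists k; repeat split; auto; lia.
  - intros k z _. rewrite !b2n_eqb0. destruct (Nat.ltb_spec k (r - l)); cbn [negb andb]; auto.
    pose proof (HVy u). pose proof (HVy (l + k)).
    rewrite (Nat.min_r V (l + k)), !Nat.min_r by lia. destruct (_ =? _); reflexivity.
Qed.

Lemma sound0 : sound 0.
Proof.
  intros u v l r Hu Hv Hl Hr Hs. unfold costf, costf0. rewrite HK, b2n_eqb0.
  destruct (Nat.ltb_spec u v) as [L|L]; cbn [negb]; intros _.
  - simpl in Hs. assert (v = S u) by lia; subst v. rewrite sub_single by lia.
    destruct (costf0_found u l r) as [[-> H]|[-> (j & Lj & Lj' & H)]]; auto.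
    + eapply al_le; [apply al_max|]. rewrite sub_length by lia.
      destruct (Nat.eqb_spec (r - l) 0); simpl length; lia.
    + rewrite <- (sub_app y l (l + j) r), <- (sub_app y (l + j) (S (l + j)) r), sub_single by lia.
      rewrite H. apply al_le with (j + (r - S (l + j))).
      * change [nth u y 0] with ([] ++ [nth u y 0]) at 1. apply al_app.
        -- eapply al_le; [apply al_nil_l|]. rewrite sub_length; lia.
        -- simpl. apply al_eq. eapply al_le; [apply al_nil_l|]. rewrite sub_length; lia.
      * destruct (Nat.eqb_spec (r - l) 0); lia.
  - rewrite (sub_empty y u v) by lia. eapply al_le; [apply al_nil_l|]. rewrite sub_length; lia.
Qed.

Lemma complete0 : complete 0.
Proof.
  intros u v l r k Hu Hv Hl Hr Hs Ha. unfold costf, costf0. rewrite HK, b2n_eqb0.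
  rewrite !Nat.pow_1_r.
  destruct (Nat.ltb_spec u v) as [L|L]; cbn [negb].
  - simpl in Hs. assert (v = S u) by lia; subst v. rewrite sub_single in Ha by lia.
    apply al_single in Ha. rewrite sub_length in Ha by lia.
    destruct (costf0_found u l r) as [[-> H]|[-> (j & Lj & Lj' & H)]]; auto.
    + destruct Ha as [Ha|[Hin Ha]].
      * assert ((if r - l =? 0 then 1 else r - l) <= k) by (destruct (Nat.eqb_spec (r - l) 0); lia).
        nia.
      * destruct (sub_In _ _ _ _ Hin) as (j & Lj & E); [lia|].
        (* The match lies beyond the K symbols searched. Then the true cost is at least r - l - 1 >=
           K, and the value r - l is too large by 1 only, a factor of at most 1 + 1/K. *)
        assert (K <= r - l - 1).
        { destruct (le_lt_dec K (j - l)); [lia|]. exfalso. apply (H (j - l)); try lia.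
          replace (l + (j - l)) with j by lia; auto. }
        destruct (Nat.eqb_spec (r - l) 0); nia.
    + destruct (Nat.eqb_spec (r - l) 0); [lia|].
      assert (r - l - 1 <= k) by lia. nia.
  - rewrite (sub_empty y u v) in Ha by lia. apply al_length in Ha as [Ha _].
    rewrite sub_length in Ha by lia. simpl in Ha. nia.
Qed.

Section Step.
Variables (t u v l r : nat).
Hypothesis (HtT : S t <= T) (Hu : u <= v) (Hv : v <= n) (Hl : l <= r) (Hr : r <= n)
  (Hs : v - u <= (2 * b) ^ S t).
Let M := (2 * b) ^ t.
Let sI i := Nat.min (i * M) (v - u).

Lemma blocks_u i : i <= 2 * b ->
  Nat.min (Nat.min V (i * pows rho 8 t)) (v - u) = sI i.
Proof.
  intros Hi. rewrite (pows_exact 8 t (2 * b)) by (auto; intros; apply HVb; lia).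
  fold M. unfold sI. pose proof (HVb (S t) HtT) as H. rewrite Nat.pow_succ_r' in H. fold M in H.
  assert (i * M <= 2 * b * M) by (apply Nat.mul_le_mono_r; auto). lia.
Qed.

Lemma sI_facts : sI 0 = 0 /\ sI (2 * b) = v - u /\ forall i, sI i <= sI (S i) <= sI i + M /\ sI i <= v - u.
Proof.
  unfold sI. rewrite Nat.pow_succ_r' in Hs. fold M in Hs. repeat split; simpl; lia.
Qed.

(** Within the bounds on the parameters none of the clamps acts, and the blocks of y[u,v) are the
    intended ones. *)
Lemma grid_costf k : 
  let G := grid V W (costr t) (fun i => Nat.min (Nat.min V (i * pows rho 8 t)) (v - u))
          (fun i => Nat.min V (u + Nat.min (Nat.min V (i * pows rho 8 t)) (v - u)))
          (fun i => Nat.min V (u + Nat.min (Nat.min V (Nat.min V (i + 1) * pows rho 8 t)) (v - u)))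
          l (r - l) (pwr k) (gapr (pwr k)) (rho 8) in
  G = grid V W (costr t) sI (fun i => u + sI i) (fun i => u + sI (S i))
       l (r - l) (pwr k) (gapr (pwr k)) (2 * b).
Proof.
  cbv zeta. rewrite Hb2. unfold grid. apply loop_ext. intros i dp Hi.
  apply functional_extensionality; intros j. unfold grid_step.
  destruct sI_facts as (_ & _ & SF). destruct V_large.
  pose proof (proj2 (SF i)). pose proof (proj2 (SF (S i))). 
  assert (E0 : 2 * b <= V) by nia.
  replace (Nat.min V (i + 1)) with (S i) by lia.
  rewrite !blocks_u by lia.
  replace (Nat.min V (u + sI i)) with (u + sI i) by lia.
  replace (Nat.min V (u + sI (S i))) with (u + sI (S i)) by lia.
  reflexivity.
Qed.

Lemma grid_hyps : length y < V /\ l + (r - l) <= length y /\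
  (forall i, i < 2 * b -> sI (S i) = sI i + ((u + sI (S i)) - (u + sI i))) /\
  (forall i, i <= 2 * b -> sI i <= V) /\
  (forall i, i < 2 * b -> u + sI i <= u + sI (S i) <= length y).
Proof.
  destruct sI_facts as (_ & _ & SF). destruct V_large. rewrite Hn.
  split; [lia|]. split; [lia|].
  split; [|split]; intros i Hi; pose proof (SF i); pose proof (SF (S i)); lia.
Qed.

Lemma xcat_blocks i : i <= 2 * b ->
  xcat y (fun i => u + sI i) (fun i => u + sI (S i)) i = sub y u (u + sI i).
Proof.
  destruct sI_facts as (S0 & _ & SF).
  induction i as [|i IH]; intros L; cbn [xcat].
  - rewrite sub_empty; auto. rewrite S0; lia.
  - rewrite IH by lia. apply sub_app; specialize (SF i); lia.
Qed.

Lemma costf_step_sound : sound t -> costr (S t) u v l r < V ->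
  al (costr (S t) u v l r) (sub y u v) (sub y l r).
Proof.
  intros IH Hlt. destruct sI_facts as (SF0 & SF1 & SF).
  destruct grid_hyps as (G1 & G2 & G3 & G4 & G5).
  cbn [costf] in *.
  match type of Hlt with loop _ ?F _ < _ =>
    destruct (loop_min (rho 5) F V (fun _ => true) (fun k => inner_end rho (v - u) (r - l) (pwr k) (gapr (pwr k))
     (grid V W (costr t) sI (fun i => u + sI i) (fun i => u + sI (S i))
       l (r - l) (pwr k) (gapr (pwr k)) (2 * b))))
      as (_ & _ & [E|(k & _ & _ & E)])
  end.
  { intros k z _. rewrite grid_costf. reflexivity. }
  { lia. }
  rewrite E in *. unfold inner_end in *.
  set (dp := grid _ _ _ _ _ _ _ _ _ _ _) in *.
  match type of Hlt with loop _ ?F _ < _ =>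
    destruct (loop_min W F V (fun j => negb (r - l <? gpos V (gapr (pwr k)) (pwr k) (v - u) j))
      (fun j => Nat.min V (cellv V W dp j + (r - l - gpos V (gapr (pwr k)) (pwr k) (v - u) j))))
      as (_ & _ & [E'|(j & Lj & Cj & E')])
  end.
  { intros j z _. rewrite b2n_eqb0. reflexivity. }
  { lia. }
  rewrite E' in *. apply Bool.negb_true_iff, Nat.ltb_ge in Cj.
  set (q := gpos _ _ _ _ _) in *.
  unfold cellv in *. replace (Nat.min j (W - 1)) with j in * by lia.
  replace (Nat.min V (Nat.min V (dp j) + (r - l - q))) with (dp j + (r - l - q)) in * by lia.
  (* What remains of y[l,r) after the last cut is matched with nothing. *)
  rewrite <- (app_nil_r (sub y u v)), <- (sub_app y l (l + q) r) by lia.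
  apply al_app.
  - assert (Sd := grid_sound V W y (costr t) sI (fun i => u + sI i) (fun i => u + sI (S i)) l (r - l)
      (pwr k) (gapr (pwr k)) (2 * b) G1 G2 SF0 G3 G4).
    specialize (Sd ltac:(intros i p q' Hi Hp Hq Hf; apply IH; try lia; specialize (SF i);
       specialize (G5 i Hi); fold M; lia) (2 * b) j (le_n _)).
    rewrite SF1 in Sd. fold q in Sd. fold dp in Sd.
    rewrite xcat_blocks, SF1 in Sd by lia. replace (u + (v - u)) with v in Sd by lia.
    apply Sd; lia.
  - eapply al_le; [apply al_nil_l|]. rewrite sub_length; lia.
Qed.

(** Two roundings for each of the 2b blocks and one for the tail after the last cut make 2(2b) + 1
    gaps, which [gap_spec] turns into one more factor (K + 6)/K. *)
Lemma costf_step_complete k : complete t -> al k (sub y u v) (sub y l r) ->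
  K ^ S (S t) * costr (S t) u v l r <= (K + 6) ^ S (S t) * k.
Proof.
  intros IH Ha. destruct sI_facts as (SF0 & SF1 & SF).
  destruct grid_hyps as (G1 & G2 & G3 & G4 & G5).
  (* The guesses reach only to 2n; larger costs may be lowered to 2n, because two windows of y are
     never farther apart than that. *)
  assert (Hk : exists k', k' <= k /\ k' <= 2 * n /\ al k' (sub y u v) (sub y l r)).
  { exists (Nat.min k (2 * n)). repeat split; try lia.
    destruct (Nat.min_dec k (2 * n)) as [E|E]; rewrite E; auto.
    eapply al_le; [apply al_max|]. rewrite !sub_length; lia. }
  destruct Hk as (k' & Hkk & Hk2 & Ha'). 
  eapply Nat.le_trans; [|apply Nat.mul_le_mono_l; exact Hkk].
  clear k Ha Hkk. rename k' into k. rename Ha' into Ha.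
  destruct (guess_exists k Hk2) as (i0 & Li0 & Hd1 & Hd2).
  destruct (gap_spec (pwr i0)) as (Hg1 & Hg2 & Hg3).
  set (dl := pwr i0) in *. set (g := gapr dl) in *.
  cbn [costf].
  match goal with |- _ * loop _ ?F _ <= _ =>
    destruct (loop_min (rho 5) F V (fun _ => true) (fun k => inner_end rho (v - u) (r - l) (pwr k) (gapr (pwr k))
     (grid V W (costr t) sI (fun i => u + sI i) (fun i => u + sI (S i))
       l (r - l) (pwr k) (gapr (pwr k)) (2 * b))))
      as (_ & H1 & _)
  end.
  { intros j z _. rewrite grid_costf. reflexivity. }
  specialize (H1 i0 Li0 eq_refl). cbv beta in H1. fold dl in H1. fold g in H1.
  set (dp := grid _ _ _ _ _ _ _ _ _ _ _) in *.
  destruct (grid_complete V W y (costr t) sI (fun i => u + sI i) (fun i => u + sI (S i)) l (r - l)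
      dl g (2 * b) G1 G2 SF0 G3 G4 G5 ((K + 6) ^ S t) (K ^ S t)) with (i := 2 * b) (pt := r - l) (k := k)
    as (j & Lj & Gj & Bj); auto.
  { apply Nat.pow_le_mono_l; lia. }
  { intros i p q k0 Hi Hp Hq Hal. apply IH; try lia; auto; specialize (SF i); specialize (G5 i Hi); fold M; lia. }
  { rewrite xcat_blocks, SF1 by lia. replace (u + (v - u)) with v by lia.
    replace (l + (r - l)) with r by lia. auto. }
  rewrite SF1 in Gj. fold dp in Bj.
  set (q := g * ((r - l) / g)) in *.
  assert (Lq : q <= r - l) by (apply Nat.Div0.mul_div_le).
  assert (Lq' : r - l - q <= g - 1).
  { pose proof (Nat.div_mod_eq (r - l) g). pose proof (Nat.mod_upper_bound (r - l) g ltac:(lia)). unfold q; lia. }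
  unfold inner_end in H1.
  match type of H1 with _ <= loop _ ?F _ =>
    destruct (loop_min W F V (fun j => negb (r - l <? gpos V g dl (v - u) j))
      (fun j => Nat.min V (cellv V W dp j + (r - l - gpos V g dl (v - u) j))))
      as (_ & H2 & _)
  end.
  { intros j0 z _. rewrite b2n_eqb0. reflexivity. }
  specialize (H2 j Lj). cbv beta in H2. rewrite Gj in H2.
  specialize (H2 ltac:(apply Bool.negb_true_iff, Nat.ltb_ge; auto)).
  unfold cellv in H2. replace (Nat.min j (W - 1)) with j in * by lia.
  assert (H3 : forall z, z <= Nat.min V (Nat.min V (dp j) + (r - l - q)) -> z <= dp j + (g - 1)) by lia.
  eapply Nat.le_trans in H2; [|exact H1]. apply H3 in H2. clear H1 H3.
  eapply Nat.le_trans; [apply Nat.mul_le_mono_l; exact H2|].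
  rewrite (Nat.pow_succ_r' K (S t)), (Nat.pow_succ_r' (K + 6) (S t)).
  set (Q := K ^ S t) in *. set (P := (K + 6) ^ S t) in *.
  assert (QP : Q <= P) by (apply Nat.pow_le_mono_l; lia).
  specialize (Hg3 k (2 * (2 * b) + 1) (le_n _) Hd2).
  assert (A1 : Q * (dp j + (g - 1)) <= P * (k + (2 * (2 * b) + 1) * (g - 1))).
  { rewrite Nat.mul_add_distr_l.
    replace (k + (2 * (2 * b) + 1) * (g - 1)) with ((k + 2 * (2 * b) * (g - 1)) + (g - 1)) by lia.
    rewrite Nat.mul_add_distr_l. apply Nat.add_le_mono; auto. apply Nat.mul_le_mono_r; auto. }
  rewrite <- !Nat.mul_assoc.
  eapply Nat.le_trans; [apply Nat.mul_le_mono_l; exact A1|].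
  rewrite (Nat.mul_assoc K P), (Nat.mul_comm K P), (Nat.mul_comm (K + 6)), <- !Nat.mul_assoc.
  apply Nat.mul_le_mono_l. rewrite (Nat.mul_comm k). exact Hg3.
Qed.

End Step.

Lemma costf_spec t : t <= T -> sound t /\ complete t.
Proof.
  induction t as [|t IH]; intros Ht.
  - split; [apply sound0|apply complete0].
  - destruct IH as [IH1 IH2]; [lia|]. split.
    + intros u v l r Hu Hv Hl Hr Hs Hlt. apply costf_step_sound; auto.
    + intros u v l r k Hu Hv Hl Hr Hs Ha. apply costf_step_complete; auto.
Qed.

End CostSpec.

(** * Summaries of blocks of x and how they merge *)

Section Merge.
Variables (rho : nat -> nat) (x y : list nat) (n b K T : nat) (be : R).
Notation V := (rho 1).
Notation W := (rho 2).
Hypothesis par : params rho y n b K T.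
Let Hn : length y = n := par_len _ _ _ _ _ _ par.
Let Hr0 : rho 0 = n := par_0 _ _ _ _ _ _ par.
Let HW : W = 8 * K * b + 4 := par_W _ _ _ _ _ _ par.
Let Hb : rho 4 = b := par_4 _ _ _ _ _ _ par.
Let HL : rho 5 = Nat.log2 n + 3 := par_5 _ _ _ _ _ _ par.
Let Hn1 : rho 6 = n + 1 := par_6 _ _ _ _ _ _ par.
Let HK : rho 7 = K := par_7 _ _ _ _ _ _ par.
Let Hb2 : rho 8 = 2 * b := par_8 _ _ _ _ _ _ par.
Let Hn0 : 1 <= n := par_n _ _ _ _ _ _ par.
Let Hb0 : 1 <= b := par_b _ _ _ _ _ _ par.
Let HK0 : 1 <= K := par_K _ _ _ _ _ _ par.
Let HVn : (n + 1) * ((n + 1) * (n + 1)) + 4 * n + 4 < V := par_Vn _ _ _ _ _ _ par.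
Let HVK : 2 * K * b <= V := par_VK _ _ _ _ _ _ par.
Let HVb : forall t, t <= T -> (2 * b) ^ t <= V := par_Vb _ _ _ _ _ _ par.
Let HVy : forall i, nth i y 0 <= V := par_y _ _ _ _ _ _ par.
Hypothesis (Hx : length x = n)
  (Hbe : forall t, t < T -> (INR ((K + 6) ^ S (S t)) <= be * INR (K ^ S (S t)))%R)
  (Hbe1 : (0 <= be)%R).
Notation costr := (costf rho y).
Notation pwr := (pw rho).
Notation gapr := (gap rho).
Notation keyr := (key rho).
Notation kvalr := (kval rho).
Notation klor := (klo rho).
Notation kmodr := (kmod rho).

Lemma V_large' : 4 * n + 4 < V /\ (n + 1) * (n + 1) <= V.
Proof. pose proof (Nat.le_0_l ((n + 1) * ((n + 1) * (n + 1)))). split; [lia|nia]. Qed.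

Lemma key_le a l r : keyr a l r <= (a * (n + 1) + l) * (n + 1) + r.
Proof.
  unfold key. rewrite Hn1.
  eapply Nat.le_trans; [apply Nat.le_min_r|]. apply Nat.add_le_mono_r.
  eapply Nat.le_trans; [apply Nat.le_min_r|]. apply Nat.mul_le_mono_r.
  eapply Nat.le_trans; [apply Nat.le_min_r|]. apply Nat.add_le_mono_r.
  apply Nat.le_min_r.
Qed.

(** Saturation is never undone, because each later operation only increases the number; so a key
    below V was computed exactly. *)
Lemma key_exact a l r : keyr a l r < V -> keyr a l r = (a * (n + 1) + l) * (n + 1) + r /\ a < V.
Proof.
  unfold key. rewrite Hn1. intros H.
  set (A := a * (n + 1)) in *.
  set (B := Nat.min V (Nat.min V A + l)) in *. set (C := B * (n + 1)) in *.
  assert (C < V /\ Nat.min V (Nat.min V C + r) = C + r) as [HC ->] by lia.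
  assert (B <= C) by (unfold C; nia).
  assert (A < V /\ B = A + l) as [HA HB] by (unfold B in *; lia).
  rewrite <- HB. split; [reflexivity|]. unfold A in HA. nia.
Qed.

Lemma key_decode d l r k : k = (d * (n + 1) + l) * (n + 1) + r -> l <= n -> r <= n -> k < V ->
  kvalr k = d /\ klor k = l /\ kmodr k = r.
Proof.
  intros E Hl Hr Hk. destruct V_large' as [V1 V2].
  assert (E1 : k / (n + 1) = d * (n + 1) + l)
    by (symmetry; apply Nat.div_unique with r; lia).
  assert (E2 : k / ((n + 1) * (n + 1)) = d)
    by (rewrite <- Nat.Div0.div_div, E1; symmetry; apply Nat.div_unique with l; lia).
  assert (E3 : (d * (n + 1) + l) / (n + 1) = d)
    by (symmetry; apply Nat.div_unique with l; lia).
  assert (Hle : (d * (n + 1) + l) * (n + 1) <= V) by lia.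
  assert (Hle2 : d * (n + 1) <= V) by nia.
  unfold kval, klo, kmod. rewrite Hn1, Nat.min_r, E1, E2, E3 by lia.
  repeat split; lia.
Qed.

(** The distance is the leading digit, so an upper bound on a key bounds its distance even when the
    minimum is attained by a different window. *)
Lemma kval_le d l r k : k <= (d * (n + 1) + l) * (n + 1) + r -> l <= n -> r <= n -> kvalr k <= d.
Proof.
  intros H Hl Hr. destruct V_large' as [V1 V2].
  unfold kval. rewrite Hn1, Nat.min_r by lia.
  apply Nat.lt_succ_r. apply Nat.Div0.div_lt_upper_bound. nia.
Qed.

(** [be] bounds (1 + 6/K)^(t + 2), the loss of the search at level t: t + 1 factors come from
    [costf t], one from rounding the cuts of the merge. *)
Fixpoint alpha (t : nat) : R :=
  match t with 0 => 1 | S t => alpha t + be * (alpha t + 1) end%R.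

Lemma alpha_pos t : (1 <= alpha t)%R.
Proof. induction t; simpl; nra. Qed.

Definition xblock (s m : nat) : list nat := sub x (Nat.min s n) (Nat.min (s + m) n).

(* A key stores a window y[l,r) close to the block of x starting at s, and a bound d on
   their distance that is within a factor alpha of the best window. *)
Record summary (t s k : nat) : Prop := {
  sm_lt : k < V;
  sm_win : klor k <= kmodr k /\ kmodr k <= n;
  sm_len : kmodr k - klor k <= (2 * b) ^ t;
  sm_le : kvalr k <= length (xblock s (b ^ t));
  sm_al : al (kvalr k) (xblock s (b ^ t)) (sub y (klor k) (kmodr k));
  sm_opt : forall l r j, l <= r -> r <= n -> al j (xblock s (b ^ t)) (sub y l r) ->
    (INR (kvalr k) <= alpha t * INR j)%R }.

Lemma leaf_summary s : summary 0 s (leaff rho y (nth s x 0) s).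
Proof.
  destruct V_large' as [V1 V2].
  assert (N2 : n * (n + 1) + (n + 1) = (n + 1) * (n + 1)) by lia.
  unfold leaff. rewrite b2n_eqb0, Hr0, Hn1.
  destruct (Nat.ltb_spec s n) as [Ls|Ls]; cbn [negb].
  - assert (EX : xblock s (b ^ 0) = [nth s x 0]).
    { unfold xblock. simpl. rewrite !Nat.min_l by lia. replace (s + 1) with (S s) by lia.
      apply sub_single; lia. }
    set (a := nth s x 0) in *.
    match goal with |- summary _ _ (loop _ ?F _) =>
      destruct (loop_min (n + 1) F (keyr 1 0 0) (fun k => (k <? n) && (nth k y 0 =? a))%bool
        (fun k => keyr 0 k (k + 1))) as (H1 & H2 & H3) end.
    { intros k z Hk. rewrite !b2n_eqb0. destruct (Nat.ltb_spec k n); cbn [negb andb]; auto.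
      rewrite (Nat.min_r V (k + 1)), (Nat.min_r V (nth k y 0)) by (auto; lia).
      destruct (_ =? a); reflexivity. }
    set (z := loop _ _ _) in *.
    pose proof (key_le 1 0 0) as B1.
    assert (Hz : z < V) by nia.
    destruct H3 as [E|(k & Lk & Ck & E)].
    + rewrite E in Hz. destruct (key_exact 1 0 0 Hz) as [Ek _].
      destruct (key_decode 1 0 0 z) as (D1 & D2 & D3); try lia.
      split; rewrite ?D1, ?D2, ?D3, ?EX; simpl; try lia.
      * rewrite sub_empty by lia. constructor; constructor.
      (* Distance 1 is beaten only by distance 0, that is by an occurrence of the symbol in y, and
         its key would have been smaller. *)
      * intros l r j Hl Hr Ha. rewrite Rmult_1_l. change 1%R with (INR 1). apply le_INR.
        destruct j as [|j]; [exfalso|lia].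
        apply al_zero in Ha. assert (Lr : r = S l).
        { apply (f_equal (@length nat)) in Ha. rewrite sub_length in Ha by lia. simpl in Ha. lia. }
        subst r. rewrite sub_single in Ha by lia. injection Ha as Ha.
        specialize (H2 l ltac:(lia)). rewrite <- Ha in H2.
        specialize (H2 ltac:(apply andb_true_intro; split; [apply Nat.ltb_lt; lia|apply Nat.eqb_refl])).
        pose proof (key_le 0 l (l + 1)). nia.
    + apply andb_prop in Ck as [C1 C2]. apply Nat.ltb_lt in C1. apply Nat.eqb_eq in C2.
      rewrite E in Hz. destruct (key_exact 0 k (k + 1) Hz) as [Ek _].
      destruct (key_decode 0 k (k + 1) z) as (D1 & D2 & D3); try lia.
      split; rewrite ?D1, ?D2, ?D3, ?EX; simpl; try lia.
      * replace (k + 1) with (S k) by lia. rewrite sub_single, C2 by lia. apply al_refl.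
      * intros l r j _ _ _. pose proof (pos_INR j). lra.
  - assert (EX : xblock s (b ^ 0) = []).
    { unfold xblock. apply sub_empty; lia. }
    destruct (key_decode 0 0 0 0) as (D1 & D2 & D3); try lia.
    split; rewrite ?D1, ?D2, ?D3, ?EX; simpl; try lia.
    + rewrite sub_empty by lia. constructor.
    + intros l r j _ _ _. pose proof (pos_INR j). lra.
Qed.

Section Step.
Variables (t s : nat) (keys : nat -> nat).
Hypothesis (HtT : S t <= T)
  (Hkeys : forall j, j < b -> summary t (s + j * b ^ t) (keys j)).
Let M := b ^ t.
Let lo i := klor (keys i).
Let hi i := kmodr (keys i).
Let sI i := length (xcat y lo hi i).

Lemma keys_cell j : j < b -> cellv V W keys j = keys j.
Proof.
  intros Hj. unfold cellv. rewrite (Nat.min_l j) by nia.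
  pose proof (sm_lt _ _ _ (Hkeys j Hj)). lia.
Qed.

Lemma xblock_cat m m' : xblock s m ++ xblock (s + m) m' = xblock s (m + m').
Proof. unfold xblock. rewrite Nat.add_assoc. apply sub_app; lia. Qed.

Lemma xblock_length m : length (xblock s m) <= n /\ length (xblock s m) <= m.
Proof. unfold xblock. rewrite sub_length; lia. Qed.

Definition dsum (m : nat) := loop m (fun k acc => acc + kvalr (keys k)) 0.

(** Any window aligned with the block is cut by [al_split] into one piece per child. Each child is
    within [alpha t] of its own piece, so the sum of the children's distances loses no more than
    [alpha t]. *)
Lemma dsum_spec m : m <= b ->
  dsum m <= length (xblock s (m * M)) /\
  al (dsum m) (xblock s (m * M)) (xcat y lo hi m) /\
  forall l r j, l <= r -> r <= n -> al j (xblock s (m * M)) (sub y l r) ->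
    (INR (dsum m) <= alpha t * INR j)%R.
Proof.
  unfold dsum. induction m as [|m IH]; intros Hm; cbn [loop xcat].
  - replace (xblock s (0 * M)) with (@nil nat) by (unfold xblock; symmetry; apply sub_empty; lia).
    repeat split; [simpl; lia|constructor|].
    intros l r j _ _ _. pose proof (pos_INR j). pose proof (alpha_pos t). simpl. nra.
  - destruct IH as (H1 & H2 & H3); [lia|].
    replace (S m * M) with (m * M + M) by lia. rewrite <- xblock_cat.
    destruct (Hkeys m ltac:(lia)) as [K1 K2 K3 K4 K5 K6]. fold M in K4, K5, K6.
    repeat split.
    + rewrite length_app. lia.
    + apply al_app; auto.
    + intros l r j Hl Hr Ha. apply al_split in Ha as (j1 & j2 & y1 & y2 & -> & Ey & A1 & A2).
      assert (Ly : length y1 + length y2 = r - l).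
      { rewrite <- length_app, <- Ey, sub_length; lia. }
      assert (Y1 : y1 = sub y l (l + length y1)).
      { assert (E : firstn (length y1) (sub y l r) = y1).
        { rewrite Ey, firstn_app, Nat.sub_diag, firstn_all. simpl. apply app_nil_r. }
        rewrite <- E at 1. unfold sub. rewrite firstn_firstn. f_equal. lia. }
      assert (Y2 : y2 = sub y (l + length y1) r).
      { apply (app_inv_head y1). rewrite <- Ey. rewrite Y1 at 1. rewrite sub_app; auto; lia. }
      rewrite Y1 in A1. rewrite Y2 in A2.
      specialize (H3 l (l + length y1) j1 ltac:(lia) ltac:(lia) A1).
      specialize (K6 (l + length y1) r j2 ltac:(lia) ltac:(lia) A2).
      change (loop m _ 0) with (dsum m) in *.
      rewrite !plus_INR. lra.
Qed.

Lemma dsum_code : loop (rho 4) (fun k acc => Nat.min V (acc + kvalr (cellv V W keys k))) 0 = dsum b.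
Proof.
  destruct V_large' as [V1 _]. rewrite Hb. 
  assert (E : forall m, m <= b -> loop m (fun k acc => Nat.min V (acc + kvalr (cellv V W keys k))) 0 = dsum m).
  { induction m as [|m IH]; intros Hm; auto. cbn [loop]. rewrite IH, keys_cell by lia.
    change (dsum (S m)) with (dsum m + kvalr (keys m)). apply Nat.min_r.
    pose proof (proj1 (dsum_spec (S m) Hm)) as D. change (dsum (S m)) with (dsum m + kvalr (keys m)) in D.
    pose proof (xblock_length (S m * M)). lia. }
  apply E; auto.
Qed.

Lemma sI_le i : i <= b -> sI i <= 2 * n.
Proof.
  intros Hi. destruct (dsum_spec i Hi) as (H1 & H2 & _). apply al_length in H2 as [H2 _].
  pose proof (xblock_length (i * M)). unfold sI. lia.
Qed.

Lemma sI_S i : i < b -> sI (S i) = sI i + (hi i - lo i).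
Proof.
  intros Hi. unfold sI. cbn [xcat]. rewrite length_app. f_equal. apply sub_length.
  destruct (sm_win _ _ _ (Hkeys i Hi)). unfold hi. lia.
Qed.

Lemma sI_code i : i <= b ->
  loop (rho 4) (fun k acc => if b2n (k <? i) =? 0 then acc
                  else Nat.min V (acc + klen rho (cellv V W keys k))) 0 = sI i.
Proof.
  intros Hi. destruct V_large' as [V1 _]. rewrite Hb.
  assert (E : forall m, m <= b -> loop m (fun k acc => if b2n (k <? i) =? 0 then acc
                  else Nat.min V (acc + klen rho (cellv V W keys k))) 0 = sI (Nat.min m i)).
  { induction m as [|m IH]; intros Hm; auto. cbn [loop]. rewrite IH, b2n_eqb0 by lia.
    destruct (Nat.ltb_spec m i); cbn [negb].
    - replace (Nat.min m i) with m by lia. replace (Nat.min (S m) i) with (S m) by lia.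
      rewrite keys_cell by lia. rewrite sI_S by lia. unfold klen. fold (hi m). fold (lo m).
      apply Nat.min_r. rewrite <- sI_S by lia. pose proof (sI_le (S m) Hm). lia.
    - f_equal. lia. }
  rewrite E by lia. f_equal. lia.
Qed.

Lemma sI_code_all :
  loop (rho 4) (fun k acc => Nat.min V (acc + klen rho (cellv V W keys k))) 0 = sI b.
Proof.
  rewrite <- (sI_code b (le_n b)). apply loop_ext. intros k z Hk. rewrite b2n_eqb0.
  rewrite Hb in Hk. destruct (Nat.ltb_spec k b); [reflexivity|lia].
Qed.

Lemma grid_merge l k :
  grid V W (costr t)
    (fun i => loop (rho 4) (fun k acc => if b2n (k <? i) =? 0 then acc
        else Nat.min V (acc + klen rho (cellv V W keys k))) 0)
    (fun i => klor (cellv V W keys i)) (fun i => kmodr (cellv V W keys i))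
    l (rho 0 - l) (pwr k) (gapr (pwr k)) (rho 4) =
  grid V W (costr t) sI lo hi l (n - l) (pwr k) (gapr (pwr k)) b.
Proof.
  rewrite Hr0. unfold grid. rewrite Hb. apply loop_ext. intros i dp Hi.
  apply functional_extensionality; intros j. unfold grid_step.
  rewrite <- Hb, sI_code, keys_cell by lia. reflexivity.
Qed.

Lemma merge_grid_hyps : length y < V /\ sI 0 = 0 /\
  (forall i, i < b -> sI (S i) = sI i + (hi i - lo i)) /\
  (forall i, i <= b -> sI i <= V) /\
  (forall i, i < b -> lo i <= hi i <= length y).
Proof.
  destruct V_large' as [V1 _]. rewrite Hn. repeat split; try lia.
  - intros i Hi. apply sI_S; auto.
  - intros i Hi. pose proof (sI_le i Hi). lia.
  - apply (sm_win _ _ _ (Hkeys i H)).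
  - apply (sm_win _ _ _ (Hkeys i H)).
Qed.

Definition cand (k l j : nat) : nat :=
  keyr (Nat.min V (dsum b + cellv V W (grid V W (costr t) sI lo hi l (n - l) (pwr k) (gapr (pwr k)) b) j)) l
      (Nat.min V (l + gpos V (gapr (pwr k)) (pwr k) (sI b) j)).

(** The nested minima read as one, over guess, left end and cut point. The alternative [V <= z]
    stands for a search in which no cut point was accepted. *)
Lemma merge_min :
  let len := length (xblock s (b ^ S t)) in
  let z := mergef rho y t s keys in
  z <= keyr len 0 0 /\
  (forall k l j, k < rho 5 -> l <= n -> j < W -> gpos V (gapr (pwr k)) (pwr k) (sI b) j <= n - l ->
     z <= cand k l j) /\
  (z = keyr len 0 0 \/ V <= z \/ exists k l j, k < rho 5 /\ l <= n /\ j < W /\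
     gpos V (gapr (pwr k)) (pwr k) (sI b) j <= n - l /\ z = cand k l j).
Proof.
  destruct V_large' as [V1 _].
  cbv zeta. unfold mergef. rewrite dsum_code, sI_code_all.
  rewrite (pows_exact rho y n b K T par 4 (S t) b Hb).
  2: { intros t' Ht'. eapply Nat.le_trans; [|apply (HVb t'); lia]. apply Nat.pow_le_mono_l; lia. }
  replace (Nat.min (Nat.min V (s + b ^ S t)) (rho 0) - Nat.min s (rho 0))
    with (length (xblock s (b ^ S t))) by (unfold xblock; rewrite sub_length, Hr0; lia).
  match goal with |- context [Nat.min (keyr ?a 0 0) ?z] => set (z0 := z); set (k0 := keyr a 0 0) end.
  cbv zeta in z0.
  set (oe := fun k l => outer_end rho (sI b) (n - l) (pwr k) (gapr (pwr k)) (dsum b) l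
      (grid V W (costr t) sI lo hi l (n - l) (pwr k) (gapr (pwr k)) b)).
  assert (Ez : z0 = loop (rho 5) (fun k acc => Nat.min acc (loop (n + 1) (fun l acc => Nat.min acc (oe k l)) V)) V).
  { unfold z0. apply loop_ext. intros k acc Hk. f_equal. rewrite Hn1. apply loop_ext. intros l acc' Hl.
    f_equal. unfold oe. rewrite <- grid_merge. rewrite Hr0. reflexivity. }
  clearbody z0. rewrite Ez. clear Ez z0.
  assert (Hoe : forall k l, (forall j, j < W -> gpos V (gapr (pwr k)) (pwr k) (sI b) j <= n - l -> oe k l <= cand k l j) /\
      (oe k l = V \/ exists j, j < W /\ gpos V (gapr (pwr k)) (pwr k) (sI b) j <= n - l /\ oe k l = cand k l j)).
  { intros k l. unfold oe, outer_end.
    match goal with |- context [loop W ?F V] =>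
      destruct (loop_min W F V (fun j => negb (n - l <? gpos V (gapr (pwr k)) (pwr k) (sI b) j)) (cand k l))
        as (_ & H2 & H3) end.
    { intros j z Hj. rewrite b2n_eqb0. reflexivity. }
    split.
    - intros j Hj Hg. apply H2; auto. apply Bool.negb_true_iff, Nat.ltb_ge; auto.
    - destruct H3 as [H3|(j & Hj & Cj & H3)]; [left; auto|right; exists j].
      apply Bool.negb_true_iff, Nat.ltb_ge in Cj. auto. }
  assert (Hin : forall k, (forall l, l <= n -> loop (n + 1) (fun l acc => Nat.min acc (oe k l)) V <= oe k l) /\
     (loop (n + 1) (fun l acc => Nat.min acc (oe k l)) V = V \/
      exists l, l <= n /\ loop (n + 1) (fun l acc => Nat.min acc (oe k l)) V = oe k l)).
  { intros k.
    destruct (loop_min (n + 1) (fun l acc => Nat.min acc (oe k l)) V (fun _ => true) (oe k)) as (_ & H2 & H3).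
    { reflexivity. }
    split; [intros l Hl; apply H2; auto; lia|].
    destruct H3 as [H3|(l & Hl & _ & H3)]; [left; auto|right; exists l; split; auto; lia]. }
  destruct (loop_min (rho 5) (fun k acc => Nat.min acc (loop (n + 1) (fun l acc => Nat.min acc (oe k l)) V)) V
     (fun _ => true) (fun k => loop (n + 1) (fun l acc => Nat.min acc (oe k l)) V)) as (_ & H2 & H3).
  { reflexivity. }
  set (z := loop (rho 5) _ V) in *.
  split; [lia|]. split.
  - intros k l j Hk Hl Hj Hg. specialize (H2 k Hk eq_refl).
    pose proof (proj1 (Hin k) l Hl). pose proof (proj1 (Hoe k l) j Hj Hg). lia.
  - destruct (Nat.min_dec k0 z) as [E|E]; rewrite E; [left; auto|right].
    destruct H3 as [H3|(k & Hk & _ & H3)]; [left; lia|].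
    destruct (Hin k) as [_ [H4|(l & Hl & H4)]]; [left; lia|].
    destruct (Hoe k l) as [_ [H5|(j & Hj & Hg & H5)]]; [left; lia|].
    right. exists k, l, j. repeat split; auto. lia.
Qed.

(** Let y[l,r) be at distance k from the block. The row of the children's windows is within dsum + k
    of it, so the right guess finds a cost of at most be * (dsum + k) for the same left end; adding
    dsum, with dsum <= alpha t * k, gives [alpha (S t)]. The right end may be rounded down without
    paying for the tail, since any window is welcome, so only 2b gaps are lost. *)
Lemma merge_summary : summary (S t) s (mergef rho y t s keys).
Proof.
  destruct V_large' as [V1 V2].
  destruct merge_min as (M1 & M2 & M3).
  set (z := mergef rho y t s keys) in *. 
  set (X := xblock s (b ^ S t)) in *. 
  assert (LX : length X <= n /\ length X <= b ^ S t) by apply xblock_length.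
  assert (EX : X = xblock s (b * M)) by reflexivity.
  destruct (dsum_spec b (le_n b)) as (D1 & D2 & D3). rewrite <- EX in *.
  destruct merge_grid_hyps as (G1 & G2 & G3 & G4 & G5).
  destruct (costf_spec rho y n b K T par t ltac:(lia)) as [Sd Cp].
  pose proof (key_le (length X) 0 0) as B0.
  assert (Hz : z < V) by nia.
  assert (Hd : kvalr z <= length X).
  { apply (kval_le _ 0 0); lia. }
  assert (HH : exists l r d, l <= r /\ r <= n /\ z = (d * (n + 1) + l) * (n + 1) + r /\ al d X (sub y l r)).
  { destruct M3 as [E|[E|(k & l & j & Hk & Hl & Hj & Hg & E)]].
    - rewrite E in Hz. apply key_exact in Hz as [E' _].
      exists 0, 0, (length X). repeat split; try lia.
      rewrite sub_empty by lia. apply al_sym, al_nil_l.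
    - lia.
    - rewrite E in Hz. unfold cand in *. pose proof (key_exact _ _ _ Hz) as [E' Ha].
      set (q := gpos V (gapr (pwr k)) (pwr k) (sI b) j) in *.
      unfold cellv in *. replace (Nat.min j (W - 1)) with j in * by lia.
      set (dp := grid _ _ _ _ _ _ _ _ _ _ _) in *.
      exists l, (l + q), (dsum b + dp j).
      assert (Ea : Nat.min V (dsum b + Nat.min V (dp j)) = dsum b + dp j) by lia.
      assert (Eq : Nat.min V (l + q) = l + q) by lia.
      rewrite Ea, Eq in E'.
      split; [lia|]. split; [lia|]. split; [rewrite E, Ea, Eq; exact E'|].
      apply al_trans with (xcat y lo hi b); auto.
      apply (grid_sound V W y (costr t) sI lo hi l (n - l) (pwr k) (gapr (pwr k)) b); auto; try lia.
      + intros i p q' Hi Hp Hq Hf. pose proof (G5 i Hi).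
        apply Sd; try lia. apply (sm_len _ _ _ (Hkeys i Hi)).
      + fold dp; lia. }
  destruct HH as (l & r & d & Hl & Hr & Ez & Ha).
  destruct (key_decode d l r z Ez ltac:(lia) Hr Hz) as (E1 & E2 & E3).
  split; fold X; rewrite ?E1, ?E2, ?E3; auto; try lia.
  - apply al_length in Ha as [Ha _]. rewrite sub_length in Ha by lia.
    (* The distance is at most the length of the block, so the window has at most 2b^(t+1) symbols,
       short enough for [costf] at the next level. *)
    assert (2 * b ^ S t <= (2 * b) ^ S t).
    { rewrite Nat.pow_mul_l. apply Nat.mul_le_mono_r. rewrite Nat.pow_succ_r'.
      pose proof (Nat.pow_nonzero 2 t). lia. }
    lia.
  - rewrite <- E1. intros l' r' k0 Hl' Hr' Hk0.
    (* Capping k at n keeps dsum + k within the 2n that the guesses reach. *)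
    assert (Hk : exists k, k <= k0 /\ k <= n /\ al k X (sub y l' r')).
    { exists (Nat.min k0 n). repeat split; try lia.
      destruct (Nat.min_dec k0 n) as [E|E]; rewrite E; auto.
      eapply al_le; [apply al_max|]. rewrite sub_length; lia. }
    destruct Hk as (k & Hkk & Hkn & Hk).
    apply Rle_trans with (alpha (S t) * INR k)%R.
    2: { apply Rmult_le_compat_l; [pose proof (alpha_pos (S t)); lra|apply le_INR; auto]. }
    clear k0 Hk0 Hkk. clear E1 E2 E3 Ez Ha Hl Hr d l r.
    rename l' into l, r' into r, Hl' into Hl, Hr' into Hr.
    specialize (D3 l r k Hl Hr Hk).
    set (k1 := dsum b + k).
    assert (A1 : al k1 (xcat y lo hi b) (sub y l r)) by (eapply al_trans; [apply al_sym; exact D2|exact Hk]).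
    destruct (guess_exists rho y n b K T par k1 ltac:(unfold k1; lia))
      as (i0 & Li0 & Hd1 & Hd2).
    destruct (gap_spec rho y n b K T par (pwr i0)) as (Hg1 & Hg2 & Hg3).
    set (dl := pwr i0) in *. set (g := gapr dl) in *.
    destruct (grid_complete V W y (costr t) sI lo hi l (n - l) dl g b G1 ltac:(lia) G2 G3 G4 G5
        ((K + 6) ^ S t) (K ^ S t)) with (i := b) (pt := r - l) (k := k1)
      as (j & Lj & Gj & Bj); auto; try lia.
    { apply Nat.pow_le_mono_l; lia. }
    { intros i p q k2 Hi Hp Hq Hal. pose proof (G5 i Hi).
      apply Cp; auto; try lia. apply (sm_len _ _ _ (Hkeys i Hi)). }
    { replace (l + (r - l)) with r by lia. auto. }
    set (dp := grid _ _ _ _ _ _ _ _ _ _ _) in *.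
    set (q := g * ((r - l) / g)) in *.
    assert (Lq : q <= r - l) by (apply Nat.Div0.mul_div_le).
    specialize (M2 i0 l j Li0 ltac:(lia) Lj). fold dl in M2. fold g in M2. rewrite Gj in M2.
    specialize (M2 ltac:(lia)).
    assert (Hval : kvalr z <= dsum b + dp j).
    { apply (kval_le _ l (l + q)); try lia. eapply Nat.le_trans; [exact M2|].
      unfold cand. fold dl. fold g. fold dp. rewrite Gj. eapply Nat.le_trans; [apply key_le|].
      unfold cellv. replace (Nat.min j (W - 1)) with j by lia.
      apply Nat.add_le_mono; [|lia]. apply Nat.mul_le_mono_r. apply Nat.add_le_mono_r.
      apply Nat.mul_le_mono_r. lia. }
    assert (Hdp : (INR (dp j) <= be * INR k1)%R).
    { specialize (Hg3 k1 (2 * b) ltac:(lia) Hd2).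
      assert (N : K ^ S (S t) * dp j <= (K + 6) ^ S (S t) * k1).
      { rewrite (Nat.pow_succ_r' K (S t)), (Nat.pow_succ_r' (K + 6) (S t)).
        set (Q := K ^ S t) in *. set (P := (K + 6) ^ S t) in *.
        replace (K * Q * dp j) with (K * (Q * dp j)) by lia.
        eapply Nat.le_trans; [apply Nat.mul_le_mono_l; exact Bj|].
        replace (K * (P * (k1 + 2 * b * (g - 1)))) with (P * (K * (k1 + 2 * b * (g - 1)))) by lia.
        replace ((K + 6) * P * k1) with (P * ((K + 6) * k1)) by lia.
        apply Nat.mul_le_mono_l. exact Hg3. }
      apply le_INR in N. rewrite !mult_INR in N.
      specialize (Hbe t ltac:(lia)).
      assert (0 < INR (K ^ S (S t)))%R by (apply lt_0_INR; apply Nat.neq_0_lt_0, Nat.pow_nonzero; lia).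
      apply Rmult_le_reg_l with (INR (K ^ S (S t))); auto.
      eapply Rle_trans; [exact N|].
      replace (INR (K ^ S (S t)) * (be * INR k1))%R with (be * INR (K ^ S (S t)) * INR k1)%R by ring.
      apply Rmult_le_compat_r; [apply pos_INR|auto]. }
    apply le_INR in Hval. rewrite plus_INR in Hval. unfold k1 in Hdp. rewrite plus_INR in Hdp.
    cbn [alpha]. pose proof (pos_INR k). pose proof (alpha_pos t).
    assert (be * INR (dsum b) <= be * (alpha t * INR k))%R by (apply Rmult_le_compat_l; auto).
    nra.
Qed.

End Step.
End Merge.

(** * The pass through x *)

Definition startE (t : nat) : expr := Op Oadd (Var 1) (Op Omul (Var 0) (powE 4 t)).

Definition storec (D NA slot idx a : nat) : code :=
  block [IConst s1 NA; IMul s1 s1 idx; IConst s2 (AB D + slot); IAdd s1 s1 s2; IStore s1 a].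

(* [stream t] reads the (register 4)^t symbols of x whose start index is in register [sreg],
   and leaves a summary key of that block on top of the stack. *)
Fixpoint stream (D NA t sreg d q : nat) : code :=
  match t with
  | 0 => cseq (block [IReadX (rg d)])
           (cseq (comp D NA leafE [rg d; sreg] [] (S d) q) (block (mov (rg d) (rg (S d)))))
  | S t =>
    cseq (block [IConst (rg d) 0])
      (cseq (loopc s1 (rg d) 4
         (cseq (comp D NA (startE t) [rg d; sreg] [] (S d) (S q))
           (cseq (stream D NA t (rg (S d)) (S (S d)) (S q))
                 (storec D NA q (rg d) (rg (S (S d)))))))
         (comp D NA (mergeE t) [sreg] [q] d (S q)))
  end.

Fixpoint stream_d (t : nat) : nat :=
  match t with
  | 0 => 1 + dneed leafE
  | S t => Nat.max (1 + dneed (startE t)) (Nat.max (2 + stream_d t) (dneed (mergeE t)))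
  end.

Fixpoint stream_a (t : nat) : nat :=
  match t with
  | 0 => aneed leafE
  | S t => S (Nat.max (stream_a t) (aneed (mergeE t)))
  end.

Fixpoint stream_cost (W : nat) (rho : nat -> nat) (t : nat) : nat :=
  match t with
  | 0 => 1 + (cost W rho leafE + 2)
  | S t => 1 + ((rho 4 * (cost W rho (startE t) + (stream_cost W rho t + 5) + 5) + 2) + cost W rho (mergeE t))
  end.

Lemma stream_d_pos t : 1 <= stream_d t.
Proof. destruct t; cbn [stream_d]; lia. Qed.

Lemma aneed_powE i t : aneed (powE i t) = 0.
Proof. induction t; simpl; lia. Qed.

Lemma maxc_powE i t : maxc (powE i t) <= 1.
Proof. induction t; simpl; lia. Qed.

Lemma scope_powE i t nv na : i < NP -> scope nv na (powE i t).
Proof. induction t; simpl; auto. Qed.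

Lemma maxc_costE t : maxc (costE t) <= 1.
Proof.
  induction t as [|t IH]; [simpl; lia|]. cbn [costE maxc pow2E gapE gridE].
  repeat apply Nat.max_lub; try apply maxc_powE; try assumption; lia.
Qed.

Lemma maxc_mergeE t : maxc (mergeE t) <= 1.
Proof.
  unfold mergeE. cbn [maxc pow2E gapE gridE lenE keyE valE loE hiE modE].
  repeat apply Nat.max_lub; try apply maxc_powE; try apply maxc_costE; lia.
Qed.

Lemma scope_costE t nv na : 4 <= nv -> scope nv na (costE t).
Proof.
  revert nv na; induction t as [|t IH]; intros nv na H.
  - simpl. unfold NP. repeat split; lia.
  - cbn [costE scope pow2E gapE gridE]. unfold NP.
    repeat split; try lia; try (apply scope_powE; unfold NP; lia); try (apply IH; lia); unfold NP; lia.
Qed.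

Lemma scope_mergeE t : scope 1 1 (mergeE t).
Proof.
  unfold mergeE. cbn [scope pow2E gapE gridE lenE keyE valE loE hiE modE]. unfold NP.
  repeat split; try lia; try (apply scope_powE; unfold NP; lia);
    try (apply scope_costE; lia); simpl; unfold NP; lia.
Qed.

Section Stream.
Variables (rho : nat -> nat) (p : list instr) (x y : list nat) (n b K T D NA S0 Z : nat) (be : R).
Notation V := (rho 1).
Notation W := (rho 2).
Hypothesis lay : layout V W rho y D NA S0 Z.
Hypothesis par : params rho y n b K T.
Hypothesis (Hx : length x = n)
  (Hbe : forall t, t < T -> (INR ((K + 6) ^ S (S t)) <= be * INR (K ^ S (S t)))%R)
  (Hbe1 : (0 <= be)%R) (HxV : forall i, nth i x 0 <= V).
Notation wp := (wp p x y S0 Z).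
Notation rep := (rep V W rho D NA).
Notation eqon := (eqon W D NA).
Notation cellr := (cell D NA).

Lemma storec_ok slot idx a g pos v j : slot < NA -> j < W -> idx <> s1 -> idx <> s2 -> a <> s1 -> a <> s2 ->
  g idx = j -> g a = v ->
  wp (storec D NA slot idx a) 5 (fun g' p' => p' = pos /\ g' (cellr slot j) = v /\
    forall i, i <> s1 -> i <> s2 -> i <> cellr slot j -> g' i = g i) g pos.
Proof.
  intros Hs Hj I1 I2 A1 A2 Ei Ev. apply wp_bounded; intros B.
  pose proof (lay_V2 _ _ _ _ _ _ _ _ lay). pose proof (lay_SV _ _ _ _ _ _ _ _ lay).
  pose proof (lay_VZ _ _ _ _ _ _ _ _ lay) as VZ. pose proof (lay_S _ _ _ _ _ _ _ _ lay).
  assert (VZ' : V <= Z) by nia.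
  assert (Lc : cellr slot j < S0) by (eapply cell_lt; eauto).
  assert (Ls : s1 < S0 /\ s2 < S0) by (eapply s12_lt; eauto). destruct Ls as [Ls1 Ls2].
  assert (M2 : NA * j <= Z) by (unfold cell in Lc; lia).
  assert (M1 : NA <= Z) by (pose proof (Nat.mul_le_mono_r 1 W NA (lay_W _ _ _ _ _ _ _ _ lay)); lia).
  assert (M3 : AB D + slot <= Z) by (unfold cell in Lc; lia).
  refine (wp_block p x y S0 Z [_;_;_;_;_] _ g pos _). cbn [wpb eff].
  split; [auto|]; split; [lia|]; intros g4 E4 O4.
  assert (E4' : g4 s1 * g4 idx = NA * j) by (rewrite E4, O4, Ei by auto; lia).
  split; [auto|]; split; [lia|]; intros g5 E5 O5. rewrite E4' in E5.
  split; [auto|]; split; [lia|]; intros g6 E6 O6.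
  assert (E6' : g6 s1 + g6 s2 = cellr slot j)
    by (rewrite E6, O6, E5 by (unfold s1, s2; lia); unfold cell; lia).
  split; [auto|]; split; [lia|]; intros g7 E7 O7. rewrite E6' in E7.
  assert (E7' : g7 a = v) by (rewrite O7, O6, O5, O4; auto).
  split; [rewrite E7; auto|]; split; [rewrite E7', <- Ev; auto|]; intros g8 E8 O8.
  rewrite E7', E7 in *. split; [auto|]. split; [auto|].
  intros i J1 J2 J3. rewrite O8, O7, O6, O5, O4; auto.
Qed.

(** The loop invariant ties the reading position to the counter, so the start index handed to a
    child is the position of its first symbol. Children run above depth d and array q, so the keys
    collected in array q survive them. *)
Lemma stream_ok t : forall sreg d q s g,
  t <= T -> d + stream_d t <= D -> q + stream_a t <= NA -> s + b ^ t <= V ->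
  rep g [sreg] [] [s] [] d q ->
  wp (stream D NA t sreg d q) (stream_cost W rho t)
    (fun g' p' => p' = s + b ^ t /\ eqon d q g g' /\
       exists v, g' (rg d) = v /\ v <= V /\ summary rho x y n b be t s v) g s.
Proof.
  pose proof (lay_VZ _ _ _ _ _ _ _ _ lay) as HVZ. pose proof (lay_V2 _ _ _ _ _ _ _ _ lay) as HV2.
  pose proof (keep_scratch V W rho y D NA S0 Z lay) as KS.
  pose proof (keep_has_rg V W rho y D NA S0 Z lay) as KR.
  pose proof (keep_le V W rho y D NA S0 Z lay) as KL.
  assert (VZ : V <= Z) by nia.
  assert (Nrg : forall d, rg d <> s1 /\ rg d <> s2) by (unfold rg, SB, s1, s2; lia).
  assert (Ls : s1 < S0 /\ s2 < S0) by (eapply s12_lt; eauto). destruct Ls as [Ls1 Ls2].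
  assert (Hn0 := par_n _ _ _ _ _ _ par). assert (Hb0 := par_b _ _ _ _ _ _ par).
  assert (LbW : b < W) by (rewrite (par_W _ _ _ _ _ _ par); pose proof (par_K _ _ _ _ _ _ par); nia).
  assert (LWV : W <= V) by (eapply W_le_V; eauto).
  induction t as [|t IH]; intros sreg d q s g HT Hd Hq Hs R; cbn [stream stream_cost stream_d stream_a] in *.
  - assert (Ld : 1 <= dneed leafE) by apply dneed_pos.
    assert (Lr : rg d < S0) by (eapply rg_lt; eauto; lia).
    apply wp_seq. refine (wp_block p x y S0 Z [_] _ g s _). cbn [wpb eff].
    split; [auto|]; split; [pose proof (HxV s); lia|]; intros g1 E1 O1.
    assert (R1 : rep g1 [rg d; sreg] [] [nth s x 0; s] [] (S d) q).
    { eapply (rep_push V W rho y D NA S0 Z lay); eauto.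
      eapply (rep_weaken V W rho y D NA S0 Z lay); [exact R| |lia|lia].
      eapply eqon_upd; eauto. eapply keep_rg; eauto; lia. }
    apply wp_seq. eapply wp_mono.
    { eapply comp_ok; eauto; try lia.
      - simpl. lia.
      - simpl. unfold NP. repeat split; lia. }
    { reflexivity. }
    intros g2 p2 (-> & K2 & E2 & L2). rewrite ev_leafE in E2, L2.
    eapply wp_mono; [eapply mov_ok; eauto; apply Nrg|reflexivity|].
    intros g3 p3 (-> & E3 & O3). simpl Nat.pow. split; [lia|]. split.
    + intros i Ki. rewrite O3; [rewrite K2; [apply O1|]| |].
      * intros ->. eapply keep_rg; [exact lay| | |exact Ki]; lia.
      * eapply KL; eauto.
      * intros ->. eapply keep_rg; [exact lay| | |exact Ki]; lia.
      * intros ->. first [exact (proj1 (KS d q) Ki)|exact (proj2 (KS d q) Ki)].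
    + exists (leaff rho y (nth s x 0) s). rewrite E3. split; [auto|]. split; [auto|].
      eapply leaf_summary; eauto.
  - pose proof (dneed_pos (startE t)). pose proof (stream_d_pos t).
    assert (Lr : rg d < S0) by (eapply rg_lt; eauto; lia).
    pose proof (par_Vb _ _ _ _ _ _ par) as HVb.
    assert (Epow : pows rho 4 t = b ^ t).
    { eapply pows_exact; eauto using par_4. intros t' Ht'.
      eapply Nat.le_trans; [|apply (HVb t'); lia]. apply Nat.pow_le_mono_l; lia. }
    assert (Hs' : forall j, j < b -> s + j * b ^ t + b ^ t <= V).
    { intros j Hj. rewrite Nat.pow_succ_r' in Hs.
      pose proof (Nat.mul_le_mono_r (S j) b (b ^ t) Hj). lia. }
    assert (Rv := rep_var _ _ _ _ _ _ _ _ _ _ _ _ R 0 ltac:(simpl; lia)). simpl in Rv.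
    assert (Nc : forall i, (i = s1 \/ i = s2 \/ exists d', d' < D /\ i = rg d') -> forall a j, i <> cellr a j).
    { intros i Hi a j ->. unfold s1, s2, rg, cell, AB, SB in Hi.
      destruct Hi as [|[|(d' & ? & ?)]]; lia. }
    apply wp_seq. refine (wp_block p x y S0 Z [_] _ g s _). cbn [wpb eff].
    split; [auto|]; split; [lia|]; intros g1 E1 O1.
    rewrite (par_4 _ _ _ _ _ _ par).
    apply wp_seq. apply wp_loop with (n := b) (I := fun j g2 p2 =>
      p2 = s + j * b ^ t /\ g2 (rg d) = j /\ eqon d q g g2 /\
      forall j', j' < j -> summary rho x y n b be t (s + j' * b ^ t) (g2 (cellr q j'))); auto; try lia.
    + apply not_eq_sym, Nrg.
    + split; [lia|]. split; [auto|]. split; [|lia].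
      eapply eqon_upd; eauto. eapply keep_rg; eauto; lia.
    + intros k g2 p2 (-> & A2 & K2 & F2). split; auto.
      rewrite K2 by (eapply keep_has_par; unfold NP; lia).
      rewrite (rep_par _ _ _ _ _ _ _ _ _ _ _ _ R) by (unfold NP; lia). apply (par_4 _ _ _ _ _ _ par).
    + intros k g2 p2 g3 Lk (-> & A2 & K2 & F2) O3.
      assert (K3 : eqon d q g g3).
      { eapply eqon_trans; [exact K2|]. eapply eqon_upd; [exact O3|]. apply KS. }
      assert (A3 : g3 (rg d) = k) by (rewrite O3; auto; apply Nrg).
      assert (R3 : rep g3 [rg d; sreg] [] [k; s] [] (S d) (S q)).
      { eapply (rep_push V W rho y D NA S0 Z lay); auto; [|lia].
        eapply (rep_weaken V W rho y D NA S0 Z lay); [exact R|exact K3|lia|lia]. }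
      apply wp_seq. eapply wp_mono.
      { eapply (comp_ok V W rho y D NA p x S0 Z lay (startE t) [rg d; sreg] [] (S d) (S q)); eauto; try lia.
        - unfold startE. cbn [aneed]. rewrite aneed_powE. lia.
        - unfold startE. cbn [maxc]. pose proof (maxc_powE 4 t). lia.
        - unfold startE. cbn [scope length]. repeat split; try lia. apply scope_powE. unfold NP; lia. }
      { reflexivity. }
      intros g4 p4 (-> & K4 & E4 & L4).
      assert (Ev4 : ev V W rho y (startE t) [k; s] [] = s + k * b ^ t).
      { unfold startE. cbn [ev nth opf]. rewrite ev_powE, Epow. specialize (Hs' k Lk). lia. }
      rewrite Ev4 in E4, L4.
      assert (R4 : rep g4 [rg (S d)] [] [s + k * b ^ t] [] (S (S d)) (S q)).
      { eapply (rep_push V W rho y D NA S0 Z lay); auto.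
        split; simpl; auto; try lia.
        intros i Hi. rewrite K4 by (eapply keep_has_par; auto).
        apply (rep_par _ _ _ _ _ _ _ _ _ _ _ _ R3); auto. }
      apply wp_seq. eapply wp_mono; [apply (IH (rg (S d)) (S (S d)) (S q)); eauto; try lia|reflexivity|].
      intros g5 p5 (-> & K5 & v & E5 & L5 & Sm).
      eapply wp_mono; [apply (storec_ok q (rg d) (rg (S (S d))) g5 _ v k); auto; try apply Nrg; try lia|reflexivity|].
      { rewrite K5, K4, A3; auto; apply KR; lia. }
      intros g6 p6 (-> & E6 & O6).
      assert (A6 : g6 (rg d) = k).
      { rewrite O6, K5, K4; auto; try apply Nrg; try (apply KR; lia).
        apply Nc. right; right; exists d; split; auto; lia. }
      split; [auto|]. intros g7 E7 O7. split; [lia|]. split; [auto|]. split.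
      * intros i Ki.
        assert (N1 : i <> rg d).
        { intros ->. eapply keep_rg; [exact lay| | |exact Ki]; lia. }
        assert (N2 : i <> s1) by (intros ->; first [exact (proj1 (KS d q) Ki)|exact (proj2 (KS d q) Ki)]).
        assert (N3 : i <> s2) by (intros ->; first [exact (proj1 (KS d q) Ki)|exact (proj2 (KS d q) Ki)]).
        assert (N4 : i <> cellr q k).
        { intros ->. eapply (keep_cell V W rho y D NA S0 Z lay d q q k); eauto; lia. }
        rewrite O7, O6, K5, K4, K3; auto; eapply KL; eauto.
      * intros j' Hj'.
        rewrite O7 by (apply not_eq_sym; apply Nc; eauto; right; right; exists d; split; auto; lia).
        destruct (Nat.eq_dec j' k) as [->|Ne]; [rewrite E6; auto|].
        assert (Kc : keep W D NA (S d) (S q) (cellr q j')) by (apply keep_has_cell; lia).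
        rewrite O6.
        -- rewrite K5, K4, O3; auto.
           ++ apply F2; lia.
           ++ apply not_eq_sym; apply Nc; auto.
           ++ eapply KL; eauto.
        -- apply not_eq_sym; apply Nc; auto.
        -- apply not_eq_sym; apply Nc; auto.
        -- intros E. apply (cell_inj V W rho y D NA S0 Z lay) in E; lia.
    + intros g2 p2 g3 (-> & A2 & K2 & F2) O3.
      assert (K3 : eqon d q g g3).
      { eapply eqon_trans; [exact K2|]. eapply eqon_upd; [exact O3|]. apply KS. }
      assert (R3 : rep g3 [sreg] [q] [s] [fun j => g3 (cellr q j)] d (S q)).
      { eapply (rep_apush V W rho y D NA S0 Z lay); auto.
        eapply (rep_weaken V W rho y D NA S0 Z lay); [exact R|exact K3|lia|lia]. }
      eapply wp_mono.
      { eapply (comp_ok V W rho y D NA p x S0 Z lay (mergeE t) [sreg] [q] d (S q)); eauto; try lia.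
        - pose proof (maxc_mergeE t). lia.
        - apply scope_mergeE. }
      { reflexivity. }
      intros g4 p4 (-> & K4 & E4 & L4). rewrite ev_mergeE in E4, L4.
      split; [rewrite Nat.pow_succ_r'; lia|]. split.
      * eapply eqon_trans; [exact K3|]. eapply eqon_le; eauto.
      * eexists. split; [exact E4|]. split; [exact L4|].
        eapply merge_summary; eauto. intros j Hj. rewrite O3; [apply F2; auto|].
        apply not_eq_sym; apply Nc; auto.
Qed.

End Stream.

(** * Computing the parameters, and the whole algorithm *)

Fixpoint powX (e : expr) (t : nat) : expr :=
  match t with 0 => Cst 1 | S t => Op Omul (powX e t) e end.

(** The least b with b^T >= n equals the number of k with k^T < n. *)
Definition rootE (T : nat) : expr :=
  Fold 6 (Cst 0) (If (Op Olt (powX (Var 1) T) (Par 0)) (Op Oadd (Var 0) (Cst 1)) (Var 0)).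

(** There are log2 n + 1 exponents k with 2^k <= n, and the count starts at 2. *)
Definition logE : expr :=
  Fold 6 (Cst 2)
    (If (Op Olt (Par 0) (Fold 6 (Cst 1) (If (Op Olt (Var 1) (Var 3)) (Op Oadd (Var 0) (Var 0)) (Var 0))))
        (Var 0) (Op Oadd (Var 0) (Cst 1))).

(** This is W - 1, for register 3; register 2 is set from it at the very end. *)
Definition widthE : expr := Op Oadd (Op Omul (Op Omul (Cst 8) (Par 7)) (Par 4)) (Cst 3).

(** The same compiler computes the parameters, under a provisional width 1 (registers 2 and 3 hold 1
    and 0), since the true width depends on b. *)
Definition stage (D NA : nat) (e : expr) (r : nat) : code :=
  cseq (comp D NA e [] [] 0 0) (block (mov r (rg 0))).

Definition prelude (D NA C K T : nat) : code :=
  cseq (block ([IConst 6 1; IAdd 6 6 0; IConst 1 1] ++ repeat (IMul 1 1 6) C))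
   (cseq (block [IConst 2 1; IConst 3 0; IConst 7 K])
    (cseq (stage D NA (rootE T) 4)
     (cseq (stage D NA logE 5)
      (cseq (stage D NA (Op Oadd (Par 4) (Par 4)) 8)
       (cseq (stage D NA widthE 3)
        (block [IConst 2 1; IAdd 2 2 3])))))).

Definition answerE : expr := Op Omul (Cst 2) (valE (Var 0)).

Definition algo (D NA C K T : nat) : code :=
  cseq (prelude D NA C K T)
    (cseq (block [IConst (rg 0) 0])
      (cseq (stream D NA T (rg 0) 1 0) (comp D NA answerE [rg 1] [] 2 0))).

Definition need_d (T : nat) : nat :=
  Nat.max (1 + stream_d T) (Nat.max (2 + dneed answerE)
    (Nat.max (dneed (rootE T)) (Nat.max (dneed logE) (dneed widthE)))).

(** Only register 6, which holds n + 1, bounds loops at this stage. *)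
Definition stage_cost (n : nat) (e : expr) : nat := cost 1 (fun _ => n + 1) e + 2.

Definition prelude_cost (n C T : nat) : nat :=
  (3 + C) + (3 + (stage_cost n (rootE T) + (stage_cost n logE + (9 + (stage_cost n widthE + 2))))).

(** P is closed downwards, so the indices counted form an initial segment and the count is the first
    index that fails, unless all succeed. *)
Lemma loop_count V P c0 m :
  (forall k k', k <= k' -> P k' = true -> P k = true) -> c0 + m <= V ->
  exists c, loop m (fun k (acc : nat) => if P k then Nat.min V (acc + 1) else acc) c0 = c0 + c /\
    c <= m /\ (forall k, k < c -> P k = true) /\ (c = m \/ P c = false).
Proof.
  intros HP. induction m as [|m IH]; intros Hm; cbn [loop].
  - exists 0. repeat split; auto; lia.
  - destruct IH as (c & -> & Hc & H1 & H2); [lia|].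
    destruct (P m) eqn:E.
    + exists (S m). assert (c = m).
      { destruct H2 as [H2|H2]; auto. rewrite (HP c m) in H2; auto; discriminate. }
      subst c. repeat split; try lia. intros k Hk. apply HP with m; auto; lia.
    + exists c. repeat split; auto. destruct H2 as [->|H2]; auto.
Qed.

Lemma ev_powX V W rho y t e env arrs :
  ev V W rho y (powX e t) env arrs = Nat.min V (ev V W rho y e env arrs ^ t) \/
  ev V W rho y (powX e t) env arrs = 1 /\ t = 0.
Proof.
  induction t as [|t IH]; [right; auto|left].
  cbn [powX ev opf]. set (a := ev V W rho y e env arrs) in *. rewrite Nat.pow_succ_r'.
  destruct IH as [->|[-> ->]]; [|f_equal; simpl; lia].
  destruct (le_lt_dec V (a ^ t)) as [H|H].
  - rewrite (Nat.min_l V (a ^ t)) by auto. destruct a as [|a]; [f_equal; lia|].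
    rewrite !Nat.min_l by nia. reflexivity.
  - rewrite (Nat.min_r V (a ^ t)) by lia. f_equal. lia.
Qed.

Lemma cost_powX W rho rho' i t : cost W rho (powX (Var i) t) = cost W rho' (powX (Var i) t).
Proof. induction t as [|t IH]; cbn [powX cost]; auto. Qed.

Lemma aneed_powX i t : aneed (powX (Var i) t) = 0.
Proof. induction t; simpl; lia. Qed.

Lemma maxc_powX i t : maxc (powX (Var i) t) <= 1.
Proof. induction t; simpl; lia. Qed.

Lemma scope_powX i t nv na : i < nv -> scope nv na (powX (Var i) t).
Proof. induction t; simpl; auto. Qed.

Section Algo.
Variables (p : list instr) (x y : list nat) (n b C K T D NA S0 : nat) (be : R).
Let V := (n + 1) ^ C.
Let Z := V * V.
Hypothesis (Hx : length x = n) (Hn : length y = n) (Hn0 : 1 <= n) (HK0 : 1 <= K) (HT : 1 <= T)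
  (Hbl : forall k, k < b -> k ^ T < n) (Hbu : n <= b ^ T)
  (HD : need_d T <= D) (HNA : 1 <= NA) (HNA' : stream_a T <= NA)
  (HS : SB + D + (8 * K * b + 4) * NA <= S0) (HSV : S0 <= V) (HK : K <= V)
  (HxV : forall i, nth i x 0 <= V) (HyV : forall i, nth i y 0 <= V)
  (HVn : (n + 1) * ((n + 1) * (n + 1)) + 4 * n + 4 < V)
  (HVb : forall t, t <= T -> (2 * b) ^ t <= V)
  (Hbe : forall t, t < T -> (INR ((K + 6) ^ S (S t)) <= be * INR (K ^ S (S t)))%R)
  (Hbe1 : (0 <= be)%R).
Notation wp := (wp p x y S0 Z).

Lemma b_pos : 1 <= b.
Proof. destruct b; [|lia]. rewrite Nat.pow_0_l in Hbu; lia. Qed.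

Lemma V_bounds : 8 <= V /\ 4 * n + 4 < V /\ V <= Z /\ V + V <= Z.
Proof.
  pose proof (Nat.le_0_l ((n + 1) * ((n + 1) * (n + 1)))).
  assert (8 <= V) by lia. unfold Z. repeat split; try lia; nia.
Qed.

Lemma stage_layout rho : rho 1 = V -> rho 2 = 1 -> rho 3 = 0 -> (forall i, i < NP -> rho i <= V) ->
  layout V 1 rho y D NA S0 Z.
Proof.
  intros R1 R2 R3 RV. pose proof V_bounds. pose proof b_pos.
  assert (1 <= D) by (unfold need_d in HD; lia).
  split; auto; try (unfold Z; lia).
Qed.

Lemma stage_ok e r g pos v N :
  dneed e <= D -> aneed e = 0 -> maxc e <= V -> scope 0 0 e -> r < NP ->
  g 1 = V -> g 2 = 1 -> g 3 = 0 -> (forall i, i < NP -> g i <= V) ->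
  ev V 1 g y e [] [] = v -> cost 1 g e <= N ->
  wp (stage D NA e r) (N + 2) (fun g' p' => p' = pos /\ g' r = v /\ v <= V /\
    forall i, i < NP -> i <> r -> g' i = g i) g pos.
Proof.
  intros Hd Ha Hc Hs Hr G1 G2 G3 GV Ev Hcost.
  pose proof (stage_layout g G1 G2 G3 GV) as lay.
  unfold stage. apply wp_seq. eapply wp_mono.
  { apply (comp_ok V 1 g y D NA p x S0 Z lay e [] [] 0 0 [] [] g pos); simpl; auto; try lia.
    split; simpl; auto; lia. }
  { exact Hcost. }
  intros g1 p1 (-> & K1 & E1 & L1). rewrite Ev in *.
  eapply wp_mono; [apply (mov_ok V 1 g y D NA p x S0 Z lay)|reflexivity|].
  - unfold NP, SB in *. lia.
  - unfold NP, s1 in *; lia.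
  - unfold rg, SB, s1; lia.
  - intros g2 p2 (-> & E2 & O2). rewrite E2. repeat split; auto.
    intros i Hi Hir. rewrite O2; auto.
    + apply K1. left; auto.
    + unfold NP, s1 in *; lia.
Qed.

Lemma rootE_value rho : rho 0 = n -> rho 6 = n + 1 -> ev V 1 rho y (rootE T) [] [] = b.
Proof.
  intros R0 R6. pose proof V_bounds as (_ & V1 & _).
  unfold rootE. cbn [ev]. rewrite R6.
  destruct (loop_count V (fun k => k ^ T <? n) 0 (n + 1)) as (c & Ec & Lc & H1 & H2).
  { intros k k' L H. apply Nat.ltb_lt in H. apply Nat.ltb_lt.
    pose proof (Nat.pow_le_mono_l k k' T L). lia. }
  { lia. }
  rewrite (loop_ext (n + 1) _ (fun k acc => if k ^ T <? n then Nat.min V (acc + 1) else acc)).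
  - rewrite Ec. simpl.
    assert (Hc : n <= c ^ T).
    { destruct H2 as [->|H2]; [|apply Nat.ltb_ge; auto].
      apply Nat.le_trans with ((n + 1) ^ 1); [simpl; lia|]. apply Nat.pow_le_mono_r; lia. }
    destruct (lt_eq_lt_dec b c) as [[L|E]|L]; auto; exfalso.
    + specialize (H1 b L). apply Nat.ltb_lt in H1. lia.
    + specialize (Hbl c L). lia.
  - intros k z Hk. cbn [ev nth opf]. rewrite R0.
    destruct (ev_powX V 1 rho y T (Var 1) [z; k] []) as [E|[_ E]]; [|lia].
    rewrite E. cbn [ev nth]. rewrite b2n_eqb0.
    (* V exceeds n, so the saturated power compares with n as the true one does. *)
    destruct (Nat.ltb_spec (Nat.min V (k ^ T)) n), (Nat.ltb_spec (k ^ T) n); cbn [negb]; auto; lia.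
Qed.

Lemma logE_value rho : rho 0 = n -> rho 6 = n + 1 -> ev V 1 rho y logE [] [] = Nat.log2 n + 3.
Proof.
  intros R0 R6. pose proof V_bounds as (_ & V1 & _).
  unfold logE. cbn [ev]. rewrite R6.
  destruct (loop_count V (fun k => 2 ^ k <=? n) 2 (n + 1)) as (c & Ec & Lc & H1 & H2).
  { intros k k' L H. apply Nat.leb_le in H. apply Nat.leb_le.
    pose proof (Nat.pow_le_mono_r 2 k k' ltac:(lia) L). lia. }
  { lia. }
  rewrite (loop_ext (n + 1) _ (fun k acc => if 2 ^ k <=? n then Nat.min V (acc + 1) else acc)).
  - rewrite Ec.
    assert (Hc : n < 2 ^ c).
    { destruct H2 as [->|H2]; [|apply Nat.leb_gt; auto].
      apply Nat.lt_trans with (n + 1); [lia|]. apply Nat.pow_gt_lin_r; lia. }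
    destruct c as [|c]; [simpl in Hc; lia|].
    specialize (H1 c (le_n _)). apply Nat.leb_le in H1.
    rewrite (Nat.log2_unique n c); lia.
  - intros k z Hk. cbn [ev nth opf]. rewrite R0.
    assert (E : forall m, loop m (fun k0 acc => if b2n (k0 <? k) =? 0 then acc else Nat.min V (acc + acc)) 1
       = Nat.min V (2 ^ Nat.min m k)).
    { induction m as [|m IH]; cbn [loop]; [simpl; lia|]. rewrite IH, b2n_eqb0.
      destruct (Nat.ltb_spec m k); cbn [negb].
      - replace (Nat.min m k) with m by lia. replace (Nat.min (S m) k) with (S m) by lia.
        rewrite Nat.pow_succ_r'. lia.
      - do 2 f_equal. lia. }
    rewrite E. replace (Nat.min (n + 1) k) with k by lia. rewrite b2n_eqb0.
    destruct (Nat.ltb_spec n (Nat.min V (2 ^ k))), (Nat.leb_spec (2 ^ k) n); cbn [negb]; auto; lia.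
Qed.

Lemma V_powers g pos m v : v = (n + 1) ^ m -> forall c, m + c = C -> g 1 = v -> g 6 = n + 1 ->
  wpb x y S0 Z (repeat (IMul 1 1 6) c)
    (fun g' p' => p' = pos /\ g' 1 = V /\ forall i, i <> 1 -> g' i = g i) g pos.
Proof.
  intros Hv c; revert g m v Hv. induction c as [|c IH]; intros g m v Hv Hc G1 G6; cbn [repeat wpb eff].
  - repeat split; auto. rewrite G1, Hv. unfold V. f_equal. lia.
  - pose proof V_bounds as (V0 & V1 & V2 & _).
    split; [unfold SB in HS; lia|]. split.
    + rewrite G1, G6, Hv. apply Nat.le_trans with V; auto. unfold V.
      replace ((n + 1) ^ m * (n + 1)) with ((n + 1) ^ S m) by (simpl; lia).
      apply Nat.pow_le_mono_r; lia.
    + intros g1 E1 O1. 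
      assert (W : wpb x y S0 Z (repeat (IMul 1 1 6) c)
         (fun g' p' => p' = pos /\ g' 1 = V /\ forall i, i <> 1 -> g' i = g1 i) g1 pos).
      { apply (IH g1 (S m) ((n + 1) ^ S m)); auto; try lia.
        - rewrite E1, G1, G6, Hv. simpl. lia.
        - rewrite O1; auto. }
      assert (M : forall l Q Q' g pos, (forall g' p', Q g' p' -> Q' g' p') -> wpb x y S0 Z l Q g pos -> wpb x y S0 Z l Q' g pos).
      { clear. induction l as [|i l IH]; cbn [wpb]; auto. intros Q Q' g pos H.
        destruct (eff y x i g pos) as [[[r v] p']|]; auto. intros (A & B & H'). repeat split; auto.
        intros g' E O. eapply IH; eauto. }
      eapply M; [|exact W]. intros g' p' (-> & A & B). repeat split; auto.
      intros i Hi. rewrite B, O1; auto.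
Qed.

Lemma prelude_ok g pos : g 0 = n -> (forall i, g i <= V) ->
  wp (prelude D NA C K T) (prelude_cost n C T) (fun g' p' => p' = pos /\
    g' 1 = V /\ g' 3 = g' 2 - 1 /\ (forall i, i < NP -> g' i <= V) /\ params g' y n b K T) g pos.
Proof.
  intros G0 GV. pose proof V_bounds as (V0 & V1 & V2 & V3). pose proof b_pos.
  assert (L2 : SB <= S0) by lia. unfold need_d in HD. unfold SB in L2.
  unfold prelude, prelude_cost.
  apply wp_seq.
  replace (3 + C) with (length ([IConst 6 1; IAdd 6 6 0; IConst 1 1] ++ repeat (IMul 1 1 6) C))
    by (rewrite length_app, repeat_length; auto).
  apply wp_block. cbn [app wpb eff].
  split; [lia|]; split; [lia|]; intros g1 E1 O1.
  split; [lia|]; split; [rewrite E1, O1, G0; lia|]; intros g2 E2 O2.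
  rewrite E1, O1, G0 in E2 by lia.
  split; [lia|]; split; [lia|]; intros g3 E3 O3.
  assert (M : forall l Q Q' g pos, (forall g' p', Q g' p' -> Q' g' p') -> wpb x y S0 Z l Q g pos -> wpb x y S0 Z l Q' g pos).
  { clear. induction l as [|i l IH]; cbn [wpb]; auto. intros Q Q' g pos H.
    destruct (eff y x i g pos) as [[[r v] p']|]; auto. intros (A & B & H'). repeat split; auto.
    intros g' E O. eapply IH; eauto. }
  eapply M; [|apply (V_powers g3 pos 0 1); auto; rewrite O3, E2; lia].
  clear M. intros g4 p4 (-> & E4 & O4).
  assert (A4 : g4 0 = n) by (rewrite O4, O3, O2, O1; auto).
  assert (B4 : g4 6 = n + 1) by (rewrite O4, O3, E2; lia).
  assert (C4 : forall i, i < NP -> g4 i <= V).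
  { intros i Hi. destruct (Nat.eq_dec i 1) as [->|N1]; [lia|]. rewrite O4, O3 by auto.
    destruct (Nat.eq_dec i 6) as [->|N2]; [lia|]. rewrite O2, O1 by auto. auto. }
  clear g1 g2 g3 E1 O1 E2 O2 E3 O3 O4.
  apply wp_seq. refine (wp_block p x y S0 Z [_;_;_] _ _ _ _). cbn [wpb eff].
  split; [lia|]; split; [lia|]; intros g1 E1 O1.
  split; [lia|]; split; [lia|]; intros g2 E2 O2.
  split; [lia|]; split; [lia|]; intros g3 E3 O3.
  assert (A0 : g3 0 = n) by (rewrite O3, O2, O1; auto).
  assert (A1 : g3 1 = V) by (rewrite O3, O2, O1; auto).
  assert (A2 : g3 2 = 1) by (rewrite O3, O2, E1; auto).
  assert (A3 : g3 3 = 0) by (rewrite O3, E2; auto).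
  assert (A6 : g3 6 = n + 1) by (rewrite O3, O2, O1; auto).
  assert (AV : forall i, i < NP -> g3 i <= V).
  { intros i Hi. destruct (Nat.eq_dec i 7) as [->|N1]; [lia|]. rewrite O3 by auto.
    destruct (Nat.eq_dec i 3) as [->|N2]; [lia|]. rewrite O2 by auto.
    destruct (Nat.eq_dec i 2) as [->|N3]; [lia|]. rewrite O1 by auto. auto. }
  clear g1 g2 g4 E1 O1 E2 O2 O3 A4 B4 C4 E4.
  rename g3 into g1, E3 into A7.
  apply wp_seq. eapply wp_mono; [apply (stage_ok (rootE T) 4 g1 pos b (cost 1 (fun _ => n + 1) (rootE T))); auto| |].
  { lia. } { unfold rootE. cbn [aneed]. rewrite aneed_powX. reflexivity. }
  { unfold rootE. cbn [maxc]. pose proof (maxc_powX 1 T). lia. }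
  { unfold rootE. cbn [scope]. unfold NP. repeat split; try lia. apply scope_powX; lia. }
  { unfold NP; lia. } { apply rootE_value; auto. }
  { unfold rootE. cbn [cost]. rewrite A6, (cost_powX 1 g1 (fun _ => n + 1)). reflexivity. }
  { reflexivity. }
  intros g2 p2 (-> & E2 & L4 & O2).
  assert (X2 : forall i, i < NP -> g2 i <= V).
  { intros i Hi. destruct (Nat.eq_dec i 4) as [->|]; [lia|]. rewrite O2; auto. }
  apply wp_seq. eapply wp_mono; [apply (stage_ok logE 5 g2 pos (Nat.log2 n + 3) (cost 1 (fun _ => n + 1) logE)); auto| |].
  { lia. } { simpl. lia. } { simpl. unfold NP. repeat split; lia. }
  { unfold NP; lia. } 
  { rewrite O2; auto; unfold NP; lia. } { rewrite O2; auto; unfold NP; lia. }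
  { rewrite O2; auto; unfold NP; lia. }
  { apply logE_value; rewrite O2; auto; unfold NP; lia. }
  { unfold logE. cbn [cost]. rewrite O2, A6 by (unfold NP; lia). reflexivity. }
  { reflexivity. }
  intros g3 p3 (-> & E3 & L5 & O3).
  assert (X3 : forall i, i < NP -> g3 i <= V).
  { intros i Hi. destruct (Nat.eq_dec i 5) as [->|]; [lia|]. rewrite O3; auto. }
  assert (Y3 : forall i, i < NP -> i <> 4 -> i <> 5 -> g3 i = g1 i) by (intros; rewrite O3, O2; auto).
  assert (E34 : g3 4 = b) by (rewrite O3; auto; unfold NP; lia).
  pose proof (HVb 1 HT) as Hb2. rewrite Nat.pow_1_r in Hb2.
  assert (HKb : 8 * K * b + 4 <= V).
  { eapply Nat.le_trans; [|exact HSV]. eapply Nat.le_trans; [|exact HS].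
    pose proof (Nat.mul_le_mono_l 1 NA (8 * K * b + 4) HNA). lia. }
  apply wp_seq. eapply wp_mono; [apply (stage_ok (Op Oadd (Par 4) (Par 4)) 8 g3 pos (2 * b) 7); auto| |].
  { simpl; pose proof (stream_d_pos T); lia. } { simpl. lia. } { simpl. unfold NP. repeat split; lia. }
  { rewrite Y3; auto; unfold NP; lia. } { rewrite Y3; auto; unfold NP; lia. }
  { rewrite Y3; auto; unfold NP; lia. }
  { cbn [ev opf]. rewrite E34. lia. }
  { lia. }
  intros g4 p4 (-> & E4 & L8 & O4).
  assert (X4 : forall i, i < NP -> g4 i <= V).
  { intros i Hi. destruct (Nat.eq_dec i 8) as [->|]; [lia|]. rewrite O4; auto. }
  assert (Y4 : forall i, i < NP -> i <> 4 -> i <> 5 -> i <> 8 -> g4 i = g1 i) by (intros; rewrite O4, Y3; auto).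
  assert (E44 : g4 4 = b) by (rewrite O4; auto; unfold NP; lia).
  apply wp_seq. eapply wp_mono; [apply (stage_ok widthE 3 g4 pos (8 * K * b + 3) (cost 1 (fun _ => n + 1) widthE)); auto| |].
  { lia. } { simpl. unfold NP. repeat split; lia. }
  { unfold NP; lia. } 
  { rewrite Y4; auto; unfold NP; lia. } { rewrite Y4; auto; unfold NP; lia. }
  { rewrite Y4; auto; unfold NP; lia. }
  { unfold widthE. cbn [ev opf]. rewrite E44, Y4, A7 by (unfold NP; lia). 
    rewrite (Nat.min_r V (8 * K)) by (pose proof (Nat.mul_le_mono_l 1 b (8 * K) b_pos); lia). rewrite (Nat.min_r V (8 * K * b)) by lia. lia. }
  { reflexivity. }
  intros g5 p5 (-> & E5 & L3 & O5).
  refine (wp_block p x y S0 Z [_;_] _ _ _ _). cbn [wpb eff].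
  split; [lia|]; split; [lia|]; intros g6 E6 O6.
  assert (E63 : g6 3 = 8 * K * b + 3) by (rewrite O6; auto).
  split; [lia|]; split; [rewrite E6, E63; lia|]; intros g7 E7 O7.
  rewrite E6, E63 in E7.
  assert (Y7 : forall i, i < NP -> i <> 2 -> i <> 3 -> g7 i = g4 i) by (intros; rewrite O7, O6, O5; auto).
  assert (E72 : g7 2 = 8 * K * b + 4) by lia.
  assert (E73 : g7 3 = 8 * K * b + 3) by (rewrite O7, O6; auto).
  split; [auto|]. split; [rewrite Y7, Y4; auto; unfold NP; lia|].
  split; [lia|]. split.
  { intros i Hi. destruct (Nat.eq_dec i 2) as [->|]; [lia|]. destruct (Nat.eq_dec i 3) as [->|]; [lia|].
    rewrite Y7; auto. }
  assert (E71 : g7 1 = V) by (rewrite Y7, Y4; auto; unfold NP; lia).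
  split; rewrite ?E71; auto.
  - rewrite Y7, Y4; auto; unfold NP; lia.
  - rewrite Y7; auto; unfold NP; lia.
  - rewrite Y7, O4, E3; auto; unfold NP; lia.
  - rewrite Y7, Y4; auto; unfold NP; lia.
  - rewrite Y7, Y4; auto; unfold NP; lia.
  - rewrite Y7; auto; unfold NP; lia.
  - lia.
Qed.

(** Both strings have length n, so a window of y at distance d from x leaves out at most d symbols
    of y, and 2d bounds the edit distance. Conversely y is itself a window, so d is at most
    [alpha be T] times the edit distance. *)
Lemma algo_ok g NS : g 0 = n -> (forall i, g i <= V) ->
  (forall rho, params rho y n b K T -> stream_cost (rho 2) rho T <= NS) ->
  wp (algo D NA C K T) (prelude_cost n C T + (1 + (NS + cost 0 (fun _ => 0) answerE)))
    (fun g' p' => exists e, is_ED x y e /\ e <= g' (rg 2) /\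
       (INR (g' (rg 2)) <= 2 * alpha be T * INR e)%R) g 0.
Proof.
  intros G0 GV Hcost. pose proof V_bounds as (V0 & V1 & V2 & V3). pose proof b_pos as Hb0.
  assert (HD' : 1 + stream_d T <= D /\ 2 + dneed answerE <= D) by (unfold need_d in HD; lia).
  destruct HD' as [HD1 HD2].
  unfold algo. apply wp_seq. eapply wp_mono; [apply prelude_ok; auto|reflexivity|].
  intros g1 p1 (-> & A1 & A3 & AV & par).
  assert (lay : layout (g1 1) (g1 2) g1 y D NA S0 Z).
  { rewrite A1. pose proof (par_W _ _ _ _ _ _ par) as PW.
    split; [lia|apply le_n|rewrite PW; exact HS|exact HSV|lia|exact HNA|rewrite PW; lia
           |exact AV|exact A1|reflexivity|exact A3|exact HyV]. }
  apply wp_seq. refine (wp_block p x y S0 Z [_] _ _ _ _). cbn [wpb eff].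
  assert (L2 : rg 0 < S0) by (unfold rg, SB in *; lia).
  split; [auto|]; split; [lia|]; intros g2 E2 O2.
  assert (Hbt : b ^ T <= V).
  { eapply Nat.le_trans; [|apply (HVb T); auto]. apply Nat.pow_le_mono_l; lia. }
  apply wp_seq. eapply wp_mono.
  { apply (stream_ok g1 p x y n b K T D NA S0 Z be lay par Hx Hbe Hbe1 ltac:(rewrite A1; auto) T (rg 0) 1 0 0 g2); auto.
    - rewrite A1. simpl. auto.
    - split; simpl; auto; try lia.
      + intros [|i] Hi; [|lia]. split; [unfold rg, SB; lia|split; [exact E2|lia]].
      + intros i Hi. apply O2. unfold rg, SB, NP in *; lia. }
  { apply Hcost; auto. }
  intros g3 p3 (-> & K3 & v & E3 & L3 & Sm).
  assert (Ek : kval g1 v <= n).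
  { pose proof (sm_le _ _ _ _ _ _ _ _ _ Sm) as H. unfold xblock in H. rewrite sub_length in H; lia. }
  assert (Ev : ev (g1 1) (g1 2) g1 y answerE [v] [] = 2 * kval g1 v).
  { unfold answerE, valE, kval. cbn [ev nth opf]. unfold kval in Ek.
    apply Nat.min_r. rewrite A1 in *. lia. }
  eapply wp_mono.
  { apply (comp_ok (g1 1) (g1 2) g1 y D NA p x S0 Z lay answerE [rg 1] [] 2 0 [v] [] g3); auto.
    - simpl. lia.
    - simpl. lia.
    - simpl. unfold NP. lia.
    - split; simpl; auto; try lia.
      + intros [|i] Hi; [|lia]. split; [unfold rg, SB; lia|split; [exact E3|exact L3]].
      + intros i Hi. rewrite K3 by (left; auto). apply O2. unfold rg, SB, NP in *; lia. }
  { reflexivity. }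
  intros g4 p4 (-> & K4 & E4 & L4). rewrite Ev in E4. rewrite E4.
  destruct (is_ED_exists x y) as (e & He). exists e. split; auto.
  destruct (is_ED_al _ _ _ He) as [Ha Hmin].
  assert (EX : xblock x n 0 (b ^ T) = x).
  { unfold xblock. replace (Nat.min 0 n) with 0 by lia.
    replace (Nat.min (0 + b ^ T) n) with n by lia. rewrite <- Hx. apply sub_full. }
  destruct Sm as [_ [S1 S2] _ _ S3 S4]. rewrite EX in S3, S4. split.
  - assert (H : al (klo g1 v + (kval g1 v + (n - kmod g1 v))) x y).
    { rewrite <- (sub_full y), Hn, <- (sub_app y 0 (klo g1 v) n), <- (sub_app y (klo g1 v) (kmod g1 v) n) by lia.
      rewrite <- (app_nil_l x). apply al_app.
      - eapply al_le; [apply al_nil_l|]. rewrite sub_length; lia.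
      - rewrite <- (app_nil_r x). apply al_app; auto.
        eapply al_le; [apply al_nil_l|]. rewrite sub_length; lia. }
    apply Hmin in H. apply al_length in S3 as [_ S3]. rewrite sub_length in S3; lia.
  - rewrite mult_INR. specialize (S4 0 n e ltac:(lia) (le_n _)).
    rewrite <- Hn, sub_full in S4. specialize (S4 Ha). simpl (INR 2). lra.
Qed.

End Algo.

(** * Running time *)

Section Cost.
Variables (W : nat) (rho : nat -> nat).

(** The cost is separated into [weight], which depends on the expression alone and so goes into the
    constant, and [loops], the largest product of nested loop bounds, which carries the dependence
    on n. *)
Fixpoint weight (e : expr) : nat :=
  match e with
  | Cst _ | Par _ | Var _ => 2
  | Op _ e1 e2 | Let e1 e2 => weight e1 + weight e2 + 3
  | If c e1 e2 => weight c + weight e1 + weight e2 + 2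
  | Arr _ e | QY e => weight e + 9
  | Fold _ e0 eb => weight e0 + weight eb + 14
  | AFold _ e0 es er => weight e0 + weight es + weight er + 60
  end.

Fixpoint loops (e : expr) : nat :=
  match e with
  | Cst _ | Par _ | Var _ => 1
  | Op _ e1 e2 | Let e1 e2 => Nat.max (loops e1) (loops e2)
  | If c e1 e2 => Nat.max (loops c) (Nat.max (loops e1) (loops e2))
  | Arr _ e | QY e => loops e
  | Fold N e0 eb => Nat.max (loops e0) (Nat.max 1 (rho N) * loops eb)
  | AFold N e0 es er => Nat.max (W * loops e0) (Nat.max (Nat.max 1 (rho N) * (W * loops es)) (loops er))
  end.

Hypothesis HW : 1 <= W.

Lemma loops_pos e : 1 <= loops e.
Proof.
  induction e; cbn [loops]; try lia.
Qed.

Lemma cost_le e : cost W rho e <= weight e * loops e.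
Proof.
  induction e as [k|i|i|o e1 IH1 e2 IH2|c IHc e1 IH1 e2 IH2|i e IH|e IH|e1 IH1 e2 IH2
                 |N e0 IH0 eb IHb|N e0 IH0 es IHs er IHr]; cbn [cost weight loops]; try lia.
  - set (m := Nat.max (loops e1) (loops e2)).
    assert (weight e1 * loops e1 <= weight e1 * m) by (apply Nat.mul_le_mono_l; lia).
    assert (weight e2 * loops e2 <= weight e2 * m) by (apply Nat.mul_le_mono_l; lia).
    pose proof (loops_pos e1). assert (1 <= m) by lia. lia.
  - set (m := Nat.max (loops c) (Nat.max (loops e1) (loops e2))).
    assert (weight c * loops c <= weight c * m) by (apply Nat.mul_le_mono_l; lia).
    assert (weight e1 * loops e1 <= weight e1 * m) by (apply Nat.mul_le_mono_l; lia).
    assert (weight e2 * loops e2 <= weight e2 * m) by (apply Nat.mul_le_mono_l; lia).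
    pose proof (loops_pos c). assert (1 <= m) by lia. lia.
  - pose proof (loops_pos e). lia.
  - pose proof (loops_pos e). lia.
  - set (m := Nat.max (loops e1) (loops e2)).
    assert (weight e1 * loops e1 <= weight e1 * m) by (apply Nat.mul_le_mono_l; lia).
    assert (weight e2 * loops e2 <= weight e2 * m) by (apply Nat.mul_le_mono_l; lia).
    pose proof (loops_pos e1). assert (1 <= m) by lia. lia.
  - set (m := Nat.max (loops e0) (Nat.max 1 (rho N) * loops eb)).
    assert (weight e0 * loops e0 <= weight e0 * m) by (apply Nat.mul_le_mono_l; lia).
    pose proof (loops_pos e0). assert (1 <= m) by lia.
    assert (rho N * (cost W rho eb + 2 + 5) <= (weight eb + 7) * m).
    { apply Nat.le_trans with (Nat.max 1 (rho N) * ((weight eb + 7) * loops eb)).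
      - apply Nat.mul_le_mono; [lia|]. pose proof (loops_pos eb). lia.
      - rewrite Nat.mul_assoc, (Nat.mul_comm (Nat.max 1 (rho N))), <- Nat.mul_assoc.
        apply Nat.mul_le_mono_l. lia. }
    lia.
  - set (m := Nat.max (W * loops e0) (Nat.max (Nat.max 1 (rho N) * (W * loops es)) (loops er))). unfold fill_cost.
    pose proof (loops_pos e0). pose proof (loops_pos es). pose proof (loops_pos er).
    assert (1 <= m) by lia.
    assert (Hr : weight er * loops er <= weight er * m) by (apply Nat.mul_le_mono_l; lia).
    assert (Hz : W * (cost W rho e0 + 5 + 5) <= (weight e0 + 10) * m).
    { apply Nat.le_trans with (W * ((weight e0 + 10) * loops e0)).
      - apply Nat.mul_le_mono_l. lia.
      - rewrite Nat.mul_assoc, (Nat.mul_comm W), <- Nat.mul_assoc.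
        apply Nat.mul_le_mono_l. lia. }
    assert (Hs : rho N * (1 + (W * (cost W rho es + 5 + 5) + 2) + (1 + (W * (11 + 5 + 5) + 2)) + 5)
        <= (weight es + 42) * m).
    { apply Nat.le_trans with (Nat.max 1 (rho N) * ((weight es + 42) * (W * loops es))).
      - apply Nat.mul_le_mono; [lia|].
        assert (W * (cost W rho es + 5 + 5) <= W * ((weight es + 10) * loops es))
          by (apply Nat.mul_le_mono_l; lia).
        assert (W <= W * loops es) by nia. 
        replace (W * ((weight es + 10) * loops es)) with ((weight es + 10) * (W * loops es)) in * by lia.
        lia.
      - rewrite Nat.mul_assoc, (Nat.mul_comm (Nat.max 1 (rho N))), <- Nat.mul_assoc.
        apply Nat.mul_le_mono_l. lia. }
    lia.
Qed.

Lemma loops_powE i t : loops (powE i t) = 1.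
Proof. induction t; simpl; auto. rewrite IHt; auto. Qed.

Lemma loops_powX i t : loops (powX (Var i) t) = 1.
Proof. induction t; simpl; auto. rewrite IHt; auto. Qed.

End Cost.

Lemma monomial_le a b c d i j k m : 1 <= a -> 1 <= b -> 1 <= c -> 1 <= d ->
  i <= 2 -> j <= 1 -> k <= 2 -> m <= 1 ->
  a ^ i * b ^ j * c ^ k * d ^ m <= a ^ 2 * b ^ 1 * c ^ 2 * d ^ 1.
Proof. intros. repeat apply Nat.mul_le_mono; apply Nat.pow_le_mono_r; lia. Qed.

(** All loop nests met below are monomials bounded by a^2 b c^2 d; the exponents are found by
    trial. *)
Ltac monomial a b c d :=
  let go i j k m := (apply Nat.le_trans with (a ^ i * b ^ j * c ^ k * d ^ m);
    [apply Nat.eq_le_incl; cbn [Nat.pow]; ring|apply monomial_le; auto]) in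
  first [go 0 0 0 0|go 1 0 0 0|go 2 0 0 0|go 1 0 1 0|go 1 1 1 0|go 1 1 2 0|go 1 1 2 1
        |go 0 1 0 0|go 0 0 1 0|go 0 1 1 0|go 0 1 2 0|go 0 1 2 1].

Section Loops.
Variables (rho : nat -> nat).
Hypothesis (H2 : 1 <= rho 2) (H5 : 1 <= rho 5) (H7 : 1 <= rho 7) (H8 : 1 <= rho 8).
Notation W := (rho 2).
Notation nest := (loops (rho 2) rho).

(** A common bound for the nests added by one level: guesses with the doubling loop inside them,
    blocks, and pairs of cut points. *)
Definition unit_cost := rho 5 ^ 2 * rho 8 ^ 1 * W ^ 2.

Lemma loops_costE t : nest (costE t) <= rho 7 * unit_cost ^ t.
Proof.
  induction t as [|t IH].
  - cbn [costE loops costE0 Nat.pow]. lia.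
  - pose proof (loops_pos W rho H2 (costE t)) as HX.
    apply Nat.le_trans with (unit_cost * nest (costE t)).
    + unfold costE; fold costE. cbn [loops pow2E gapE gridE].
      set (X := nest (costE t)) in *. clearbody X.
      rewrite !loops_powE, !(Nat.max_r 1 (rho _)) by auto.
      repeat rewrite ?Nat.max_id, ?Nat.mul_1_r.
      repeat rewrite <- Nat.mul_max_distr_l.
      unfold unit_cost. rewrite <- (Nat.pow_1_r X) at 2.
      repeat apply Nat.max_lub; monomial (rho 5) (rho 8) (rho 2) X.
    + rewrite Nat.pow_succ_r', Nat.mul_assoc, (Nat.mul_comm (rho 7)), <- Nat.mul_assoc.
      apply Nat.mul_le_mono_l. exact IH.
Qed.

(** All left ends and all guesses enclose a grid over the b children. The loops inside it that
    recompute prefix lengths have b <= W rounds, so they fit under the search over pairs of cut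
    points. *)
Lemma loops_mergeE t : 1 <= rho 4 -> 1 <= rho 6 -> rho 4 <= rho 8 -> rho 4 <= W ->
  nest (mergeE t) <= rho 6 * (rho 5 * (unit_cost * nest (costE t))).
Proof.
  intros H4 H6 L1 L2. pose proof (loops_pos W rho H2 (costE t)) as HX.
  apply Nat.le_trans with (rho 6 * (rho 5 * (rho 5 ^ 2 * rho 4 ^ 1 * W ^ 2 * nest (costE t) ^ 1))).
  2: { apply Nat.mul_le_mono_l, Nat.mul_le_mono_l. unfold unit_cost. rewrite !Nat.pow_1_r.
       apply Nat.mul_le_mono_r. apply Nat.mul_le_mono_r. apply Nat.mul_le_mono_l. auto. }
  unfold mergeE. cbn [loops pow2E gapE gridE lenE keyE valE loE hiE modE].
  set (X := nest (costE t)) in *. clearbody X.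
  rewrite !loops_powE, !(Nat.max_r 1 (rho _)) by auto.
  repeat rewrite ?Nat.max_id, ?Nat.mul_1_r.
  repeat rewrite <- Nat.mul_max_distr_l.
  set (U := rho 5 ^ 2 * rho 4 ^ 1 * W ^ 2 * X ^ 1).
  assert (Hout : forall z, z <= U -> rho 5 * (rho 6 * z) <= rho 6 * (rho 5 * U)).
  { intros z Hz. replace (rho 6 * (rho 5 * U)) with (rho 5 * (rho 6 * U)) by ring.
    apply Nat.mul_le_mono_l, Nat.mul_le_mono_l; auto. }
  assert (Hin' : forall z, z <= U -> rho 5 * z <= rho 6 * (rho 5 * U)).
  { intros z Hz. specialize (Hout z Hz). clearbody U. nia. }
  assert (Hin : forall z, z <= U -> z <= rho 6 * (rho 5 * U)).
  { intros z Hz. specialize (Hin' z Hz). clearbody U. nia. }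
  repeat apply Nat.max_lub;
    first [apply Hout|apply Hin'|apply Hin]; unfold U;
    first [monomial (rho 5) (rho 4) (rho 2) X
          |apply Nat.le_trans with (rho 4 * (W * W));
             [apply Nat.mul_le_mono_l, Nat.mul_le_mono_l; auto|monomial (rho 5) (rho 4) (rho 2) X]].
Qed.

End Loops.

(** For b >= 2, b is at most 2(b - 1), and (b - 1)^T < n. *)
Lemma root_pow_le T n b : 1 <= n -> (forall k, k < b -> k ^ T < n) -> b ^ T <= 2 ^ T * n.
Proof.
  intros Hn Hb. pose proof (Nat.pow_nonzero 2 T).
  destruct b as [|[|b]].
  - apply Nat.le_trans with (1 ^ T); [apply Nat.pow_le_mono_l; lia|]. rewrite Nat.pow_1_l. nia.
  - rewrite Nat.pow_1_l. nia.
  - specialize (Hb (S b) ltac:(lia)).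
    apply Nat.le_trans with ((2 * S b) ^ T); [apply Nat.pow_le_mono_l; lia|].
    rewrite Nat.pow_mul_l. apply Nat.mul_le_mono_l. lia.
Qed.

(** The merge dominates: n + 1 left ends, then at most a constant times L^2 b^3 per level, where L
    is the number of guesses. The b children fit under one more such factor. c is chosen before n
    and b. *)
Lemma stream_cost_step K T t : exists c, forall rho y n b, params rho y n b K T ->
  stream_cost (rho 2) rho t <= c * (n * rho 5 * (rho 5 ^ 2 * b ^ 3) ^ t).
Proof.
  induction t as [|t (c & IH)].
  - exists (2 * weight leafE + 3). intros rho y n b par.
    pose proof (par_n _ _ _ _ _ _ par). pose proof (par_6 _ _ _ _ _ _ par).
    pose proof (par_5 _ _ _ _ _ _ par).
    assert (W1 : 1 <= rho 2) by (rewrite (par_W _ _ _ _ _ _ par); lia).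
    cbn [stream_cost Nat.pow].
    pose proof (cost_le (rho 2) rho W1 leafE) as HC.
    assert (HL : loops (rho 2) rho leafE <= 2 * n).
    { unfold leafE, keyE. cbn [loops]. repeat rewrite ?Nat.max_id, ?Nat.mul_1_r. lia. }
    assert (n <= n * rho 5) by nia.
    assert (weight leafE * loops (rho 2) rho leafE <= weight leafE * (2 * (n * rho 5)))
      by (apply Nat.mul_le_mono_l; lia).
    lia.
  (* 288 = 2 * 12^2, from 2b blocks and W = 8Kb + 4 <= 12Kb. *)
  - set (kap := 288 * K * K).
    exists (13 + weight (startE t) + c + weight (mergeE t) * (2 * (K * kap ^ S t))).
    intros rho y n b par. specialize (IH rho y n b par).
    pose proof (par_n _ _ _ _ _ _ par) as Hn. pose proof (par_6 _ _ _ _ _ _ par) as H6.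
    pose proof (par_5 _ _ _ _ _ _ par) as H5. pose proof (par_4 _ _ _ _ _ _ par) as H4.
    pose proof (par_7 _ _ _ _ _ _ par) as H7. pose proof (par_8 _ _ _ _ _ _ par) as H8.
    pose proof (par_b _ _ _ _ _ _ par) as Hb. pose proof (par_K _ _ _ _ _ _ par) as HK.
    pose proof (par_W _ _ _ _ _ _ par) as HW.
    assert (W1 : 1 <= rho 2) by lia.
    cbn [stream_cost]. rewrite H4.
    pose proof (cost_le (rho 2) rho W1 (startE t)) as HS.
    assert (LS : loops (rho 2) rho (startE t) = 1)
      by (unfold startE; cbn [loops]; rewrite loops_powE; reflexivity).
    rewrite LS, Nat.mul_1_r in HS.
    pose proof (cost_le (rho 2) rho W1 (mergeE t)) as HM.
    set (L := rho 5) in *. assert (L1 : 1 <= L) by lia.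
    set (q := L ^ 2 * b ^ 3) in *.
    assert (Hq : b <= q).
    { unfold q. rewrite <- (Nat.mul_1_l b) at 1. apply Nat.mul_le_mono.
      - rewrite <- (Nat.pow_1_l 2). apply Nat.pow_le_mono_l; auto.
      - rewrite <- (Nat.pow_1_r b) at 1. apply Nat.pow_le_mono_r; lia. }
    assert (Hqt : 1 <= q ^ t) by (apply Nat.neq_0_lt_0, Nat.pow_nonzero; lia).
    assert (HLM : loops (rho 2) rho (mergeE t) <= 2 * (K * kap ^ S t) * (n * L * q ^ S t)).
    { eapply Nat.le_trans; [apply loops_mergeE; try lia; nia|].
      assert (HU : unit_cost rho <= kap * q).
      { unfold unit_cost, kap, q. fold L. rewrite H8. 
        apply Nat.le_trans with (L ^ 2 * (2 * b) ^ 1 * (12 * K * b) ^ 2).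
        - apply Nat.mul_le_mono_l. apply Nat.pow_le_mono_l. rewrite HW. nia.
        - cbn [Nat.pow]. nia. }
      assert (HU2 : unit_cost rho * loops (rho 2) rho (costE t) <= K * (kap * q) ^ S t).
      { eapply Nat.le_trans; [apply Nat.mul_le_mono_l; apply loops_costE; lia|].
        rewrite H7. rewrite Nat.mul_assoc, (Nat.mul_comm _ K), <- Nat.mul_assoc.
        apply Nat.mul_le_mono_l. rewrite <- Nat.pow_succ_r'. apply Nat.pow_le_mono_l; auto. }
      fold L. rewrite H6.
      apply Nat.le_trans with ((2 * n) * (L * (K * (kap * q) ^ S t))).
      - apply Nat.mul_le_mono; [lia|]. apply Nat.mul_le_mono_l; auto.
      - rewrite Nat.pow_mul_l. apply Nat.eq_le_incl. ring. }
    set (X := n * L * q ^ S t) in *.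
    assert (HX : b * (n * L * q ^ t) <= X).
    { unfold X. rewrite Nat.pow_succ_r'.
      replace (n * L * (q * q ^ t)) with (q * (n * L * q ^ t)) by ring.
      apply Nat.mul_le_mono_r; auto. }
    assert (HY : 1 <= n * L * q ^ t) by nia.
    assert (HbX : b <= X) by nia.
    apply (Nat.mul_le_mono_l _ _ (weight (mergeE t))) in HLM.
    assert (HB : b * (cost (rho 2) rho (startE t) + (stream_cost (rho 2) rho t + 5) + 5)
       <= (weight (startE t) + c + 10) * X).
    { apply Nat.le_trans with (b * ((weight (startE t) + c + 10) * (n * L * q ^ t))).
      - apply Nat.mul_le_mono_l.
        assert (weight (startE t) + 10 <= (weight (startE t) + 10) * (n * L * q ^ t)) by nia.
        lia.
      - rewrite Nat.mul_assoc, (Nat.mul_comm b), <- Nat.mul_assoc. apply Nat.mul_le_mono_l; auto. }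
    rewrite Nat.mul_assoc in HLM. lia.
Qed.

(** n^4 is n * (b^T)^3 up to a constant; two logarithms come from each of the T levels and one is
    left over. *)
Definition time_unit (T n : nat) : nat := n ^ 4 * (Nat.log2 n + 1) ^ (2 * T + 1).

Lemma time_unit_ge T n : 1 <= n -> n ^ 4 <= time_unit T n.
Proof.
  intros Hn. unfold time_unit. pose proof (Nat.pow_nonzero (Nat.log2 n + 1) (2 * T + 1)). nia.
Qed.

Lemma stream_cost_bound K T : exists c, forall rho y n b, params rho y n b K T ->
  (forall k, k < b -> k ^ T < n) -> stream_cost (rho 2) rho T <= c * time_unit T n.
Proof.
  destruct (stream_cost_step K T T) as (c & Hc).
  exists (c * (3 ^ (2 * T + 1) * (2 ^ T) ^ 3)). intros rho y n b par Hb.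
  eapply Nat.le_trans; [eapply Hc; eauto|]. rewrite <- (Nat.mul_assoc c). apply Nat.mul_le_mono_l.
  pose proof (par_n _ _ _ _ _ _ par) as Hn. rewrite (par_5 _ _ _ _ _ _ par).
  pose proof (root_pow_le T n b Hn Hb) as HR.
  set (l := Nat.log2 n). unfold time_unit. fold l.
  replace (n * (l + 3) * ((l + 3) ^ 2 * b ^ 3) ^ T) with (n * (l + 3) ^ (2 * T + 1) * (b ^ T) ^ 3).
  2: { rewrite Nat.pow_mul_l, <- !Nat.pow_mul_r, (Nat.mul_comm 3 T), Nat.pow_add_r, Nat.pow_1_r. ring. }
  apply Nat.le_trans with (n * (3 * (l + 1)) ^ (2 * T + 1) * (2 ^ T * n) ^ 3).
  - apply Nat.mul_le_mono.
    + apply Nat.mul_le_mono_l, Nat.pow_le_mono_l. lia.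
    + apply Nat.pow_le_mono_l; auto.
  - rewrite !Nat.pow_mul_l. apply Nat.eq_le_incl. cbn [Nat.pow]. ring.
Qed.

Lemma prelude_cost_bound C T : exists c, forall n, 1 <= n -> prelude_cost n C T <= c * time_unit T n.
Proof.
  exists (24 + C + 4 * weight (rootE T) + 4 * weight logE + 4 * weight widthE). intros n Hn.
  pose proof (time_unit_ge T n Hn) as HU. set (U := time_unit T n) in *.
  assert (N2 : (n + 1) * (n + 1) <= 4 * U).
  { apply Nat.le_trans with (4 * n ^ 4); [|lia]. cbn [Nat.pow].
    assert (n * n <= n * (n * (n * (n * 1)))) by nia. nia. }
  unfold prelude_cost, stage_cost.
  assert (H : forall e, loops 1 (fun _ => n + 1) e <= (n + 1) * (n + 1) ->
     cost 1 (fun _ => n + 1) e <= 4 * weight e * U).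
  { intros e He. eapply Nat.le_trans; [apply cost_le; lia|].
    rewrite (Nat.mul_comm 4), <- Nat.mul_assoc. apply Nat.mul_le_mono_l. lia. }
  assert (H1 : loops 1 (fun _ => n + 1) (rootE T) <= (n + 1) * (n + 1)).
  { unfold rootE. cbn [loops]. rewrite loops_powX. nia. }
  assert (H2 : loops 1 (fun _ => n + 1) logE <= (n + 1) * (n + 1)).
  { unfold logE. cbn [loops]. nia. }
  assert (H3 : loops 1 (fun _ => n + 1) widthE <= (n + 1) * (n + 1)).
  { unfold widthE. cbn [loops]. nia. }
  apply H in H1, H2, H3. nia.
Qed.

(** * A decision tree for short inputs *)

(** Needed as a function, because the leaves of the tree hold distances as constants of the program;
    no machine computes it. *)
Definition ED (x y : list nat) : nat :=
  proj1_sig (constructive_indefinite_description _ (is_ED_exists x y)).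

Lemma ED_spec x y : is_ED x y (ED x y).
Proof. unfold ED. apply proj2_sig. Qed.

Definition test (r a : nat) (c1 c2 : code) : code :=
  cseq (block [IConst 2 a; IEq 2 r 2]) (ite 2 c1 c2).

Fixpoint switch (r q : nat) (sub : nat -> code) : code :=
  match q with
  | 0 => block []
  | S q => test r q (sub q) (switch r q sub)
  end.

Fixpoint tree_y (q k i : nat) (acc xs : list nat) : code :=
  match k with
  | 0 => block [IConst 1 (ED xs acc)]
  | S k => cseq (block [IConst 1 i; IQueryY 1 1])
             (switch 1 q (fun a => tree_y q k (S i) (acc ++ [a]) xs))
  end.

Fixpoint tree_x (q k : nat) (acc : list nat) (rest : list nat -> code) : code :=
  match k with
  | 0 => rest acc
  | S k => cseq (block [IReadX 1]) (switch 1 q (fun a => tree_x q k (acc ++ [a]) rest))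
  end.

(* For inputs of a fixed length the program counter can remember both strings. *)
Definition tree (c n : nat) : code :=
  tree_x ((n + 1) ^ c) n [] (fun xs => tree_y ((n + 1) ^ c) n 0 [] xs).

Definition tree_cost (c n : nat) : nat := n * (1 + 4 * (n + 1) ^ c) + (n * (2 + 4 * (n + 1) ^ c) + 1).

Fixpoint dispatch (c k a : nat) (main : code) : code :=
  match k with
  | 0 => main
  | S k => test 0 a (tree c a) (dispatch c k (S a) main)
  end.

Section Tree.
Variables (p : list instr) (x y : list nat) (S0 Z : nat).
Hypothesis (HS : 3 <= S0) (HZ : 1 <= Z).
Notation wp := (wp p x y S0 Z).

Lemma test_ok r a c1 c2 N Q g pos : r <> 2 -> a <= Z ->
  (g r = a -> forall g', (forall j, j <> 2 -> g' j = g j) -> g' 2 <= 1 -> wp c1 N Q g' pos) ->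
  (g r <> a -> forall g', (forall j, j <> 2 -> g' j = g j) -> g' 2 <= 1 -> wp c2 N Q g' pos) ->
  wp (test r a c1 c2) (N + 4) Q g pos.
Proof.
  intros Hr Ha H1 H2. unfold test. replace (N + 4) with (2 + (Nat.max N N + 2)) by lia.
  apply wp_seq. refine (wp_block p x y S0 Z [_;_] _ g pos _). cbn [wpb eff].
  split; [lia|]; split; [lia|]; intros g1 E1 O1.
  assert (B : b2n (g1 r =? g1 2) <= 1) by (destruct (_ =? _); simpl; lia).
  split; [lia|]; split; [lia|]; intros g2 E2 O2.
  rewrite E1, O1 in E2 by auto. rewrite E1, O1 in B by auto.
  assert (O : forall j, j <> 2 -> g2 j = g j) by (intros; rewrite O2, O1; auto).
  apply wp_ite; intros E; rewrite E2 in E.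
  - destruct (Nat.eqb_spec (g r) a); [|simpl in E; congruence]. apply H1; auto. lia.
  - destruct (Nat.eqb_spec (g r) a); [simpl in E; congruence|]. apply H2; auto. lia.
Qed.

Lemma switch_ok r q sub N Q g pos : r <> 2 -> q <= Z -> g r < q ->
  (forall g', (forall j, j <> 2 -> g' j = g j) -> wp (sub (g r)) N Q g' pos) ->
  wp (switch r q sub) (N + 4 * q) Q g pos.
Proof.
  intros Hr Hq Hv H. revert g Hv H; induction q as [|q IH]; intros g Hv H; [lia|].
  cbn [switch]. eapply wp_mono with (N := (N + 4 * q) + 4); [|lia|intros g' p' HQ; exact HQ].
  apply test_ok; auto; [lia| |].
  - intros E g' O _. rewrite E in H. eapply wp_mono; [apply H; auto|lia|auto].
  - intros E g' O _. apply IH; [lia|rewrite O by auto; lia|].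
    intros g'' O'. rewrite (O r) by auto. apply H. intros j Hj. rewrite O', O; auto.
Qed.

Variables (c n : nat).
Hypothesis (Hx : length x = n) (Hy : length y = n)
  (Ax : forall a, In a x -> a < (n + 1) ^ c) (Ay : forall a, In a y -> a < (n + 1) ^ c)
  (HZc : (n + 1) ^ c <= Z) (HZn : n <= Z).

Lemma ED_le_n : ED x y <= n.
Proof.
  destruct (is_ED_al _ _ _ (ED_spec x y)) as [_ H]. rewrite <- (Nat.max_id n).
  rewrite <- Hx at 1. rewrite <- Hy. apply H. apply al_max.
Qed.

Lemma firstn_snoc (l : list nat) i : i < length l -> firstn i l ++ [nth i l 0] = firstn (S i) l.
Proof.
  revert i; induction l as [|a l IH]; intros [|i] H; simpl in *; try lia; auto.
  f_equal. apply IH. lia.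
Qed.

Lemma tree_y_ok k : forall i g pos, i + k = n ->
  wp (tree_y ((n + 1) ^ c) k i (firstn i y) x) (k * (2 + 4 * (n + 1) ^ c) + 1)
    (fun g' p' => g' 1 = ED x y) g pos.
Proof.
  induction k as [|k IH]; intros i g pos Hk; cbn [tree_y].
  - rewrite firstn_all2 by lia. refine (wp_block p x y S0 Z [_] _ g pos _). cbn [wpb eff].
    split; [lia|]. split; [|auto]. pose proof ED_le_n; lia.
  - replace (S k * (2 + 4 * (n + 1) ^ c) + 1)
      with (2 + ((k * (2 + 4 * (n + 1) ^ c) + 1) + 4 * (n + 1) ^ c)) by lia.
    apply wp_seq. refine (wp_block p x y S0 Z [_;_] _ g pos _). cbn [wpb eff].
    split; [lia|]; split; [lia|]; intros g1 E1 O1. rewrite E1.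
    assert (Hyi : nth i y 0 < (n + 1) ^ c) by (apply Ay, nth_In; lia).
    split; [lia|]; split; [lia|]; intros g2 E2 O2.
    apply switch_ok; auto; [lia|].
    intros g3 O3. rewrite E2, firstn_snoc by lia. apply IH. lia.
Qed.

Lemma tree_x_ok k : forall i g, i + k = n ->
  wp (tree_x ((n + 1) ^ c) k (firstn i x) (fun xs => tree_y ((n + 1) ^ c) n 0 [] xs))
    (k * (1 + 4 * (n + 1) ^ c) + (n * (2 + 4 * (n + 1) ^ c) + 1))
    (fun g' p' => g' 1 = ED x y) g i.
Proof.
  induction k as [|k IH]; intros i g Hk; cbn [tree_x].
  - rewrite (firstn_all2 x) by lia. apply (tree_y_ok n 0 g i); lia.
  - eapply wp_mono with (N := 1 + ((k * (1 + 4 * (n + 1) ^ c) + (n * (2 + 4 * (n + 1) ^ c) + 1)) + 4 * (n + 1) ^ c));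
      [|lia|intros g' p' HQ; exact HQ].
    apply wp_seq. refine (wp_block p x y S0 Z [_] _ g i _). cbn [wpb eff].
    assert (Hxi : nth i x 0 < (n + 1) ^ c) by (apply Ax, nth_In; lia).
    split; [lia|]; split; [lia|]; intros g1 E1 O1.
    apply switch_ok; auto; [lia|].
    intros g3 O3. rewrite E1, firstn_snoc by lia. apply IH. lia.
Qed.

Lemma dispatch_small main k : forall a g, a <= n -> n < a + k -> g 0 = n ->
  wp (dispatch c k a main) (tree_cost c n + 4 * k) (fun g' p' => g' 1 = ED x y) g 0.
Proof.
  induction k as [|k IH]; intros a g Ha Hk G0; [lia|]. cbn [dispatch].
  eapply wp_mono with (N := (tree_cost c n + 4 * k) + 4); [|lia|intros g' p' HQ; exact HQ].
  apply test_ok; [lia|lia| |].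
  - intros E g' O _. rewrite <- E, G0. eapply wp_mono; [apply (tree_x_ok n 0 g'); lia| |auto].
    unfold tree_cost; lia.
  - intros E g' O _. apply IH; [lia|lia|rewrite O; auto].
Qed.

(** The tests read nothing of x and disturb only register 2, which keeps a small value, so the main
    code starts with n and the reading position intact. *)
Lemma dispatch_large main N Q k B : 1 <= B ->
  (forall g, g 0 = n -> (forall i, g i <= B) -> wp main N Q g 0) ->
  forall a g, a + k <= n -> g 0 = n -> (forall i, g i <= B) ->
  wp (dispatch c k a main) (N + 4 * k) Q g 0.
Proof.
  intros HB HM. induction k as [|k IH]; intros a g Ha G0 GB; cbn [dispatch].
  - eapply wp_mono; [apply HM; auto|lia|auto].
  - eapply wp_mono with (N := (N + 4 * k) + 4); [|lia|intros g' p' HQ; exact HQ].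
    apply test_ok; [lia|lia| |].
    + intros E. lia.
    + intros E g' O L. apply IH; [lia|rewrite O; auto|].
      intros i. destruct (Nat.eq_dec i 2) as [->|Ne]; [lia|]. rewrite O; auto.
Qed.

End Tree.

(** * Assembling the program *)

Lemma exec_of_wp p x y S0 Z (cd : code) N Q n :
  p = cd 0 ++ [IHalt 1] -> 1 <= S0 -> n <= Z ->
  wp p x y S0 Z cd N Q (get [n]) 0 ->
  exists t d, exec p x y (init n) t (S0 * bitlen Z) d /\ t <= N * tau Z + 1 /\
    exists g' p', Q g' p' /\ d = g' 1.
Proof.
  intros Hp HS HZ H.
  assert (B : bounded S0 Z [n]).
  { split; [simpl; lia|]. intros [|[|i]]; unfold get; simpl; lia. }
  destruct (H 0 [n]) as (m' & p' & R & B' & HQ); auto.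
  { intros i ins E. rewrite Hp. simpl. rewrite nth_error_app1; auto.
    apply nth_error_Some. congruence. }
  destruct (R 1 (get m' 1)) as (t & Ht & He).
  { apply exec_halt.
    - cbn [pc]. rewrite Hp, nth_error_app2 by lia. simpl. rewrite Nat.sub_diag. reflexivity.
    - apply space_bounded; auto. }
  exists t, (get m' 1). split; [exact He|]. split; [exact Ht|]. exists (get m'), p'. auto.
Qed.

Definition program (c N0 D NA C K T : nat) : list instr :=
  dispatch c N0 0 (cseq (algo D NA C K T) (block (mov 1 (rg 2)))) 0 ++ [IHalt 1].

Lemma log2_pow_le a n k : a <= n + 1 -> 1 <= n -> Nat.log2 (a ^ k) <= (Nat.log2 n + 1) * k.
Proof.
  intros Ha Hn. 
  assert (H : a <= 2 ^ (Nat.log2 n + 1)).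
  { destruct (Nat.log2_spec n) as [_ H]; [lia|]. rewrite Nat.add_1_r. lia. }
  apply Nat.le_trans with (Nat.log2 ((2 ^ (Nat.log2 n + 1)) ^ k)).
  - apply Nat.log2_le_mono, Nat.pow_le_mono_l; auto.
  - rewrite <- Nat.pow_mul_r, Nat.log2_pow2; lia.
Qed.

Lemma bitlen_pow_le n k : 1 <= n -> bitlen ((n + 1) ^ k) <= (k + 1) * (Nat.log2 n + 1).
Proof.
  intros Hn. unfold bitlen. pose proof (log2_pow_le (n + 1) n k (le_n _) Hn). lia.
Qed.

Lemma nth_le_of_In (l : list nat) B i : (forall a, In a l -> a < B) -> nth i l 0 <= B.
Proof.
  intros H. destruct (le_lt_dec (length l) i).
  - rewrite nth_overflow; lia.
  - apply Nat.lt_le_incl, H, nth_In; auto.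
Qed.

(** Three registers suffice: n, the last symbol read, and a scratch register. The exponent c + 1
    makes Z at least n even if c = 0. *)
Lemma small_case c N0 D NA C K T n x y :
  n < N0 -> 1 <= n -> length x = n -> length y = n ->
  (forall a, In a x -> a < (n + 1) ^ c) -> (forall a, In a y -> a < (n + 1) ^ c) ->
  exists t d, exec (program c N0 D NA C K T) x y (init n) t (3 * bitlen ((n + 1) ^ (c + 1))) d /\
    t <= (tree_cost c n + 4 * N0) * (1 + 3 * bitlen ((n + 1) ^ (c + 1))) + 1 /\ is_ED x y d.
Proof.
  intros HN Hn Hx Hy Ax Ay. set (Z := (n + 1) ^ (c + 1)).
  pose proof (Nat.pow_nonzero (n + 1) c) as P.
  assert (HZ : (n + 1) ^ c <= Z /\ n <= Z).
  { unfold Z. rewrite Nat.add_1_r with (n := c), Nat.pow_succ_r'. split; nia. }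
  destruct (exec_of_wp (program c N0 D NA C K T) x y 3 Z
     (dispatch c N0 0 (cseq (algo D NA C K T) (block (mov 1 (rg 2)))))
     (tree_cost c n + 4 * N0) (fun g' p' => g' 1 = ED x y) n) as (t & d & He & Ht & g' & p' & HQ & ->);
    auto; try lia.
  - apply dispatch_small; auto; lia.
  - exists t, (g' 1). split; [exact He|]. split; [exact Ht|]. rewrite HQ. apply ED_spec.
Qed.

Lemma least_root T n : 1 <= T -> 1 <= n ->
  exists b, 1 <= b /\ n <= b ^ T /\ forall k, k < b -> k ^ T < n.
Proof.
  intros HT Hn.
  assert (H : exists m, n <= m ^ T).
  { exists n. rewrite <- (Nat.pow_1_r n) at 1. apply Nat.pow_le_mono_r; lia. }
  destruct H as [m H]. revert H.
  induction m as [m IH] using (well_founded_induction lt_wf); intros H.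
  destruct (classic (exists k, k < m /\ n <= k ^ T)) as [(k & Hk & E)|N].
  - apply (IH k); auto.
  - exists m. repeat split; auto.
    + destruct m; [rewrite Nat.pow_0_l in H; lia|lia].
    + intros k Hk. destruct (le_lt_dec n (k ^ T)); auto. destruct N; eauto.
Qed.

Definition cells (D NA K b : nat) : nat := SB + D + (8 * K * b + 4) * NA.

(** V = (n + 1)^(c + 10) is above symbols, keys and the number of registers, the last being at most
    (n + 1)^8; Z = V^2 holds a product before it is cut back. [4 ^ T <= n] gives (2b)^T <= 4^T n <=
    n^2. [Ct] is chosen before the threshold [N0], which the theorem fixes later. *)
Lemma large_case c D NA K T be :
  (forall t, t < T -> (INR ((K + 6) ^ S (S t)) <= be * INR (K ^ S (S t)))%R) -> (0 <= be)%R ->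
  1 <= T -> 1 <= K -> need_d T <= D -> 1 <= NA -> stream_a T <= NA ->
  exists Ct, forall N0 n b x y,
  N0 <= n -> SB + D + NA + K + 4 ^ T + 4 <= n -> length x = n -> length y = n ->
  (forall a, In a x -> a < (n + 1) ^ c) -> (forall a, In a y -> a < (n + 1) ^ c) ->
  1 <= b -> n <= b ^ T -> (forall k, k < b -> k ^ T < n) ->
  exists t d,
    exec (program c N0 D NA (c + 10) K T) x y (init n) t
      (cells D NA K b * bitlen ((n + 1) ^ (2 * (c + 10)))) d /\
    t <= (Ct * time_unit T n + 4 * N0) * (1 + 3 * bitlen ((n + 1) ^ (2 * (c + 10)))) + 1 /\
    exists e, is_ED x y e /\ e <= d /\ (INR d <= 2 * alpha be T * INR e)%R.
Proof.
  intros Hbe Hbe1 HT HK HD HNA HNA'.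
  destruct (stream_cost_bound K T) as (cs & Hcs).
  destruct (prelude_cost_bound (c + 10) T) as (cp & Hcp).
  exists (cp + cs + cost 0 (fun _ => 0) answerE + 3).
  intros N0 n b x y HN Hbig Hx Hy Ax Ay Hb Hbu Hbl.
  assert (Hn : 1 <= n) by lia.
  set (C := c + 10). set (V := (n + 1) ^ C).
  assert (EZ : (n + 1) ^ (2 * C) = V * V)
    by (unfold V; rewrite <- Nat.pow_add_r; f_equal; lia).
  rewrite EZ. set (Z := V * V).
  pose proof (root_pow_le T n b Hn Hbl) as HR.
  assert (HP : forall k, k <= C -> (n + 1) ^ k <= V) by (intros; apply Nat.pow_le_mono_r; lia).
  assert (Hxy : (n + 1) ^ c <= V) by (apply HP; unfold C; lia).
  assert (H4 : (n + 1) ^ 4 <= V) by (apply HP; unfold C; lia).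
  assert (H8 : (n + 1) ^ 8 <= V) by (apply HP; unfold C; lia).
  assert (H4T : 2 ^ T * 2 ^ T <= n) by (rewrite <- Nat.pow_mul_l; simpl (2 * 2); lia).
  assert (H2T : 1 <= 2 ^ T) by (apply Nat.neq_0_lt_0, Nat.pow_nonzero; lia).
  assert (Hbn : b <= n * n).
  { apply Nat.le_trans with (b ^ T).
    - rewrite <- (Nat.pow_1_r b) at 1. apply Nat.pow_le_mono_r; lia.
    - eapply Nat.le_trans; [exact HR|]. apply Nat.mul_le_mono_r. nia. }
  assert (HVb : forall t, t <= T -> (2 * b) ^ t <= V).
  { intros t Ht. apply Nat.le_trans with ((2 * b) ^ T); [apply Nat.pow_le_mono_r; lia|].
    rewrite Nat.pow_mul_l. apply Nat.le_trans with (2 ^ T * (2 ^ T * n)).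
    - apply Nat.mul_le_mono_l; auto.
    - eapply Nat.le_trans; [|exact H4]. rewrite Nat.mul_assoc.
      apply Nat.le_trans with (n * n); [apply Nat.mul_le_mono_r; auto|]. cbn [Nat.pow]. nia. }
  assert (HSV : cells D NA K b <= V).
  { eapply Nat.le_trans; [|exact H8]. unfold cells.
    assert (8 * K * b + 4 <= 8 * ((n + 1) ^ 3)).
    { assert (K * b <= n * (n * n)) by (apply Nat.mul_le_mono; lia). cbn [Nat.pow]. nia. }
    assert (E7 : (8 * K * b + 4) * NA <= 8 * ((n + 1) ^ 3) * (n + 1)) by (apply Nat.mul_le_mono; lia).
    assert (E4 : (n + 1) ^ 3 * (n + 1) = (n + 1) ^ 4) by (cbn [Nat.pow]; ring).
    assert (E8 : (n + 1) ^ 8 = (n + 1) ^ 4 * (n + 1) ^ 4) by (rewrite <- Nat.pow_add_r; reflexivity).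
    assert (E9 : 9 <= (n + 1) ^ 4 /\ n + 1 <= (n + 1) ^ 4).
    { split; [|rewrite <- (Nat.pow_1_r (n + 1)) at 1; apply Nat.pow_le_mono_r; lia].
      apply Nat.le_trans with (3 ^ 4); [simpl; lia|]. apply Nat.pow_le_mono_l; lia. }
    rewrite <- (Nat.mul_assoc 8 ((n + 1) ^ 3)), E4 in E7.
    rewrite E8. remember ((n + 1) ^ 4) as u.
    destruct E9 as [E9 E9']. apply (Nat.mul_le_mono_r _ _ u) in E9. lia. }
  assert (HVn : (n + 1) * ((n + 1) * (n + 1)) + 4 * n + 4 < V).
  { eapply Nat.lt_le_trans; [|exact H4].
    change ((n + 1) ^ 4) with ((n + 1) * ((n + 1) * ((n + 1) * ((n + 1) * 1)))). rewrite Nat.mul_1_r.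
    assert (M : 5 <= n + 1) by lia. remember (n + 1) as m eqn:Em.
    pose proof (Nat.mul_le_mono _ _ _ _ M M) as M2. remember (m * m) as r eqn:Er.
    pose proof (Nat.mul_le_mono_r _ _ (m * r) M). pose proof (Nat.mul_le_mono_l _ _ m M2). lia. }
  assert (HKV : K <= V) by lia.
  assert (VZ : V <= Z).
  { unfold Z. rewrite <- (Nat.mul_1_l V) at 1. apply Nat.mul_le_mono_r. lia. }
  assert (HxV : forall i, nth i x 0 <= V) by (intros; pose proof (nth_le_of_In x _ i Ax); lia).
  assert (HyV : forall i, nth i y 0 <= V) by (intros; pose proof (nth_le_of_In y _ i Ay); lia).
  assert (HSB : SB + 3 <= cells D NA K b) by (unfold cells; nia).
  set (p := program c N0 D NA C K T).
  set (NT := cp + cs + cost 0 (fun _ => 0) answerE + 3).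
  destruct (exec_of_wp p x y (cells D NA K b) Z
     (dispatch c N0 0 (cseq (algo D NA C K T) (block (mov 1 (rg 2)))))
     (NT * time_unit T n + 4 * N0)
     (fun (g' : nat -> nat) (p' : nat) => exists e, is_ED x y e /\ e <= g' 1 /\ (INR (g' 1%nat) <= 2 * alpha be T * INR e)%R) n)
    as (t & d & He & Ht & g' & p' & HQ & ->); auto; try lia.
  - apply (dispatch_large p x y (cells D NA K b) Z) with (n := n) (B := V); auto;
      try (unfold SB in HSB; lia).
    + intros g G0 GV.
      eapply wp_mono with (N := (prelude_cost n C T + (1 + (cs * time_unit T n + cost 0 (fun _ => 0) answerE))) + 2)
        (Q := fun (g' : nat -> nat) (p' : nat) => exists e, is_ED x y e /\ e <= g' 1 /\ (INR (g' 1%nat) <= 2 * alpha be T * INR e)%R).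
      * apply wp_seq. eapply wp_mono.
        { apply (algo_ok p x y n b C K T D NA (cells D NA K b) be) with (NS := cs * time_unit T n); eauto. }
        { reflexivity. }
        intros g1 p1 (e & E1 & E2 & E3). apply wp_bounded. intros B.
        refine (wp_block p x y _ Z [_;_] _ g1 p1 _). cbn [wpb eff].
        split; [unfold s1, SB in *; lia|]; split; [lia|]; intros g2 F2 O2.
        assert (F : g2 (rg 2) + g2 s1 = g1 (rg 2)) by (rewrite F2, O2; unfold rg, SB, s1; lia).
        rewrite F. split; [unfold SB in *; lia|]; split; [auto|]; intros g3 F3 O3.
        exists e. rewrite F3. auto.
      * specialize (Hcp n Hn). fold C in Hcp.
        pose proof (time_unit_ge T n Hn) as HU.
        assert (1 <= time_unit T n).
        { eapply Nat.le_trans; [|exact HU]. apply Nat.neq_0_lt_0, Nat.pow_nonzero; lia. }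
        unfold NT. set (ca := cost 0 (fun _ => 0) answerE). set (U := time_unit T n) in *.
        pose proof (Nat.mul_le_mono_l 1 U ca ltac:(auto)). lia.
      * intros g' p' H. exact H.
    + intros [|[|i]]; unfold get; simpl; lia.
  - exists t, (g' 1). auto.
Qed.

(** * Estimates of the constants, and the theorem *)

Open Scope R_scope.

Lemma exp_pow u m : exp u ^ m = exp (INR m * u).
Proof.
  induction m as [|m IH].
  - simpl. rewrite Rmult_0_l, exp_0. reflexivity.
  - rewrite S_INR, Rmult_plus_distr_r, Rmult_1_l, exp_plus. simpl. rewrite IH. ring.
Qed.

Lemma pow_le_exp u m : 0 <= u -> (1 + u) ^ m <= exp (INR m * u).
Proof. intros Hu. rewrite <- exp_pow. apply pow_incr. pose proof (exp_ineq1_le u). lra. Qed.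

(** Adding 1 makes the recurrence geometric with ratio 1 + be. *)
Lemma alpha_closed be t : alpha be t + 1 = 2 * (1 + be) ^ t.
Proof. induction t as [|t IH]; simpl; [lra|]. nra. Qed.

(** The ratio is 2(1 + 1/(2T)), and (1 + 1/(2T))^T <= exp(1/2) <= 3. *)
Lemma alpha_le T : (1 <= T)%nat -> alpha (1 + / INR T) T <= 6 * 2 ^ T.
Proof.
  intros HT. assert (PT : 0 < INR T) by (apply lt_0_INR; lia).
  pose proof (alpha_closed (1 + / INR T) T) as E.
  assert (H : (1 + (1 + / INR T)) ^ T <= 2 ^ T * 3).
  { replace (1 + (1 + / INR T)) with (2 * (1 + / (2 * INR T))) by (field; lra).
    rewrite Rpow_mult_distr. apply Rmult_le_compat_l; [apply pow_le; lra|].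
    eapply Rle_trans; [apply pow_le_exp|].
    - apply Rlt_le, Rinv_0_lt_compat; lra.
    - replace (INR T * / (2 * INR T)) with (1 / 2) by (field; lra).
      apply Rle_trans with (exp 1); [|apply exp_le_3].
      apply Rlt_le, exp_increasing. lra. }
  lra.
Qed.

(** With m = t + 2 <= T + 1 and K = 6(T + 1)^2, (1 + 6/K)^m <= exp(6m/K) <= exp(u) for u = 1/(T +
    1). Since 1 - u <= exp(-u), this is at most 1/(1 - u) = 1 + 1/T. *)
Lemma accuracy T t : (1 <= T)%nat -> (t < T)%nat ->
  INR ((6 * (T + 1) * (T + 1) + 6) ^ S (S t)) <=
  (1 + / INR T) * INR ((6 * (T + 1) * (T + 1)) ^ S (S t)).
Proof.
  intros HT Ht. rewrite !pow_INR. set (K := (6 * (T + 1) * (T + 1))%nat).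
  set (m := S (S t)). rewrite plus_INR.
  assert (PT : 1 <= INR T) by (apply (le_INR 1); lia).
  assert (EK : INR K = 6 * ((INR T + 1) * (INR T + 1))).
  { unfold K. rewrite !mult_INR, !plus_INR. simpl. ring. }
  replace (INR 6) with 6 by (simpl; lra).
  assert (PK : 0 < INR K) by (rewrite EK; nra).
  replace (INR K + 6) with (INR K * (1 + 6 / INR K)) by (field; lra).
  rewrite Rpow_mult_distr, Rmult_comm. apply Rmult_le_compat_r; [apply pow_le; lra|].
  eapply Rle_trans; [apply pow_le_exp|].
  - apply Rlt_le, Rdiv_lt_0_compat; lra.
  - set (u := / (INR T + 1)).
    assert (Hu : INR m * (6 / INR K) <= u).
    { assert (Hm : INR m <= INR T + 1) by (rewrite <- S_INR; apply le_INR; unfold m; lia).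
      apply Rle_trans with ((INR T + 1) * (6 / INR K)).
      - apply Rmult_le_compat_r; auto. apply Rlt_le, Rdiv_lt_0_compat; lra.
      - rewrite EK. unfold u. right. field. lra. }
    apply Rle_trans with (exp u).
    + destruct Hu as [Hu|Hu]; [left; apply exp_increasing; auto|rewrite Hu; lra].
    + assert (H1 : 1 + - u <= exp (- u)) by apply exp_ineq1_le.
      assert (H2 : 1 - u = INR T / (INR T + 1)) by (unfold u; field; lra).
      rewrite exp_Ropp in H1.
      assert (Pe : 0 < exp u) by apply exp_pos.
      assert (H3 : INR T / (INR T + 1) * exp u <= 1).
      { rewrite <- H2. apply Rmult_le_reg_r with (/ exp u); [apply Rinv_0_lt_compat; auto|].
        rewrite Rmult_assoc, Rinv_r by lra. lra. }
      replace (1 + / INR T) with (/ (INR T / (INR T + 1))) by (field; lra).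
      apply Rmult_le_reg_l with (INR T / (INR T + 1)); [apply Rdiv_lt_0_compat; lra|].
      rewrite Rinv_r; [exact H3|]. apply Rgt_not_eq, Rdiv_lt_0_compat; lra.
Qed.

Lemma root_le T n b : (1 <= T)%nat -> (1 <= n)%nat -> (1 <= b)%nat ->
  (forall k, (k < b)%nat -> (k ^ T < n)%nat) -> INR b <= 2 * Rpower (INR n) (/ INR T).
Proof.
  intros HT Hn Hb H. assert (PT : 0 < INR T) by (apply lt_0_INR; lia).
  assert (Pn : 1 <= INR n) by (apply (le_INR 1); lia).
  assert (P1 : 1 <= Rpower (INR n) (/ INR T)).
  { rewrite <- (Rpower_O (INR n)) by lra. apply Rle_Rpower; auto. apply Rlt_le, Rinv_0_lt_compat; auto. }
  destruct b as [|[|b]]; [lia|simpl; lra|].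
  assert (Pb : 0 < INR (S b)) by (apply lt_0_INR; lia).
  assert (H1 : INR (S b) <= Rpower (INR n) (/ INR T)).
  { specialize (H (S b) ltac:(lia)). apply lt_INR in H. rewrite pow_INR in H.
    replace (INR (S b)) with (Rpower (Rpower (INR (S b)) (INR T)) (/ INR T)).
    - apply Rle_Rpower_l; [apply Rlt_le, Rinv_0_lt_compat; auto|].
      split; [apply exp_pos|]. rewrite Rpower_pow by auto. lra.
    - rewrite Rpower_mult, Rinv_r by lra. apply Rpower_1; auto. }
  rewrite (S_INR (S b)). lra.
Qed.

Lemma exists_nat_above (r : R) : exists N : nat, forall n, (N <= n)%nat -> r <= INR n.
Proof.
  destruct (INR_unbounded r) as [N HN]. exists N. intros n Hn. apply le_INR in Hn. lra.
Qed.

(** n^(d - a) exceeds c as soon as n exceeds c^(1/(d - a)). Constants that depend on delta disappear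
    from the space bound in this way. *)
Lemma power_absorbs c a d : 0 < c -> a < d ->
  exists N : nat, forall n, (1 <= n)%nat -> (N <= n)%nat ->
    c * Rpower (INR n) a <= Rpower (INR n) d.
Proof.
  intros Hc Had. destruct (exists_nat_above (Rpower c (/ (d - a)))) as [N HN].
  exists N. intros n Hn1 Hn. specialize (HN n Hn).
  assert (Pn : 1 <= INR n) by (apply (le_INR 1); lia).
  replace d with ((d - a) + a) at 1 by ring. rewrite Rpower_plus.
  apply Rmult_le_compat_r; [apply Rlt_le, exp_pos|].
  replace c with (Rpower (Rpower c (/ (d - a))) (d - a)).
  - apply Rle_Rpower_l; [lra|]. split; [apply exp_pos|exact HN].
  - rewrite Rpower_mult, Rinv_l by lra. apply Rpower_1; auto.
Qed.

(** [up] is strictly above its argument, which yields the strict inequality 1/T < delta that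
    [power_absorbs] needs. *)
Lemma levels_exist delta : 0 < delta -> exists T : nat,
  (1 <= T)%nat /\ / INR T < delta /\ INR T <= 1 / delta + 1.
Proof.
  intros Hd. assert (P : 0 < 1 / delta) by (apply Rdiv_lt_0_compat; lra).
  destruct (archimed (1 / delta)) as [H1 H2].
  assert (Hz : (0 < up (1 / delta))%Z) by (apply lt_IZR; lra).
  exists (Z.to_nat (up (1 / delta))).
  assert (E : INR (Z.to_nat (up (1 / delta))) = IZR (up (1 / delta))).
  { rewrite INR_IZR_INZ, Z2Nat.id by lia. reflexivity. }
  repeat split.
  - lia.
  - rewrite E. set (U := IZR (up (1 / delta))) in *. apply Rmult_lt_reg_r with U; [lra|].
    rewrite Rinv_l by lra. apply (Rmult_lt_compat_l delta) in H1; [|auto].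
    replace (delta * (1 / delta)) with 1 in H1 by (field; lra). exact H1.
  - rewrite E. lra.
Qed.

Theorem theorem4 :
  exists A : R, 0 < A /\
  forall c : nat,  (* symbols are < (n+1)^c, i.e. storable in O(log n) bits *)
  exists Cs : R, 0 < Cs /\
  forall delta : R, 0 < delta < 1/2 ->
  exists (p : list instr) (Ct : R) (k : nat),
  forall (n : nat) (x y : list nat),
    (1 <= n)%nat -> length x = n -> length y = n ->
    (forall a, In a x -> (a < (n + 1) ^ c)%nat) ->
    (forall a, In a y -> (a < (n + 1) ^ c)%nat) ->
    exists t s d : nat,
      exec p x y (init n) t s d /\
      INR t <= Ct * INR n ^ 4 * INR (Nat.log2 n + 1) ^ k /\
      INR s <= Cs * (Rpower (INR n) delta / delta) * INR (Nat.log2 n + 1) /\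
      exists e : nat, is_ED x y e /\ (e <= d)%nat /\
        INR d <= A * Rpower 2 (1 / delta) * INR e.
Proof.
  (* 24 = 2 * 6 * 2: the doubled answer, the constant of [alpha_le], and 2^T <= 2 * 2^(1/delta). *)
  exists 24. split; [lra|]. intros c.
  (* Dictated by short inputs: three registers of (c + 2)(log2 n + 1) bits. For long inputs the
     constant 1 is enough. *)
  exists (INR (3 * (c + 2))). split; [apply lt_0_INR; lia|].
  intros delta [Hd0 Hd1].
  destruct (levels_exist delta Hd0) as (T & HT & HTd & HTu).
  set (K := (6 * (T + 1) * (T + 1))%nat).
  set (D := need_d T). set (NA := Nat.max 1 (stream_a T)).
  set (be := 1 + / INR T).
  assert (PT : 1 <= INR T) by (apply (le_INR 1); lia).
  assert (Pbe : 0 <= be) by (unfold be; assert (0 < / INR T) by (apply Rinv_0_lt_compat; lra); lra).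
  destruct (large_case c D NA K T be) as (C0 & Hlarge); auto.
  { intros t Ht. apply accuracy; auto. }
  { unfold K; lia. } { unfold NA; lia. } { unfold NA; lia. }
  set (cw := (SB + D + 12 * K * NA)%nat).
  set (C2 := (2 * (c + 10) + 1)%nat).
  (* The constant collects b <= 2 n^(1/T), [cw] registers per unit of b and [C2] logarithms of bits
     per register. *)
  destruct (power_absorbs (2 * INR cw * INR C2) (/ INR T) delta) as (N1 & HN1); auto.
  { assert (0 < INR cw) by (apply lt_0_INR; unfold cw, SB; lia).
    assert (0 < INR C2) by (apply lt_0_INR; unfold C2; lia). nra. }
  set (N0 := Nat.max N1 (SB + D + NA + K + 4 ^ T + 4)).
  set (Cbig := ((C0 + 4 * N0) * (1 + 3 * C2) + 1)%nat).
  set (Csml := ((tree_cost c N0 + 4 * N0) * (1 + 3 * (c + 2)) + 1)%nat).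
  (* Of the 2T + 2 logarithms, 2T + 1 belong to [time_unit] and one is the bit cost of an
     instruction. *)
  exists (program c N0 D NA (c + 10) K T), (INR (Cbig + Csml)), (2 * T + 2)%nat.
  intros n x y Hn Hx Hy Ax Ay.
  set (l := (Nat.log2 n + 1)%nat). assert (Hl : (1 <= l)%nat) by (unfold l; lia).
  assert (Pn : 1 <= INR n) by (apply (le_INR 1); lia).
  assert (Pp : 1 <= Rpower (INR n) delta).
  { rewrite <- (Rpower_O (INR n)) by lra. apply Rle_Rpower; lra. }
  assert (Pq : Rpower (INR n) delta <= Rpower (INR n) delta / delta).
  { rewrite <- (Rmult_1_r (Rpower (INR n) delta)) at 1. apply Rmult_le_compat_l; [lra|].
    rewrite <- Rinv_1. apply Rinv_le_contravar; lra. }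
  assert (P2 : 1 <= Rpower 2 (1 / delta)).
  { rewrite <- (Rpower_O 2) at 1 by lra. apply Rle_Rpower; [lra|].
    apply Rlt_le, Rdiv_lt_0_compat; lra. }
  assert (Ptime : forall t, (t <= (Cbig + Csml) * (n ^ 4 * l ^ (2 * T + 2)))%nat ->
     INR t <= INR (Cbig + Csml) * INR n ^ 4 * INR l ^ (2 * T + 2)).
  { intros t Ht. apply le_INR in Ht. rewrite !mult_INR, !pow_INR in Ht. lra. }
  assert (HX : (1 <= n ^ 4 * l ^ (2 * T + 2))%nat).
  { pose proof (Nat.pow_nonzero n 4). pose proof (Nat.pow_nonzero l (2 * T + 2)). nia. }
  assert (Hlx : (l <= n ^ 4 * l ^ (2 * T + 2))%nat).
  { pose proof (Nat.pow_nonzero n 4).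
    apply Nat.le_trans with (1 * l ^ (2 * T + 2))%nat; [|apply Nat.mul_le_mono_r; lia].
    rewrite Nat.mul_1_l, <- (Nat.pow_1_r l) at 1. apply Nat.pow_le_mono_r; lia. }
  destruct (le_lt_dec N0 n) as [Hbig|Hsmall].
  - destruct (least_root T n HT Hn) as (b & Hb & Hbu & Hbl).
    destruct (Hlarge N0 n b x y Hbig ltac:(unfold N0 in Hbig; lia) Hx Hy Ax Ay Hb Hbu Hbl)
      as (t & d & Hex & Ht & e & He & Hed & Hd).
    pose proof (bitlen_pow_le n (2 * (c + 10)) Hn) as HB. fold l in HB. fold C2 in HB.
    eexists t, _, d. split; [exact Hex|]. split; [|split].
    + apply Ptime. eapply Nat.le_trans; [exact Ht|].
      set (bl := bitlen _) in *.
      assert (E : (n ^ 4 * l ^ (2 * T + 2) = time_unit T n * l)%nat).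
      { unfold time_unit. fold l. replace (2 * T + 2)%nat with (S (2 * T + 1)) by lia.
        rewrite (Nat.pow_succ_r' l). ring. }
      rewrite E in *. set (U := time_unit T n) in *.
      assert (HU : (1 <= U)%nat) by (destruct U; lia).
      apply Nat.le_trans with (Cbig * (U * l))%nat; [|apply Nat.mul_le_mono_r; lia].
      assert (H1 : (1 + 3 * bl <= (1 + 3 * C2) * l)%nat) by lia.
      assert (H2 : (C0 * U + 4 * N0 <= (C0 + 4 * N0) * U)%nat).
      { rewrite Nat.mul_add_distr_r. pose proof (Nat.mul_le_mono_l 1 U (4 * N0) HU). lia. }
      pose proof (Nat.mul_le_mono _ _ _ _ H2 H1) as H3. unfold Cbig.
      replace (((C0 + 4 * N0) * (1 + 3 * C2) + 1) * (U * l))%nat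
        with ((C0 + 4 * N0) * U * ((1 + 3 * C2) * l) + U * l)%nat by ring.
      lia.
    + rewrite mult_INR.
      assert (Hcells : (cells D NA K b <= cw * b)%nat).
      { unfold cells, cw. assert ((8 * K * b + 4) * NA <= 12 * K * NA * b)%nat.
        { replace (12 * K * NA * b)%nat with ((12 * K * b) * NA)%nat by ring.
          apply Nat.mul_le_mono_r. pose proof (Nat.mul_le_mono 1 K 1 b ltac:(unfold K; lia) ltac:(lia)). lia. }
        pose proof (Nat.mul_le_mono_l 1 b (SB + D) ltac:(lia)). lia. }
      apply le_INR in Hcells. rewrite mult_INR in Hcells.
      apply le_INR in HB. rewrite mult_INR in HB.
      pose proof (root_le T n b HT Hn Hb Hbl) as HRb.
      specialize (HN1 n Hn ltac:(unfold N0 in Hbig; lia)).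
      set (r := Rpower (INR n) (/ INR T)) in *.
      assert (0 <= INR cw) by apply pos_INR. assert (0 <= INR C2) by apply pos_INR.
      assert (Pl : 1 <= INR l) by (apply (le_INR 1); auto).
      apply Rle_trans with (INR cw * (2 * r) * (INR C2 * INR l)).
      { apply Rmult_le_compat; [apply pos_INR|apply pos_INR| |exact HB].
        eapply Rle_trans; [exact Hcells|]. apply Rmult_le_compat_l; auto. }
      replace (INR cw * (2 * r) * (INR C2 * INR l)) with (2 * INR cw * INR C2 * r * INR l) by ring.
      apply Rmult_le_compat_r; [lra|].
      apply Rle_trans with (1 * (Rpower (INR n) delta / delta)); [lra|].
      apply Rmult_le_compat_r; [lra|]. apply (le_INR 1). lia.
    + exists e. split; [exact He|]. split; [exact Hed|].
      eapply Rle_trans; [exact Hd|]. apply Rmult_le_compat_r; [apply pos_INR|].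
      pose proof (alpha_le T HT) as HA. fold be in HA.
      assert (H2T : 2 ^ T <= 2 * Rpower 2 (1 / delta)).
      { rewrite <- Rpower_pow by lra.
        apply Rle_trans with (Rpower 2 (1 / delta + 1)); [apply Rle_Rpower; lra|].
        rewrite Rpower_plus, Rpower_1 by lra. lra. }
      lra.
  - destruct (small_case c N0 D NA (c + 10) K T n x y Hsmall Hn Hx Hy Ax Ay) as (t & d & Hex & Ht & He).
    pose proof (bitlen_pow_le n (c + 1) Hn) as HB. fold l in HB.
    replace (c + 1 + 1)%nat with (c + 2)%nat in HB by lia.
    eexists t, _, d. split; [exact Hex|]. split; [|split].
    + apply Ptime. eapply Nat.le_trans; [exact Ht|].
      set (bl := bitlen _) in *.
      assert (HT1 : (tree_cost c n <= tree_cost c N0)%nat).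
      { unfold tree_cost. assert (H : ((n + 1) ^ c <= (N0 + 1) ^ c)%nat) by (apply Nat.pow_le_mono_l; lia).
        apply Nat.add_le_mono; [apply Nat.mul_le_mono; lia|].
        apply Nat.add_le_mono_r, Nat.mul_le_mono; lia. }
      set (X := (n ^ 4 * l ^ (2 * T + 2))%nat) in *.
      apply Nat.le_trans with (Csml * X)%nat; [|apply Nat.mul_le_mono_r; lia].
      assert (H1 : (1 + 3 * bl <= (1 + 3 * (c + 2)) * X)%nat).
      { assert (bl <= (c + 2) * X)%nat by (eapply Nat.le_trans; [exact HB|apply Nat.mul_le_mono_l; auto]). lia. }
      assert (H2 : (tree_cost c n + 4 * N0 <= tree_cost c N0 + 4 * N0)%nat) by lia.
      pose proof (Nat.mul_le_mono _ _ _ _ H2 H1) as H3. unfold Csml.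
      replace (((tree_cost c N0 + 4 * N0) * (1 + 3 * (c + 2)) + 1) * X)%nat
        with ((tree_cost c N0 + 4 * N0) * ((1 + 3 * (c + 2)) * X) + X)%nat by ring.
      lia.
    + apply (Nat.mul_le_mono_l _ _ 3) in HB. apply le_INR in HB.
      replace (3 * ((c + 2) * l))%nat with ((3 * (c + 2)) * l)%nat in HB by ring.
      rewrite (mult_INR (3 * (c + 2)) l) in HB.
      eapply Rle_trans; [exact HB|]. apply Rmult_le_compat_r; [apply pos_INR|].
      rewrite <- (Rmult_1_r (INR (3 * (c + 2)))) at 1. apply Rmult_le_compat_l; [apply pos_INR|lra].
    + exists d. split; [exact He|]. split; [lia|].
      rewrite <- (Rmult_1_l (INR d)) at 1. apply Rmult_le_compat_r; [apply pos_INR|lra].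
Qed.
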